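(* Let $n\ge2$ and $(G,G')=(GL(n+1,\mathbb R),GL(n,\mathbb R))$. For $\boldsymbol\alpha=(\alpha_1,\alpha_2),\boldsymbol\beta=(\beta_1,\beta_2)\in\{\pm\}^2$, $\varpi\in\mathrm{Irr}(SL(n-1,\mathbb R))_{\mathrm{fin}}$ and $\boldsymbol\lambda=(\lambda_1,\lambda_2),\boldsymbol\nu=(\nu_1,\nu_2)\in\mathbb C^2$, $$\mathrm{Diff}_{G'}(I(\mathrm{triv};\boldsymbol\lambda)^{\boldsymbol\alpha},J(\varpi;\boldsymbol\nu)^{\boldsymbol\beta})=\begin{cases}\mathbb C\,\mathbb D_{(m,0)}&\text{if }(\boldsymbol\alpha,\boldsymbol\beta;\varpi;\boldsymbol\lambda,\boldsymbol\nu)\in\Lambda_1,\\ \mathbb C\,\mathbb D_{(m,\ell)}&\text{if }(\boldsymbol\alpha,\boldsymbol\beta;\varpi;\boldsymbol\lambda,\boldsymbol\nu)\in\Lambda_2,\\ \{0\}&\text{otherwise.}\end{cases}$$ Here $\Lambda_1$ is the set of parameters with $$\boldsymbol\beta=(\alpha_1+m,\alpha_2),\quad\varpi=\mathrm{triv},\quad\boldsymbol\nu=(\lambda_1+m,\lambda_2)\qquad(\alpha_j\in\{\pm\},\ \lambda_j\in\mathbb C,\ m\in\mathbb Z_{\ge0}),$$ and $\Lambda_2$ is the set of parameters with $$\boldsymbol\beta=(\alpha_1+m+\ell,\alpha_2),\quad\varpi=\mathrm{poly}^\ell_{n-1},\quad\boldsymbol\lambda=(1-(m+\ell),\lambda_2),\quad\boldsymbol\nu=(1+\tfrac{\ell}{n-1},\lambda_2-\tfrac{\ell}{n-1})$$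 ($\alpha_j\in\{\pm\}$, $\lambda_2\in\mathbb C$, $\ell,m\in\mathbb Z_{\ge0}$); $m,\ell$ in the formula are the integers in these descriptions.
   Context: Groups: $G=GL(n+1,\mathbb R)$, $G'=\{\mathrm{diag}(g',1):g'\in GL(n,\mathbb R)\}$; $P=\mathrm{Stab}_G(\mathbb R(1,0,\dots,0)^t)$, $P'=G'\cap P$, so $G/P\simeq\mathbb{RP}^n$, $G'/P'\simeq\mathbb{RP}^{n-1}$. Langlands decompositions $P=MAN_+$, $P'=M'A'N'_+$: $M=\{\mathrm{diag}(\epsilon,g):\epsilon=\pm1,\ g\in SL^\pm(n,\mathbb R)\}$, $M'=\{\mathrm{diag}(\epsilon,g',1):\epsilon=\pm1,\ g'\in SL^\pm(n-1,\mathbb R)\}$ with $SL^\pm(k,\mathbb R)=\{\det=\pm1\}$ ($SL^\pm(1,\mathbb R)=\{\pm1\}$); $A=\exp(\mathbb R\widetilde H_0)\exp(\mathbb RJ_0)$, $A'=\exp(\mathbb R\widetilde H_0')\exp(\mathbb RJ_0')$ with $\widetilde H_0=\frac1n\mathrm{diag}(n,-1,\dots,-1)$, $\widetilde H'_0=\frac1{n-1}\mathrm{diag}(n-1,-1,\dots,-1,0)$, $J_0=\frac1n\mathrm{diag}(0,1,\dots,1)$, $J_0'=\frac1{n-1}\mathrm{diag}(0,1,\dots,1,0)$; with $N_j^+=E_{1,j+1}$, $N_j^-=E_{j+1,1}$, $N_\pm=\exp(\mathrm{span}_{\mathbb R}\{N_1^\pm,\dots,N_n^\pm\})$, $N_\pm'=\exp(\mathrm{span}_{\mathbb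 R}\{N_1^\pm,\dots,N_{n-1}^\pm\})$. Signs: $\{\pm\}\equiv\{\pm1\}$; $\delta+k$ denotes the sign $\delta\cdot(-1)^k$; $\mathrm{sgn}^+(b)=1$, $\mathrm{sgn}^-(b)=\mathrm{sgn}(b)$. Representations: $\mathbb C_{(\lambda_1,\lambda_2)}$ is the character $\exp(t_1\widetilde H_0)\exp(t_2J_0)\mapsto e^{\lambda_1t_1+\lambda_2t_2}$ of $A$; $\mathbb C_{(\nu_1,\nu_2)}$ is $\exp(t_1\widetilde H_0')\exp(t_2J_0')\mapsto e^{\nu_1t_1+\nu_2t_2}$ on $A'$. $\mathrm{Irr}(\cdot)_{\mathrm{fin}}$: equivalence classes of finite-dimensional irreducible complex representations. The representation $\mathbb C_{\beta_1}\boxtimes(\mathbb C_{\beta_2}\otimes\varpi)$ of $M'$ is $\mathrm{diag}(\epsilon,g',1)\mapsto\mathrm{sgn}^{\beta_1}(\epsilon)\,\mathrm{sgn}^{\beta_2}(\det g')\,\varpi(g')$, with $\varpi\in\mathrm{Irr}(SL(n-1,\mathbb R))_{\mathrm{fin}}$ extended to $SL^\pm(n-1,\mathbb R)$; similarly for $M$. $\mathrm{poly}^\ell_{n-1}$ is the representation on $\mathbb C^\ell[y_1,\dots,y_{n-1}]$ (homogeneous of degree $\ell$), extended to $SL^\pm(n-1,\mathbb R)$ by $(g\cdot p)(v)=p(g^{-1}v)$. For $n=2$ one reads a label with $\varpi=\mathrm{poly}^\ell_1$ through this convention: as a representation of $SL^\pm(1,\mathbb R)=\{\pm1\}$, $\mathbb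 C_{\beta_2+\ell}\otimes\mathrm{poly}_1^\ell=\mathbb C_{\beta_2}\otimes\mathrm{triv}$ (with $\mathbb Cy_1^\ell\simeq\mathbb C$). $I(\mathrm{triv};\boldsymbol\lambda)^{\boldsymbol\alpha}=\mathrm{Ind}_P^G(\mathbb C_{\alpha_1}\boxtimes\mathbb C_{\alpha_2}\boxtimes\mathbb C_{(\lambda_1,\lambda_2)})$, $J(\varpi;\boldsymbol\nu)^{\boldsymbol\beta}=\mathrm{Ind}_{P'}^{G'}(\mathbb C_{\beta_1}\boxtimes(\mathbb C_{\beta_2}\otimes\varpi)\boxtimes\mathbb C_{(\nu_1,\nu_2)})$: unnormalized smooth induction, $\mathrm{Ind}_P^G(\sigma)=\{f\in C^\infty(G,V):f(gp)=\sigma(p)^{-1}f(g)\}$ with left translation, $N_+,N'_+$ acting trivially. $\mathrm{Diff}_{G'}(I,J)$ is the space of $G'$-intertwining differential operators $I\to J$, where, for the inclusion $\iota:G'/P'\hookrightarrow G/P$, a continuous linear map $\mathbb D$ of smooth sections is a differential operator if $\iota(\mathrm{Supp}(\mathbb Df))\subset\mathrm{Supp}f$ for all $f$. Coordinates: via $\mathbb R^n\simeq N_-$, $x\mapsto\exp(\sum x_jN_j^-)$, $\mathbb R^{n-1}=\{x_n=0\}\simeq N_-'$, sections are regarded as elements of $C^\infty(\mathbb R^n)$ and $C^\infty(\mathbb R^{n-1})\otimes W$. $\mathbb D_{(m,\ell)}=\mathrm{Rest}_{x_n=0}\circ\frac{\partial^m}{\partial x_n^m}\sum_{\mathbf l}\frac{\partial^\ell}{\partial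 x^{\mathbf l}}\otimes\widetilde y_{\mathbf l}$, the sum over $\mathbf l\in(\mathbb Z_{\ge0})^{n-1}$, $|\mathbf l|=\ell$, with $\frac{\partial^\ell}{\partial x^{\mathbf l}}=\prod_{j<n}\partial_{x_j}^{\ell_j}$, $\widetilde y_{\mathbf l}=\prod_{j<n}y_j^{\ell_j}/\ell_j!$, $(\mathrm{Rest}_{x_n=0}f)(x')=f(x',0)$; $\mathbb D_{(m,0)}=\mathrm{Rest}_{x_n=0}\circ\frac{\partial^m}{\partial x_n^m}$. *)

(* Defs.v *)
From HB Require Import structures.
From mathcomp Require Import all_boot all_order all_algebra.
From mathcomp Require Import all_classical all_reals all_analysis.
From mathcomp Require Import complex.
From mathcomp Require Export -(notations) mpoly.
Set Implicit Arguments. Unset Strict Implicit. Unset Printing Implicit Defensive.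
Import Order.TTheory GRing.Theory Num.Theory.
Import numFieldNormedType.Exports.
Local Open Scope classical_set_scope.
Local Open Scope ring_scope.
Local Open Scope complex_scope.

(* R is an arbitrary model of the real numbers and R[i] its complex numbers.
   A sign in {+,-} is a boolean: false is +, true is -;
   the sign "delta + k" is delta (+) odd k. *)

Section Scalars.
Variable R : realType.

Definition sgnpow (d : bool) (b : R) : R := if d then Num.sg b else 1.

Definition cexp (z : R[i]) : R[i] :=
  (expR (complex.Re z) * cos (complex.Im z)) +i*
  (expR (complex.Re z) * sin (complex.Im z)).

(* The real coordinates of a vector of a complex vector space; the boolean
   selects the imaginary part. *)
Definition rcoord (W : vectType R[i]) (c : 'I_(\dim {:W}) * bool) (w : W) : R :=
  let z := coord (vbasis {:W}) c.1 w in
  if c.2 then complex.Im z else complex.Re z.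

End Scalars.

Section SmoothFunctions.
Variables (R : realType) (m n : nat).
Implicit Types (f : 'M[R]_(m, n) -> R) (s : seq ('I_m * 'I_n)).

Definition pderiv (ij : 'I_m * 'I_n) f : 'M[R]_(m, n) -> R :=
  fun x => 'D_(delta_mx ij.1 ij.2) f x.

Definition pderivs s f : 'M[R]_(m, n) -> R := foldr pderiv f s.

Definition smooth_on (U : set 'M[R]_(m, n)) f : Prop :=
  forall s x, U x ->
    {for x, continuous (pderivs s f)} /\
    forall ij, derivable (pderivs s f) x (delta_mx ij.1 ij.2).

Definition vsmooth_on (W : vectType R[i]) (U : set 'M[R]_(m, n))
    (f : 'M[R]_(m, n) -> W) : Prop :=
  forall c, smooth_on U (fun x => rcoord c (f x)).

(* h lies in the basic neighbourhood of f, for the topology of uniform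
   convergence of all derivatives on compact sets, given by K, k and e. *)
Definition smooth_close (W : vectType R[i]) (K : set 'M[R]_(m, n)) (k : nat)
    (e : R) (f h : 'M[R]_(m, n) -> W) : Prop :=
  forall c s x, (size s <= k)%N -> K x ->
    `|pderivs s (fun y => rcoord c (h y)) x
      - pderivs s (fun y => rcoord c (f y)) x| < e.

Definition cpderiv (ij : 'I_m * 'I_n) (F : 'M[R]_(m, n) -> R[i]) :
    'M[R]_(m, n) -> R[i] :=
  fun x => pderiv ij (fun y => complex.Re (F y)) x
       +i* pderiv ij (fun y => complex.Im (F y)) x.

End SmoothFunctions.

Section Groups.
Variable R : realType.

Definition GL q : set 'M[R]_q := [set g | g \in unitmx].
Definition SL q : set 'M[R]_q := [set g | \det g = 1].
Definition SLpm q : set 'M[R]_q := [set g | \det g = 1 \/ \det g = -1].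

(* Subgroups of GL(q+1) attached to the stabilizer of the first coordinate
   line; they are used for q = n and q = n-1. *)
Variable q : nat.

Definition elM (e : R) (g : 'M[R]_q) : 'M[R]_q.+1 :=
  block_mx (e%:M : 'M[R]_1) 0 0 g.

(* exp (t H0) with H0 = diag(q,-1,...,-1)/q, and
   exp (t J0) with J0 = diag(0,1,...,1)/q. *)
Definition expH (t : R) : 'M[R]_q.+1 :=
  block_mx ((expR t)%:M : 'M[R]_1) 0 0 (expR (- t / q%:R))%:M.
Definition expJ (t : R) : 'M[R]_q.+1 :=
  block_mx (1%:M : 'M[R]_1) 0 0 (expR (t / q%:R))%:M.

(* exp (\sum_j b_j N_j^+) and exp (\sum_j x_j N_j^-): the exponents have
   square 0. *)
Definition expNp (b : 'rV[R]_q) : 'M[R]_q.+1 :=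
  block_mx (1%:M : 'M[R]_1) b 0 1%:M.
Definition expNm (x : 'cV[R]_q) : 'M[R]_q.+1 :=
  block_mx (1%:M : 'M[R]_1) 0 x 1%:M.

(* g' |-> diag(g', 1) and x' |-> (x', 0). *)
Definition embG (g : 'M[R]_q) : 'M[R]_q.+1 :=
  castmx (addn1 q, addn1 q) (block_mx g 0 0 (1%:M : 'M[R]_1)).
Definition embx (x : 'cV[R]_q) : 'cV[R]_q.+1 :=
  castmx (addn1 q, erefl 1%N) (col_mx x (0 : 'cV[R]_1)).

End Groups.

Section Representations.
Variables (R : realType) (q : nat).

(* A continuous representation of SL^{+-}(q,R) on W whose restriction to
   SL(q,R) is irreducible, that is, an element of Irr(SL(q,R))_fin together
   with an extension to SL^{+-}(q,R).  Values off SL^{+-}(q,R) are junk. *)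
Record irr_rep (W : vectType R[i]) (rho : 'M[R]_q -> 'End(W)) : Prop := {
  irr_rep1 : rho 1%:M = \1%VF;
  irr_repM : forall g h, SLpm g -> SLpm h ->
    rho (g *m h) = (rho g \o rho h)%VF;
  irr_rep_cont : forall (w : W) c,
    {within @SLpm R q, continuous (fun g => rcoord c (rho g w))};
  irr_rep_neq0 : {:W}%VS <> 0%VS;
  irr_rep_irr : forall U : {vspace W},
    (forall g, SL g -> (rho g @: U <= U)%VS) -> U = 0%VS \/ U = {:W}%VS }.

Definition triv_rep (_ : 'M[R]_q) : 'End(R[i]^o) := \1%VF.

(* (g . p)(v) = p(g^-1 v): the variable y_j is replaced by
   \sum_k (g^-1)_jk y_k. *)
Definition subst_inv (g : 'M[R]_q) (p : mpoly q R[i]) : mpoly q R[i] :=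
  comp_mpoly [tuple \sum_(k < q) (invmx g j k)%:C *: mpolyX R[i] (mnm1 k) | j < q] p.

Lemma subst_inv_homog l g (p : dhomog q R[i] l) :
  subst_inv g p \is ishomog1 l mdeg.
Proof.
rewrite /subst_inv comp_mpolyE big_seq; apply: rpred_sum => /= m mp.
have ml : mdeg m = l := dhomog_mf (dhomog_is_dhomog p) mp.
apply: dhomogZ.
suff : \prod_(i < q) tnth [tuple \sum_(k < q) (invmx g j k)%:C *:
    mpolyX R[i] (mnm1 k) | j < q] i ^+ m i \is ishomog1 (mdeg m) mdeg.
  by rewrite ml.
rewrite mdegE; elim/big_rec2 : _ => [|j d a _ ha]; first exact: dhomog1.
apply: dhomogM => //.
suff h : tnth [tuple \sum_(k < q) (invmx g j k)%:C *:
    mpolyX R[i] (mnm1 k) | j < q] j \is ishomog1 1 mdeg.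
  by have := dhomogMn (m j) h; rewrite mul1n.
rewrite tnth_mktuple; apply: rpred_sum => k _; apply: dhomogZ.
by rewrite dhomogX; apply/eqP; exact: mdeg1.
Qed.

Definition poly_rep l (g : 'M[R]_q) (p : dhomog q R[i] l) : dhomog q R[i] l :=
  DHomog (subst_inv_homog g p).

(* C_{d1} (x) rho1 and C_{d2} (x) rho2 are isomorphic, through T, as
   representations of SL^{+-}(q,R). *)
Definition twist_iso (d1 : bool) (U : lmodType R[i]) (rho1 : 'M[R]_q -> U -> U)
    (d2 : bool) (V : lmodType R[i]) (rho2 : 'M[R]_q -> V -> V)
    (T : {linear U -> V}) : Prop :=
  bijective T /\
  forall g u, SLpm g ->
    T ((sgnpow d1 (\det g))%:C *: rho1 g u)
    = (sgnpow d2 (\det g))%:C *: rho2 g (T u).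

(* The value of C_{b1} (x) (C_{b2} (x) rho) (x) C_lam at
   diag(e,g) exp(t1 H0) exp(t2 J0). *)
Definition inducing (W : vectType R[i]) (rho : 'M[R]_q -> 'End(W))
    (b : bool * bool) (lam : R[i] * R[i]) (e : R) (g : 'M[R]_q) (t1 t2 : R) :
    'End(W) :=
  ((sgnpow b.1 e * sgnpow b.2 (\det g))%:C
    * cexp (lam.1 * t1%:C + lam.2 * t2%:C)) *: rho g.

(* The representation space of the unnormalized smooth induction to GL(q+1)
   from the stabilizer of the first coordinate line.  Functions on GL(q+1) are
   encoded as functions on all matrices that vanish off GL(q+1). *)
Definition Ind (W : vectType R[i]) (rho : 'M[R]_q -> 'End(W))
    (b : bool * bool) (lam : R[i] * R[i]) : set ('M[R]_q.+1 -> W) :=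
  [set f | [/\ vsmooth_on (@GL R q.+1) f,
    forall g, ~ GL g -> f g = 0 &
    forall g e g0 t1 t2 y, GL g -> e = 1 \/ e = -1 -> SLpm g0 ->
      f (g *m (elM e g0 *m expH q t1 *m expJ q t2 *m expNp y))
      = ((inducing rho b lam e g0 t1 t2)^-1)%VF (f g)]].

End Representations.

Section SymmetryBreaking.
Variable R : realType.

Definition ltransl q (W : vectType R[i]) (h : 'M[R]_q) (f : 'M[R]_q -> W) :
    'M[R]_q -> W :=
  fun g => f (invmx h *m g).

(* Preimage in GL(q) of the support of a section: the closure is taken in
   GL(q), and f vanishes off GL(q). *)
Definition supp q (W : vectType R[i]) (f : 'M[R]_q -> W) : set 'M[R]_q :=
  closure [set g | f g != 0] `&` @GL R q.

Variables (p : nat) (V W : vectType R[i]).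
Variables (I : set ('M[R]_p.+2 -> V)) (J : set ('M[R]_p.+1 -> W)).
Local Notation op := (('M[R]_p.+2 -> V) -> ('M[R]_p.+1 -> W)).

(* Diff_{G'}(I,J) for G = GL(p+2), G' = GL(p+1).  An operator is represented by
   a function D whose values outside I are irrelevant. *)
Record Diff (D : op) : Prop := {
  Diff_to : forall f, I f -> J (D f);
  Diff_linear : forall (a : R[i]) f h, I f -> I h ->
    D (fun g => a *: f g + h g) = (fun g => a *: D f g + D h g);
  Diff_continuous : forall f, I f ->
    forall (K' : set 'M[R]_p.+1) (k' : nat) (e : R),
      compact K' -> K' `<=` @GL R p.+1 -> 0 < e ->
    exists (K : set 'M[R]_p.+2) (k : nat) (d : R),
      [/\ compact K, K `<=` @GL R p.+2, 0 < d &
      forall h, I h -> smooth_close K k d f h -> smooth_close K' k' e (D f) (D h)];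
  Diff_local : forall f, I f ->
    forall g, supp (D f) g -> supp f (embG g);
  Diff_intertwining : forall f h, I f -> GL h ->
    D (ltransl (embG h) f) = ltransl h (D f) }.

Definition Diff_trivial : Prop :=
  forall D, Diff D <-> forall f, I f -> D f = (fun=> 0).

(* Diff_{G'}(I,J) = C E, where E is the expression of an operator in the
   coordinates x |-> exp (\sum_j x_j N_j^-); since N_- P is dense in G, DD is
   determined on I by E. *)
Definition Diff_spanned (E : ('cV[R]_p.+1 -> V) -> ('cV[R]_p -> W)) : Prop :=
  exists DD : op,
    [/\ Diff DD,
      forall f x, I f -> DD f (expNm x) = E (fun y => f (expNm y)) x &
      forall D, Diff D <->
        exists c : R[i], forall f, I f -> D f = (fun g => c *: DD f g)].

End SymmetryBreaking.

Section Operators.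
Variables (R : realType) (p : nat).
Implicit Types (F : 'cV[R]_p.+1 -> R[i]).

(* Partial derivatives with respect to x_n, and to the multi-index l in the
   remaining coordinates x_1, ..., x_(n-1), where n = p + 1. *)
Definition dlast (m : nat) F : 'cV[R]_p.+1 -> R[i] :=
  iter m (cpderiv (ord_max, ord0)) F.

Definition dfirst (l : multinom p) F : 'cV[R]_p.+1 -> R[i] :=
  foldr (fun j : 'I_p => iter (l j) (cpderiv (widen_ord (leqnSn p) j, ord0)))
    F (enum 'I_p).

Definition opD0 (m : nat) F (x : 'cV[R]_p) : R[i]^o := dlast m F (embx x).

Definition ytilde (l : multinom p) : mpoly p R[i] :=
  ((\prod_(j < p) ((l j)`!)%:R)^-1 : R[i]) *: mpolyX R[i] l.

Definition opD_mpoly (m l : nat) F (x : 'cV[R]_p) : mpoly p R[i] :=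
  \sum_(k : bmultinom p l.+1 | mdeg k == l)
    dlast m (dfirst k F) (embx x) *: ytilde k.

Lemma opD_mpoly_homog m l F x : opD_mpoly m l F x \is ishomog1 l mdeg.
Proof.
by apply: rpred_sum => k kl; do 2 apply: dhomogZ; rewrite dhomogX.
Qed.

Definition opD (m l : nat) F (x : 'cV[R]_p) : dhomog p R[i] l :=
  DHomog (opD_mpoly_homog m l F x).

End Operators.

Section Labels.
Variables (R : realType) (p : nat) (alpha beta : bool * bool).
Variables (W : vectType R[i]) (rho : 'M[R]_p -> 'End(W)).
Variables (lam nu : R[i] * R[i]).

(* Here p = n - 1.  The labels (beta_2, varpi) and (alpha_2, triv), resp.
   (alpha_2, poly^l), are equal when the representations of SL^{+-}(p,R) they
   denote are isomorphic: the extension of varpi from SL to SL^{+-} is only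
   defined up to a twist by sgn(det), and for p = 1 all poly^l agree on SL.
   T is such an isomorphism, used to identify the targets of the operators. *)
Definition Lambda1 (m : nat) (T : {linear R[i]^o -> W}) : Prop :=
  [/\ beta.1 = alpha.1 (+) odd m,
      twist_iso alpha.2 (@triv_rep R p) beta.2 rho T &
      nu = (lam.1 + m%:R, lam.2)].

Definition Lambda2 (m l : nat) (T : {linear dhomog p R[i] l -> W}) : Prop :=
  [/\ beta.1 = alpha.1 (+) odd (m + l)%N,
      twist_iso alpha.2 (@poly_rep R p l) beta.2 rho T,
      lam.1 = 1 - (m + l)%:R &
      nu = (1 + l%:R / p%:R, lam.2 - l%:R / p%:R)].

End Labels.

(* Main.v *)
Require Import Defs.
From HB Require Import structures.
From mathcomp Require Import all_boot all_order all_algebra.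
From mathcomp Require Import all_classical all_reals all_analysis.
From mathcomp Require Import complex.
From mathcomp Require Import ring lra.
Set Implicit Arguments. Unset Strict Implicit. Unset Printing Implicit Defensive.
Import Order.TTheory GRing.Theory Num.Theory.
Import numFieldNormedType.Exports.
Local Open Scope classical_set_scope.
Local Open Scope ring_scope.
Local Open Scope complex_scope.

(** A section in I is determined by its expression in the coordinates x, and every
    germ at x = 0 extends to a section.  An intertwining operator D is determined
    by the functional f |-> D f 1, which depends on the germ of f at 0 only since
    D is local.  The dilations in A' scale this functional by a power of t, while
    by continuity and Taylor's formula it is O(t^(M+1)) on germs vanishing to
    order M; so it is a finite sum of linear maps T_(m,l) applied to the
    coefficient of x_n^m of degree l in x' = (x_1, ..., x_(n-1)).  The characters
    of A' and M' leave a single pair (m, l), determine beta and nu, and make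
    T_(m,l) an M'-equivariant map from poly^l to varpi.  A non-zero such map is
    bijective: its image is invariant, and its kernel, being stable under all
    matrices by density, would otherwise contain every (xi y)^l by stability
    under rank one matrices.  Schur's lemma gives uniqueness up to a scalar.
    Finally, exp(xi) in N'_+ maps x_n^m (xi x')^(l-1) to a germ whose coefficient
    of x_n^m of degree l in x' is proportional to
    (lam_1 + m + l - 1) (xi x')^l, which forces l = 0 or lam_1 = 1 - (m + l).

    Conversely, when l = 0 or lam_1 = 1 - (m + l), the degree l part in x' of the
    m-th derivative in x_n transforms under N'_+ without lower order terms: along
    lines through 0 this is Bol's lemma. *)

(** * Smooth functions *)

(** Lines through 0 suffice because the jet of degree l is a homogeneous polynomial whose value at v
    is the l-th derivative at 0 along t v, divided by l!, and because the maps x' |-> A x' / (1 + b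
    x') by which P' acts permute these lines. Each derivative in x_n raises the weight lam_1 by 1,
    as x_n is itself divided by 1 + b x'; hence it is lam_1 + m that must equal Bol's weight 1 - l.
    The pair (m, l) can be read off nu: the second component is lam_2 - l/(n-1), which gives l, and
    then the first gives m. No classification of the representations of SL(n-1) enters; that varpi
    is poly^l comes from the existence of a non-zero equivariant map. A germ is extended by a cutoff
    depending on x only, that is, on the coset of P, so that the extension keeps its equivariance.
    Smoothness is defined through iterated partial derivatives; differentiability, the chain rule
    and the symmetry of mixed derivatives are therefore derived from the continuity of these. *)

Lemma continuous_bigsum (R : realType) (T : topologicalType) (I : Type)
    (r : seq I) (P : pred I) (F : I -> T -> R) (x : T) :
  (forall i, {for x, continuous (F i)}) ->
  {for x, continuous (fun y => \sum_(i <- r | P i) F i y)}.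
Proof.
move=> cF; elim: r => [|i r IH].
  under [X in {for _, continuous X}]eq_fun do rewrite big_nil.
  exact: cvg_cst.
under [X in {for _, continuous X}]eq_fun do rewrite big_cons.
by case: ifP => // _; apply: cvgD; [exact: cF|exact: IH].
Qed.

Section LineCalculus.
Variables (R : realType) (V : normedModType R).
Implicit Types (f : V -> R) (x y v : V).

Lemma derivable_line f y v (t : R) : derivable f (y + t *: v) v ->
  is_derive t (1 : R) (fun s : R => f (y + s *: v)) ('D_v f (y + t *: v)).
Proof.
move=> dfv.
have E : (fun h : R => h^-1 *: ((fun s : R => f (y + s *: v)) (h *: 1 + t)
            - (fun s : R => f (y + s *: v)) t)) =
         (fun h : R => h^-1 *: (f (h *: v + (y + t *: v)) - f (y + t *: v))).
  apply/funext => h; congr (_ *: (f _ - _)).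
  by rewrite [h *: 1]mulr1 scalerDl addrCA.
apply: DeriveDef.
  by rewrite /derivable /shift /= E.
by rewrite /derive /shift /= E.
Qed.

(** Only the bound of |c| by |a| is recorded, so that a single statement covers both signs of
    [a]. *)
Lemma line_mvt f y v (a : R) :
  (forall c : R, `|c| <= `|a| -> derivable f (y + c *: v) v) ->
  exists2 c : R, `|c| <= `|a| & f (y + a *: v) - f y = a * 'D_v f (y + c *: v).
Proof.
move=> df; have [a0|a0] := leP 0 a.
  have [||c] := @MVT_segment R (fun s => f (y + s *: v))
      (fun s => 'D_v f (y + s *: v)) 0 a a0.
  - move=> c; rewrite in_itv /= => /andP[c0 ca]; apply: derivable_line; apply: df.
    by rewrite !ger0_norm// ltW.
  - apply: derivable_within_continuous => c; rewrite in_itv /= => /andP[c0 ca].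
    have /derivable_line [//] : derivable f (y + c *: v) v.
    by apply: df; rewrite !ger0_norm.
  rewrite in_itv /= => /andP[c0 ca]; rewrite scale0r addr0 subr0 mulrC => E.
  by exists c => //; rewrite !ger0_norm.
have [||c] := @MVT_segment R (fun s => f (y + s *: v))
      (fun s => 'D_v f (y + s *: v)) a 0 (ltW a0).
- move=> c; rewrite in_itv /= => /andP[c0 ca]; apply: derivable_line; apply: df.
  by rewrite !ler0_norm ?lerN2// ltW.
- apply: derivable_within_continuous => c; rewrite in_itv /= => /andP[c0 ca].
  have /derivable_line [//] : derivable f (y + c *: v) v.
  by apply: df; rewrite !ler0_norm ?lerN2// ltW.
rewrite in_itv /= => /andP[c0 ca]; rewrite scale0r addr0 sub0r mulrN => E.
exists c => //; first by rewrite !ler0_norm ?lerN2// ltW.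
by rewrite -opprB E opprK mulrC.
Qed.

End LineCalculus.

(** * Continuous partial derivatives imply differentiability *)

Section Differentiability.
Variables (R : realType) (m n : nat).
Local Notation M := 'M[R]_(m, n).
Implicit Types (f : M -> R) (x v : M).

Lemma mx_ballP x (e : R) (y : M) : 0 < e ->
  ball x e y <-> forall i j, `|x i j - y i j| < e.
Proof.
move=> e0; split=> [[_ h] i j|h]; first exact: h.
by split=> // i j; exact: h.
Qed.

Lemma mx_norm_ent x i j : `|x i j| <= `|x|.
Proof. by rewrite [leRHS]mx_normrE (le_bigmax _ (fun ij => `|x ij.1 ij.2|) (i, j)). Qed.

(** Adding the entries of [s] one at a time leads from [x] to [x + v] along segments parallel to the
    axes. *)
Let part (s : seq ('I_m * 'I_n)) v : M :=
  \matrix_(i, j) if (i, j) \in s then v i j else 0.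

(** Each new entry costs one mean value theorem, with a derivative within [e] of [d] and an
    increment bounded by the norm of [v]; the errors add up, one for each entry of [s]. *)
Lemma part_telescope f x v (d : 'I_m * 'I_n -> R) (e r : R) s :
  (forall y, ball x r y -> forall ij, derivable f y (delta_mx ij.1 ij.2)) ->
  (forall y, ball x r y -> forall ij, `|pderiv ij f y - d ij| <= e) ->
  `|v| < r -> uniq s ->
  `|f (x + part s v) - f x - \sum_(ij <- s) v ij.1 ij.2 * d ij|
     <= (size s)%:R * (e * `|v|).
Proof.
move=> df de vr; have r0 : 0 < r by apply: le_lt_trans vr.
elim: s => [|ij s IH] /=.
  move=> _; rewrite big_nil subr0 mul0r (_ : part [::] v = 0) ?addr0 ?subrr ?normr0//.
  by apply/matrixP => i j; rewrite !mxE.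
move=> /andP[ns us]; rewrite big_cons.
have E : part (ij :: s) v = part s v + v ij.1 ij.2 *: delta_mx ij.1 ij.2.
  apply/matrixP => i j; rewrite !mxE inE.
  have [Ei|nij] := eqVneq (i, j) ij.
    by rewrite Ei (negbTE ns) -Ei /= !eqxx mulr1 add0r.
  have -> : (i == ij.1) && (j == ij.2) = false.
    by apply/negbTE; rewrite -xpair_eqE -surjective_pairing.
  by rewrite mulr0 addr0; case: ifP.
have inb (c : R) : `|c| <= `|v ij.1 ij.2| ->
    ball x r (x + part s v + c *: delta_mx ij.1 ij.2).
  move=> cv; apply/mx_ballP => // i j; rewrite !mxE -addrA opprD addNKr normrN.
  have [Ei|nij] := eqVneq (i, j) ij.
    rewrite Ei (negbTE ns) -Ei /= !eqxx mulr1 add0r.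
    by apply: le_lt_trans vr; apply: le_trans cv _; exact: mx_norm_ent.
  have -> : (i == ij.1) && (j == ij.2) = false.
    by apply/negbTE; rewrite -xpair_eqE -surjective_pairing.
  rewrite mulr0 addr0; case: ifP => _; last by rewrite normr0.
  by apply: le_lt_trans vr; exact: mx_norm_ent.
have [|c cv Ec] := @line_mvt R M f (x + part s v) (delta_mx ij.1 ij.2) (v ij.1 ij.2).
  by move=> c cv; apply: df; exact: inb.
rewrite E addrA.
have -> : f (x + part s v + v ij.1 ij.2 *: delta_mx ij.1 ij.2) - f x -
   (v ij.1 ij.2 * d ij + \sum_(j <- s) v j.1 j.2 * d j) =
   v ij.1 ij.2 * ('D_(delta_mx ij.1 ij.2) f (x + part s v + c *: delta_mx ij.1 ij.2) - d ij)
   + (f (x + part s v) - f x - \sum_(ij <- s) v ij.1 ij.2 * d ij).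
  by rewrite mulrBr -Ec; ring.
rewrite (le_trans (ler_normD _ _))// -natr1 mulrDl mul1r addrC lerD// ?IH//.
rewrite normrM mulrC ler_pM//; last exact: mx_norm_ent.
exact: (de _ (inb _ cv) ij).
Qed.

Lemma C1_is_diff f (U : set M) x : open U -> U x ->
  (forall y, U y -> forall ij, derivable f y (delta_mx ij.1 ij.2)) ->
  (forall ij, {for x, continuous (pderiv ij f)}) ->
  is_diff x f (fun v : M => \sum_ij v ij.1 ij.2 * pderiv ij f x).
Proof.
move=> oU Ux df cf.
pose l (v : M) : R := \sum_(ij : 'I_m * 'I_n) v ij.1 ij.2 * pderiv ij f x.
have ll : linear l.
  move=> a u v; rewrite /l scaler_sumr -big_split /=.
  by apply: eq_bigr => ij _; rewrite !mxE mulrDl -mulrA.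
pose L : {linear M -> R} := HB.pack l (GRing.isLinear.Build _ _ _ _ l ll).
have cL : continuous (L : M -> R).
  move=> y; apply: continuous_bigsum => ij.
  exact: (cvgMr_tmp (@coord_continuous R m n ij.1 ij.2 y)).
have oE : f \o shift x = cst (f x) + (L : M -> R) +o_ (0 : M) id.
  apply/eqaddoP => _/posnumP[e].
  (* The error in [part_telescope] is multiplied by the number of entries, so the partial
     derivatives are controlled up to e / N; the 1 added below keeps N positive when the matrices
     have no entries. *)
  have [N N0 hN] : exists2 N : R, 0 < N & (size (index_enum ('I_m * 'I_n)%type))%:R / N <= 1.
    exists ((size (index_enum ('I_m * 'I_n)%type))%:R + 1); first by rewrite ltr_wpDl.
    by rewrite ler_pdivrMr ?ltr_wpDl// mul1r lerDl.
  have eN : 0 < e%:num / N by rewrite divr_gt0.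
  have : \forall y \near x, U y /\ forall ij, `|pderiv ij f y - pderiv ij f x| <= e%:num / N.
    have nU : \forall y \near x, U y by apply: open_nbhs_nbhs.
    have nP : \forall y \near x, forall ij, `|pderiv ij f y - pderiv ij f x| <= e%:num / N.
      apply: (@filter_forall _ ('I_m * 'I_n)%type
        (fun ij y => `|pderiv ij f y - pderiv ij f x| <= e%:num / N) (nbhs x)) => ij.
      have /cvgrPdist_le /(_ _ eN) := cf ij.
      by apply: filterS => y; rewrite distrC.
    by apply: filterS2 nU nP => y; split.
  case/nbhs_ballP => r r0 hr.
  have : \forall v \near (0 : M), `|v| < r.
    have /cvgr0Pnorm_lt : (fun v : M => v) v @[v --> (0 : M)] --> (0 : M) by exact: cvg_id.
    exact.
  apply: filterS => v vr.
  have := @part_telescope f x v (fun ij => pderiv ij f x) (e%:num / N) r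
     (index_enum ('I_m * 'I_n)%type) (fun y hy => df y (hr y hy).1)
     (fun y hy => (hr y hy).2) vr (index_enum_uniq _).
  have -> : part (index_enum ('I_m * 'I_n)%type) v = v.
    by apply/matrixP => i j; rewrite mxE mem_index_enum.
  have -> : (f \o shift x - (cst (f x) + (L : M -> R))) v =
      f (x + v) - f x - \sum_ij v ij.1 ij.2 * pderiv ij f x.
    by rewrite !fctE /= opprD addrA [v + x]addrC.
  move/le_trans; apply; rewrite mulrA ler_wpM2r// mulrCA.
  by rewrite ger_pMr.
have dfL := diff_unique cL oE.
split; last by rewrite dfL.
by apply/diff_locallyP; split; rewrite dfL.
Qed.

End Differentiability.

(** * Chain rules along a direction *)

Section DirectionalChainRule.
Variables (R : realType) (V : normedModType R).

Lemma is_derive_lineP (f : V -> R) x v d :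
  is_derive x v f d <-> is_derive (0 : R) (1 : R) (fun t : R => f (t *: v + x)) d.
Proof.
have E : (fun h : R => h^-1 *: ((fun t : R => f (t *: v + x)) (h *: 1 + 0)
            - (fun t : R => f (t *: v + x)) 0)) =
         (fun h : R => h^-1 *: (f (h *: v + x) - f x)).
  by apply/funext => h; rewrite scale0r add0r addr0 [h *: 1]mulr1.
split=> -[h1 h2]; apply: DeriveDef.
- by rewrite /derivable /shift /= E; exact: h1.
- by rewrite -h2 /derive /shift /= E.
- by rewrite /derivable /shift /= -E; exact: h1.
- by rewrite -h2 /derive /shift /= E.
Qed.

Lemma is_derive_comp1 (f : V -> R) (h : R -> R) x v df dh :
  is_derive x v f df -> is_derive (f x) (1 : R) h dh ->
  is_derive x v (fun y => h (f y)) (dh * df).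
Proof.
move=> /is_derive_lineP df1 dh1; apply/is_derive_lineP.
have E : (fun t : R => f (t *: v + x)) 0 = f x by rewrite scale0r add0r.
rewrite -E in dh1.
have hd : derivable (fun t : R => f (t *: v + x)) 0 1 by case: df1.
have hh : derivable h ((fun t : R => f (t *: v + x)) 0) 1 by case: dh1.
apply: DeriveDef.
  apply/derivable1_diffP.
  exact: (differentiable_comp ((derivable1_diffP _ _).1 hd) ((derivable1_diffP _ _).1 hh)).
have := derive1_comp hd hh.
by rewrite !derive1E !derive_val.
Qed.

(** A derivative along [v] sees [phi] only on the line through [x], so derivability of the entries
    in that direction is enough for [phi]; full differentiability is asked of [f] alone. *)
Lemma is_derive_pull (m n : nat) (f : 'M[R]_(m, n) -> R) (phi : V -> 'M[R]_(m, n))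
    (L : 'M[R]_(m, n) -> R) x v (d : 'M[R]_(m, n)) :
  (forall i j, is_derive x v (fun y => phi y i j) (d i j)) ->
  is_diff (phi x) f L -> is_derive x v (fun y => f (phi y)) (L d).
Proof.
move=> dphi df; apply/is_derive_lineP.
have dg i j : is_derive (0 : R) (1 : R) (fun t : R => phi (t *: v + x) i j) (d i j).
  by move/is_derive_lineP : (dphi i j).
have dgam : derivable (fun t : R => phi (t *: v + x)) 0 1.
  by apply/derivable_mxP => i j; case: (dg i j).
have E : (fun t : R => phi (t *: v + x)) 0 = phi x by rewrite scale0r add0r.
rewrite -E in df.
have dgam' : differentiable (fun t : R => phi (t *: v + x)) 0 by apply/derivable1_diffP.
have dfg : differentiable (f \o (fun t : R => phi (t *: v + x))) 0.
  exact: differentiable_comp.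
apply: DeriveDef; first exact: diff_derivable.
rewrite (deriveE _ dfg) diff_comp//= -(deriveE _ dgam') derive_mx// diff_val.
congr (L _); apply/matrixP => i j; rewrite mxE.
by case: (dg i j).
Qed.

End DirectionalChainRule.

Section SmoothBasics.
Variables (R : realType) (m n : nat).
Local Notation M := 'M[R]_(m, n).
Implicit Types (f g : M -> R) (U : set M) (x : M).

Lemma pderivs_rcons s ij f : pderivs (rcons s ij) f = pderivs s (pderiv ij f).
Proof. by rewrite /pderivs foldr_rcons. Qed.

Lemma smooth_pderiv U f ij : smooth_on U f -> smooth_on U (pderiv ij f).
Proof. by move=> sf s x Ux; rewrite -!pderivs_rcons; exact: sf. Qed.

Lemma smooth_pderivs U f s : smooth_on U f -> smooth_on U (pderivs s f).
Proof. by move=> sf; elim: s => [|ij s IH]; [exact: sf|exact: smooth_pderiv]. Qed.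

Lemma smooth_continuous U f x : smooth_on U f -> U x -> {for x, continuous f}.
Proof. by move=> /(_ [::] x) h /h[]. Qed.

Lemma smooth_derivable U f x ij : smooth_on U f -> U x ->
  derivable f x (delta_mx ij.1 ij.2).
Proof. by move=> /(_ [::] x) h /h[]. Qed.

Lemma smooth_is_derive U f x ij : smooth_on U f -> U x ->
  is_derive x (delta_mx ij.1 ij.2) f (pderiv ij f x).
Proof. by move=> sf Ux; apply: derivableP; exact: smooth_derivable sf Ux. Qed.

Lemma smooth_is_diff U f x : open U -> smooth_on U f -> U x ->
  is_diff x f (fun v : M => \sum_ij v ij.1 ij.2 * pderiv ij f x).
Proof.
move=> oU sf Ux; apply: (C1_is_diff oU Ux) => [y Uy ij|ij].
  exact: smooth_derivable sf Uy.
exact: smooth_continuous (smooth_pderiv ij sf) Ux.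
Qed.

Lemma pderiv_near f g x ij : (\near x, f x = g x) -> pderiv ij f x = pderiv ij g x.
Proof. exact: near_eq_derive. Qed.

Lemma pderiv_on U f g ij : open U -> (forall x, U x -> f x = g x) ->
  forall x, U x -> pderiv ij f x = pderiv ij g x.
Proof.
move=> oU fg x Ux; apply: pderiv_near.
by apply: filterS fg _; exact: open_nbhs_nbhs.
Qed.

Lemma pderivs_on U f g s : open U -> (forall x, U x -> f x = g x) ->
  forall x, U x -> pderivs s f x = pderivs s g x.
Proof.
move=> oU fg; elim: s => //= ij s IH x Ux.
exact: pderiv_on oU IH _ Ux.
Qed.

Lemma for_continuous_near f g x : (\near x, f x = g x) ->
  {for x, continuous f} -> {for x, continuous g}.
Proof.
move=> fg cf; have Ex : f x = g x by exact: nbhs_singleton fg.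
rewrite /prop_for /continuous_at -Ex; apply: cvg_trans cf.
exact: (@near_eq_cvg M R (nbhs x) _ f g).
Qed.

(** The list of derivatives is peeled from its innermost end: the first derivative taken agrees on
    the open set [U] with an element of [C], and the remaining ones do not see the difference. *)
Lemma smooth_coind U (C : (M -> R) -> Prop) : open U ->
  (forall f, C f -> forall x, U x -> {for x, continuous f} /\
     forall ij, derivable f x (delta_mx ij.1 ij.2)) ->
  (forall f, C f -> forall ij, exists2 g, C g & forall x, U x -> pderiv ij f x = g x) ->
  forall f, C f -> smooth_on U f.
Proof.
move=> oU C0 C1 f Cf s; elim/last_ind: s f Cf => [|s ij IH] f Cf x Ux.
  exact: C0.
have [g Cg fg] := C1 _ Cf ij.
have [cg dg] := IH _ Cg x Ux.
have E : \near x, pderivs s g x = pderivs s (pderiv ij f) x.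
  apply: filterS (pderivs_on (g := pderiv ij f) s oU _) _ => [y Uy|].
    by rewrite fg.
  by apply: open_nbhs_nbhs.
rewrite pderivs_rcons; split; first exact: for_continuous_near E cg.
by move=> kl; apply: near_eq_derivable E _.
Qed.

End SmoothBasics.

Lemma mx_continuous (R : realType) (T : topologicalType) (m n : nat)
    (phi : T -> 'M[R]_(m, n)) (x : T) :
  (forall i j, {for x, continuous (fun y => phi y i j)}) ->
  {for x, continuous phi}.
Proof.
move=> cphi; apply/cvgrPdist_lt => e e0.
have h : \forall y \near x, forall ij, `|phi x ij.1 ij.2 - phi y ij.1 ij.2| < e.
  apply: (@filter_forall _ ('I_m * 'I_n)%type
      (fun ij y => `|phi x ij.1 ij.2 - phi y ij.1 ij.2| < e) (nbhs x)) => ij.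
  by have /cvgrPdist_lt /(_ _ e0) := cphi ij.1 ij.2.
apply: filterS h => y h.
rewrite [ltLHS]mx_normrE; apply/bigmax_ltP; split=> // ij _.
by rewrite !mxE; exact: h.
Qed.

(** * Closure properties of smooth functions *)

Section SmoothClosure.
Variables (R : realType) (m n : nat) (U : set 'M[R]_(m, n)).
Hypothesis oU : open U.

(* The derivatives of an element of clo are in clo, which is why all the closure
   properties of smooth functions are proved at once, by coinduction. *)
Inductive clo : ('M[R]_(m, n) -> R) -> Prop :=
| clo_base f : smooth_on U f -> clo f
| clo_add f g : clo f -> clo g -> clo (fun x => f x + g x)
| clo_mul f g : clo f -> clo g -> clo (fun x => f x * g x)
| clo_comp1 (d : nat -> R -> R) (V : set R) f k :
    (forall k y, V y -> is_derive y (1 : R) (d k) (d k.+1 y)) ->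
    (forall x, U x -> V (f x)) -> clo f -> clo (fun x => d k (f x))
| clo_pull m' n' (phi : 'M[R]_(m, n) -> 'M[R]_(m', n')) (V : set 'M[R]_(m', n')) f :
    open V -> smooth_on V f -> (forall x, U x -> V (phi x)) ->
    (forall i j, clo (fun x => phi x i j)) -> clo (fun x => f (phi x)).

Lemma smooth_cst (a : R) : smooth_on U (fun=> a).
Proof.
pose C (f : 'M[R]_(m, n) -> R) := exists a, f = fun=> a.
apply: (@smooth_coind _ _ _ _ C) => // [f [b ->] x Ux|f [b ->] ij|].
- by split; [exact: cst_continuous|move=> ij; exact: derivable_cst].
- exists (fun=> 0); first by exists 0.
  by move=> x Ux; rewrite /pderiv (derive_cst b).
- by exists a.
Qed.

Lemma clo_big (I : Type) (r : seq I) (F : I -> 'M[R]_(m, n) -> R) :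
  (forall i, clo (F i)) -> clo (fun x => \sum_(i <- r) F i x).
Proof.
move=> cF; elim: r => [|i r IH].
  under eq_fun do rewrite big_nil; exact/clo_base/smooth_cst.
by under eq_fun do rewrite big_cons; exact: clo_add.
Qed.

Let good f := forall ij, exists2 g, clo g &
  forall x, U x -> is_derive x (delta_mx ij.1 ij.2) f (g x).

(** The sequence [d] in [clo_comp1] carries all higher derivatives of the outer function, and
    [clo_pull] replaces [f] by its partial derivatives, so differentiation never leaves the
    class. *)
Lemma clo_good f : clo f -> good f.
Proof.
elim=> {f} [f sf|f g cf gf cg gg|f g cf gf cg gg|d V f k dd UV cf gf
  |m' n' phi V f oV sf UV cphi gphi] ij.
- exists (pderiv ij f); first exact/clo_base/smooth_pderiv.
  by move=> x Ux; exact: smooth_is_derive sf Ux.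
- have [f' cf' df] := gf ij; have [g' cg' dg] := gg ij.
  exists (fun x => f' x + g' x); first exact: clo_add.
  by move=> x Ux; exact: (is_deriveD (df x Ux) (dg x Ux)).
- have [f' cf' df] := gf ij; have [g' cg' dg] := gg ij.
  exists (fun x => f x * g' x + g x * f' x).
    by apply: clo_add; exact: clo_mul.
  by move=> x Ux; exact: (is_deriveM (df x Ux) (dg x Ux)).
- have [f' cf' df] := gf ij.
  exists (fun x => d k.+1 (f x) * f' x).
    apply: clo_mul => //; exact: clo_comp1 dd UV cf.
  move=> x Ux; apply: is_derive_comp1; first exact: df.
  by apply: dd; exact: UV.
- have /(_ _ _)/cid2 h := gphi _ _ ij.
  pose D kl := projT1 (cid2 (gphi kl.1 kl.2 ij)).
  exists (fun x => \sum_kl D kl x * pderiv kl f (phi x)).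
    apply: clo_big => kl; apply: clo_mul.
      by rewrite /D; case: cid2.
    exact: (clo_pull oV (smooth_pderiv kl sf) UV cphi).
  move=> x Ux.
  have := @is_derive_pull _ _ _ _ f phi _ x (delta_mx ij.1 ij.2)
    (\matrix_(i, j) D (i, j) x) _ (smooth_is_diff oV sf (UV x Ux)).
  under eq_bigr do rewrite mxE -surjective_pairing.
  apply=> i j; rewrite mxE /D /=.
  by case: cid2 => g cg dg; exact: dg.
Qed.

Lemma clo_continuous f : clo f -> forall x : 'M[R]_(m, n), U x -> {for x, continuous f}.
Proof.
elim=> {f} [f sf|f g cf gf cg gg|f g cf gf cg gg|d V f k dd UV cf gf
  |m' n' phi V f oV sf UV cphi gphi] x Ux.
- exact: smooth_continuous sf Ux.
- exact: (cvgD (gf x Ux) (gg x Ux)).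
- exact: (cvgM (gf x Ux) (gg x Ux)).
- apply: (@continuous_comp _ _ _ f (d k)); first exact: gf.
  have [dk _] := dd k _ (UV x Ux).
  exact/differentiable_continuous/derivable1_diffP.
- apply: (@continuous_comp _ _ _ phi f); last first.
    exact: smooth_continuous sf (UV x Ux).
  by apply: mx_continuous => i j; exact: gphi.
Qed.

Lemma clo_smooth f : clo f -> smooth_on U f.
Proof.
apply: smooth_coind => // {}f cf.
  move=> x Ux; split; first exact: clo_continuous.
  by move=> ij; have [g _ /(_ x Ux)[]] := clo_good cf ij.
move=> ij; have [g cg h] := clo_good cf ij.
by exists g => // x Ux; have [] := h x Ux.
Qed.

Lemma smooth_add f g : smooth_on U f -> smooth_on U g ->
  smooth_on U (fun x => f x + g x).
Proof. by move=> /clo_base cf /clo_base cg; exact/clo_smooth/clo_add. Qed.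

Lemma smooth_mul f g : smooth_on U f -> smooth_on U g ->
  smooth_on U (fun x => f x * g x).
Proof. by move=> /clo_base cf /clo_base cg; exact/clo_smooth/clo_mul. Qed.

Lemma smooth_opp f : smooth_on U f -> smooth_on U (fun x => - f x).
Proof.
move=> sf; under eq_fun do rewrite -mulN1r.
exact: (smooth_mul (smooth_cst _) sf).
Qed.

Lemma smooth_sub_fun f g : smooth_on U f -> smooth_on U g ->
  smooth_on U (fun x => f x - g x).
Proof. by move=> sf sg; exact: (smooth_add sf (smooth_opp sg)). Qed.

Lemma smooth_bigsum (I : Type) (r : seq I) (F : I -> 'M[R]_(m, n) -> R) :
  (forall i, smooth_on U (F i)) -> smooth_on U (fun x => \sum_(i <- r) F i x).
Proof. by move=> sF; apply/clo_smooth/clo_big => i; exact: clo_base. Qed.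

Lemma smooth_bigprod (I : Type) (r : seq I) (F : I -> 'M[R]_(m, n) -> R) :
  (forall i, smooth_on U (F i)) -> smooth_on U (fun x => \prod_(i <- r) F i x).
Proof.
move=> sF; elim: r => [|i r IH].
  under eq_fun do rewrite big_nil; exact: smooth_cst.
under eq_fun do rewrite big_cons; exact: (smooth_mul (sF i) IH).
Qed.

Lemma smooth_comp1 (d : nat -> R -> R) (V : set R) f k :
    (forall k y, V y -> is_derive y (1 : R) (d k) (d k.+1 y)) ->
    (forall x, U x -> V (f x)) -> smooth_on U f -> smooth_on U (fun x => d k (f x)).
Proof. by move=> dd UV /clo_base cf; apply/clo_smooth; exact: clo_comp1 dd UV cf. Qed.

Lemma smooth_pull m' n' (phi : 'M[R]_(m, n) -> 'M[R]_(m', n'))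
    (V : set 'M[R]_(m', n')) f :
    open V -> smooth_on V f -> (forall x, U x -> V (phi x)) ->
    (forall i j, smooth_on U (fun x => phi x i j)) -> smooth_on U (fun x => f (phi x)).
Proof.
move=> oV sf UV sphi; apply/clo_smooth/(clo_pull oV sf UV) => i j.
exact: clo_base.
Qed.

Lemma smooth_ext f g : (forall x, U x -> f x = g x) -> smooth_on U f -> smooth_on U g.
Proof.
move=> fg sf s x Ux; have [cf df] := sf s x Ux.
have E : \near x, pderivs s f x = pderivs s g x.
  apply: filterS (pderivs_on s oU fg) _; exact: open_nbhs_nbhs.
split; first exact: for_continuous_near E cf.
by move=> kl; apply: near_eq_derivable E _.
Qed.

Lemma smooth_coord i j : smooth_on U (fun x : 'M[R]_(m, n) => x i j).
Proof.
pose C (f : 'M[R]_(m, n) -> R) := smooth_on U f \/ f = fun x => x i j.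
have dc x v : is_derive x v (fun x : 'M[R]_(m, n) => x i j) (v i j).
  have dd : differentiable (fun x : 'M[R]_(m, n) => x i j) x.
    exact: differentiable_coord.
  apply: DeriveDef; first exact: diff_derivable.
  rewrite /derive; apply: lim_near_cst => //=.
  near=> h; rewrite !mxE addrK scalerA mulVf ?scale1r//.
  by near: h; exact: nbhs_dnbhs_neq.
apply: (@smooth_coind _ _ _ _ C) => // [f [sf|->] x Ux|f [sf|->] ij|].
- by split; [exact: smooth_continuous sf Ux|move=> ij; exact: smooth_derivable sf Ux].
- split; first exact: coord_continuous.
  by move=> ij; have [] := dc x (delta_mx ij.1 ij.2).
- by exists (pderiv ij f) => //; left; exact: smooth_pderiv.
- exists (fun=> (delta_mx ij.1 ij.2 : 'M[R]_(m, n)) i j); first by left; exact: smooth_cst.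
  by move=> x Ux; have [] := dc x (delta_mx ij.1 ij.2).
- by right.
Unshelve. all: by end_near. Qed.

End SmoothClosure.

(** * Symmetry of mixed partial derivatives *)

Section Schwarz.
Variables (R : realType) (m n : nat).
Local Notation M := 'M[R]_(m, n).
Local Notation dl ij := (delta_mx ij.1 ij.2 : M).
Implicit Types (f g : M -> R) (U : set M) (x y : M).

Lemma is_derive_translate f x (v w : M) d :
  is_derive (x + w) v f d -> is_derive x v (fun y => f (y + w)) d.
Proof.
move=> /is_derive_lineP h; apply/is_derive_lineP.
by under eq_fun do rewrite -addrA.
Qed.

Lemma ball_two_steps x (r h a b : R) (i j : 'I_m * 'I_n) :
  0 < h -> h + h < r -> `|a| <= h -> `|b| <= h ->
  ball x r (x + a *: dl i + b *: dl j).
Proof.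
move=> h0 hr ah bh; apply/mx_ballP; first by lra.
move=> k l; rewrite !mxE -addrA opprD addNKr normrN.
have B (c : R) (t : bool) : `|c| <= h -> `|c * t%:R| <= h.
  by case: t => ch; rewrite ?mulr1// mulr0 normr0 ltW.
by apply: le_lt_trans hr; rewrite (le_trans (ler_normD _ _))// lerD// B.
Qed.

(** Two mean value theorems: in the direction [i] for the difference of f(y + h e_j) and f(y), then
    in the direction [j] for the derivative of [f] so obtained. *)
Lemma second_difference U f x (r h : R) (i j : 'I_m * 'I_n) :
  smooth_on U f -> ball x r `<=` U -> 0 < h -> h + h < r ->
  exists2 y, ball x r y &
    f (x + h *: dl i + h *: dl j) - f (x + h *: dl i) - (f (x + h *: dl j) - f x)
    = h * (h * pderiv j (pderiv i f) y).
Proof.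
move=> sf rU h0 hr.
have nh : `|h| = h by rewrite gtr0_norm.
have nh' : `|h| <= h by rewrite nh.
have dF y : U y -> U (y + h *: dl j) -> is_derive y (dl i)
    (fun y => f (y + h *: dl j) - f y) (pderiv i f (y + h *: dl j) - pderiv i f y).
  move=> Uy Uy'.
  exact: (is_deriveB (is_derive_translate (smooth_is_derive i sf Uy'))
                     (smooth_is_derive i sf Uy)).
have U0 (c : R) : `|c| <= h -> U (x + c *: dl i).
  move=> ch; apply: rU.
  by have := @ball_two_steps x r h c 0 i j h0 hr ch; rewrite normr0 scale0r addr0; apply; exact: ltW.
have U1 (c b : R) : `|c| <= h -> `|b| <= h -> U (x + c *: dl i + b *: dl j).
  by move=> ch bh; exact: (rU _ (ball_two_steps x i j h0 hr ch bh)).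
have [c|c ch] := @line_mvt R M (fun y => f (y + h *: dl j) - f y) x (dl i) h.
  by rewrite nh => ch; have [] := dF (x + c *: dl i) (U0 _ ch) (U1 _ _ ch nh').
rewrite nh in ch.
have [_ ->] := dF (x + c *: dl i) (U0 _ ch) (U1 _ _ ch nh').
have [b|b bh ->] := @line_mvt R M (pderiv i f) (x + c *: dl i) (dl j) h.
  rewrite nh => bh.
  exact: (@smooth_derivable _ _ _ _ _ _ j (smooth_pderiv i sf) (U1 c b ch bh)).
move=> E; exists (x + c *: dl i + b *: dl j); last exact: E.
by rewrite nh in bh; exact: (ball_two_steps x i j h0 hr ch bh).
Qed.

(** The second difference is symmetric in [i] and [j], so the two mixed derivatives take a common
    value at two points of a small ball around [x]; by continuity the ball may shrink. *)
Lemma schwarz U f x i j : open U -> smooth_on U f -> U x ->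
  pderiv i (pderiv j f) x = pderiv j (pderiv i f) x.
Proof.
move=> oU sf Ux; apply/eqP; rewrite -subr_eq0 -normr_le0.
apply/ler_addgt0Pr => e e0; rewrite add0r.
have e2 : 0 < e / 2 by rewrite divr_gt0.
have near_d a b : \forall y \near x,
    `|pderiv a (pderiv b f) x - pderiv a (pderiv b f) y| < e / 2.
  have := smooth_continuous (smooth_pderiv a (smooth_pderiv b sf)) Ux.
  by move/cvgrPdist_lt; apply.
have nU : \forall y \near x, U y by exact: open_nbhs_nbhs.
have : \forall y \near x, [/\ U y,
    `|pderiv i (pderiv j f) x - pderiv i (pderiv j f) y| < e / 2 &
    `|pderiv j (pderiv i f) x - pderiv j (pderiv i f) y| < e / 2].
  by apply: filterS3 nU (near_d i j) (near_d j i) => y; split.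
case/nbhs_ballP => r /= r0 hr.
have h0 : 0 < r / 3 by rewrite divr_gt0.
have hh : r / 3 + r / 3 < r by lra.
have rU : ball x r `<=` U by move=> y /hr[].
have [y xy Ey] := second_difference i j sf rU h0 hh.
have [z xz Ez] := second_difference j i sf rU h0 hh.
have E : pderiv j (pderiv i f) y = pderiv i (pderiv j f) z.
  apply: (mulfI (lt0r_neq0 h0)); apply: (mulfI (lt0r_neq0 h0)).
  have aux (a b c d : R) : a - b - (c - d) = a - c - (b - d) by ring.
  apply: etrans (esym Ey) (etrans _ Ez).
  by rewrite [x + _ + (r / 3) *: dl i]addrAC aux.
have [_ _ /ltW hy] := hr y xy; have [_ /ltW hz _] := hr z xz.
rewrite (splitr e) -(subrKA (pderiv i (pderiv j f) z)).
apply: le_trans (ler_normD _ _) _; apply: lerD; first exact: hz.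
by rewrite -E distrC; exact: hy.
Qed.

(** This is what allows lists of directions to be replaced by multi-indices. *)
Lemma pderivs_perm U f x s t : open U -> smooth_on U f -> U x ->
  perm_eq s t -> pderivs s f x = pderivs t f x.
Proof.
move=> oU sf Ux st; elim: t s x Ux st => [|i t IH] s x Ux st.
  by rewrite (perm_nilP st).
have si : i \in s by rewrite (perm_mem st) inE eqxx.
case/splitPr : si st => s1 s2 st.
have st' : perm_eq (s1 ++ s2) t.
  by rewrite -(perm_cons i) -(permPr st) perm_sym perm_catC cat_cons perm_cons perm_catC.
suff E y : U y -> pderivs (s1 ++ i :: s2) f y = pderivs (i :: s1 ++ s2) f y.
  by rewrite E//; exact: (pderiv_on i oU (fun y Uy => IH _ y Uy st') Ux).
elim: s1 y {st st'} => [//|k s1 IH1] y Uy.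
have -> : pderivs ((k :: s1) ++ i :: s2) f y = pderiv k (pderivs (i :: s1 ++ s2) f) y.
  exact: (pderiv_on k oU IH1 Uy).
exact: (schwarz k i oU (smooth_pderivs (s1 ++ s2) sf) Uy).
Qed.

End Schwarz.

Section PartialDerivativeAlgebra.
Variables (R : realType) (m n : nat) (U : set 'M[R]_(m, n)).
Hypothesis oU : open U.
Local Notation M := 'M[R]_(m, n).
Implicit Types (f g : M -> R) (x : M).

Lemma pderiv_add f g ij x : smooth_on U f -> smooth_on U g -> U x ->
  pderiv ij (fun y => f y + g y) x = pderiv ij f x + pderiv ij g x.
Proof.
move=> sf sg Ux.
by have [_] := is_deriveD (smooth_is_derive ij sf Ux) (smooth_is_derive ij sg Ux).
Qed.

Lemma pderiv_mul f g ij x : smooth_on U f -> smooth_on U g -> U x ->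
  pderiv ij (fun y => f y * g y) x = f x * pderiv ij g x + g x * pderiv ij f x.
Proof.
move=> sf sg Ux.
by have [_] := is_deriveM (smooth_is_derive ij sf Ux) (smooth_is_derive ij sg Ux).
Qed.

Lemma pderiv_cst a ij x : pderiv ij (fun _ : M => a : R) x = 0.
Proof. exact: (derive_cst a). Qed.

Lemma pderiv_lin (a : R) f g ij x : smooth_on U f -> smooth_on U g -> U x ->
  pderiv ij (fun y => a * f y + g y) x = a * pderiv ij f x + pderiv ij g x.
Proof.
move=> sf sg Ux; have sa : smooth_on U (fun=> a) by exact: smooth_cst.
rewrite (pderiv_add ij (smooth_mul oU sa sf) sg Ux).
by rewrite (pderiv_mul ij sa sf Ux) pderiv_cst mulr0 addr0.
Qed.

Lemma smooth_lin (a : R) f g : smooth_on U f -> smooth_on U g ->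
  smooth_on U (fun y => a * f y + g y).
Proof.
by move=> sf sg; exact: (smooth_add oU (smooth_mul oU (smooth_cst oU a) sf) sg).
Qed.

Lemma pderivs_lin (a : R) f g s x : smooth_on U f -> smooth_on U g -> U x ->
  pderivs s (fun y => a * f y + g y) x = a * pderivs s f x + pderivs s g x.
Proof.
move=> sf sg; elim: s x => [//|ij s IH] x Ux.
rewrite /= (pderiv_on ij oU IH Ux).
exact: (pderiv_lin a ij (smooth_pderivs s sf) (smooth_pderivs s sg) Ux).
Qed.

Lemma pderiv_coord i j (kl : 'I_m * 'I_n) x :
  pderiv kl (fun y : M => y i j) x = ((i, j) == kl)%:R.
Proof.
have -> : ((i, j) == kl)%:R = (delta_mx kl.1 kl.2 : M) i j.
  by rewrite mxE -xpair_eqE -surjective_pairing.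
apply: lim_near_cst => //=.
near=> h; rewrite !mxE addrK scalerA mulVf ?scale1r//.
by near: h; exact: nbhs_dnbhs_neq.
Unshelve. all: by end_near. Qed.

Lemma pderiv_pull m' n' (phi : M -> 'M[R]_(m', n')) (V : set 'M[R]_(m', n'))
    (f : 'M[R]_(m', n') -> R) ij x : open V -> smooth_on V f -> (forall x, U x -> V (phi x)) ->
  (forall i j, smooth_on U (fun x => phi x i j)) -> U x ->
  pderiv ij (fun y => f (phi y)) x
  = \sum_kl pderiv ij (fun y => phi y kl.1 kl.2) x * pderiv kl f (phi x).
Proof.
move=> oV sf UV sphi Ux.
have := @is_derive_pull R _ m' n' f phi _ x (delta_mx ij.1 ij.2)
    (\matrix_(i, j) pderiv ij (fun y => phi y i j) x) _
    (smooth_is_diff oV sf (UV x Ux)).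
case=> [i j|_ E]; first by rewrite mxE; exact: smooth_is_derive (sphi i j) Ux.
by apply: etrans E _; apply: eq_bigr => kl _; rewrite mxE.
Qed.

Lemma smooth_bounded (K : set M) f : compact K -> K `<=` U -> smooth_on U f ->
  exists2 C : R, 0 <= C & forall x, K x -> `|f x| <= C.
Proof.
move=> cK KU sf.
have cf : {within K, continuous f}.
  apply: continuous_in_subspaceT => x /[!inE] /KU Ux.
  exact: smooth_continuous sf Ux.
have /compact_bounded[C [_ hC]] := continuous_compact cf cK.
exists (`|C| + 1); first by rewrite addr_ge0.
move=> x Kx; apply: (hC (`|C| + 1)); last by exists x.
by rewrite ltr_pwDr// ler_norm.
Qed.

End PartialDerivativeAlgebra.

(** * Differential operators with smooth coefficients *)

Section FiniteOrderOperators.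
Variables (R : realType) (m n m' n' : nat).
Local Notation M := 'M[R]_(m, n).
Local Notation M' := 'M[R]_(m', n').
Variables (U : set M) (V : set M') (phi : M -> M').
Hypotheses (oU : open U) (oV : open V).
Hypothesis UV : forall x, U x -> V (phi x).
Hypothesis sphi : forall i j, smooth_on U (fun x => phi x i j).
Implicit Types (A B : (M' -> R) -> M -> R) (k : nat).

(* Differential operators along phi of order at most k; only their values on U
   at functions smooth on V matter, see lop_ext. *)
Inductive lop k : ((M' -> R) -> M -> R) -> Prop :=
| lop_gen c s : smooth_on U c -> (size s <= k)%N ->
    lop k (fun f x => c x * pderivs s f (phi x))
| lop_zero : lop k (fun _ _ => 0)
| lop_add A B : lop k A -> lop k B -> lop k (fun f x => A f x + B f x)
| lop_ext A B : lop k A ->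
    (forall f, smooth_on V f -> forall x, U x -> A f x = B f x) -> lop k B.

Lemma lop_mono k k' A : (k <= k')%N -> lop k A -> lop k' A.
Proof.
move=> kk'; elim=> {A} [c s sc sk||A B _ IA _ IB|A B _ IA AB].
- by apply: (lop_gen sc); exact: leq_trans kk'.
- exact: lop_zero.
- exact: lop_add.
- exact: lop_ext IA AB.
Qed.

Lemma lop_smooth k A f : lop k A -> smooth_on V f -> smooth_on U (A f).
Proof.
move=> lA sf; elim: lA => {A} [c s sc _||A B _ IA _ IB|A B _ IA AB].
- have sg := smooth_pull oU oV (smooth_pderivs s sf) UV sphi.
  exact: (smooth_mul oU sc sg).
- exact: (smooth_cst oU 0).
- exact: (smooth_add oU IA IB).
- exact: (smooth_ext oU (AB f sf) IA).
Qed.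

Lemma lop_big k (I : Type) (r : seq I) (F : I -> (M' -> R) -> M -> R) :
  (forall i, lop k (F i)) -> lop k (fun f x => \sum_(i <- r) F i f x).
Proof.
move=> hF; elim: r => [|i r IH].
  by apply: (lop_ext (lop_zero k)) => f _ x _; rewrite big_nil.
by apply: (lop_ext (lop_add (hF i) IH)) => f _ x _; rewrite big_cons.
Qed.

Lemma lop_mul k A (c : M -> R) : smooth_on U c -> lop k A ->
  lop k (fun f x => c x * A f x).
Proof.
move=> sc; elim=> {A} [c' s sc' sk||A B _ IA _ IB|A B _ IA AB].
- apply: (lop_ext (lop_gen (smooth_mul oU sc sc') sk)) => f _ x _.
  by rewrite mulrA.
- by apply: (lop_ext (lop_zero k)) => f _ x _; rewrite mulr0.
- by apply: (lop_ext (lop_add IA IB)) => f _ x _; rewrite mulrDr.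
- by apply: (lop_ext IA) => f sf x Ux; rewrite AB.
Qed.

Lemma lop_pderiv k A ij : lop k A -> lop k.+1 (fun f => pderiv ij (A f)).
Proof.
elim=> {A} [c s sc sk||A B lA IA lB IB|A B lA IA AB].
- pose T kl f x := (c x * pderiv ij (fun y => phi y kl.1 kl.2) x)
                   * pderivs (kl :: s) f (phi x).
  have lT kl : lop k.+1 (T kl).
    by apply: lop_gen => //; exact: (smooth_mul oU sc (smooth_pderiv ij (sphi _ _))).
  have l0 : lop k.+1 (fun f x => pderiv ij c x * pderivs s f (phi x)).
    by apply: (lop_gen (smooth_pderiv ij sc)); exact: leqW.
  apply: (lop_ext (lop_add l0 (lop_big (index_enum ('I_m' * 'I_n')%type) lT))) => f sf x Ux.
  have ss := smooth_pderivs s sf.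
  rewrite (pderiv_mul ij sc (smooth_pull oU oV ss UV sphi) Ux).
  rewrite (pderiv_pull ij oV ss UV sphi Ux) addrC mulr_sumr mulrC.
  by congr (_ + _); apply: eq_bigr => kl _; rewrite /T mulrA.
- by apply: (lop_ext (lop_zero _)) => f _ x _; rewrite pderiv_cst.
- apply: (lop_ext (lop_add IA IB)) => f sf x Ux.
  by rewrite (pderiv_add ij (lop_smooth lA sf) (lop_smooth lB sf) Ux).
- apply: (lop_ext IA) => f sf x Ux.
  exact: (pderiv_on ij oU (AB f sf) Ux).
Qed.

Lemma lop_lin k A (a : R) f g x : lop k A -> smooth_on V f -> smooth_on V g -> U x ->
  A (fun y => a * f y + g y) x = a * A f x + A g x.
Proof.
move=> lA sf sg Ux; elim: lA => {A} [c s sc _||A B _ IA _ IB|A B _ IA AB].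
- rewrite (pderivs_lin oV a s sf sg (UV Ux)); ring.
- by rewrite mulr0 addr0.
- rewrite IA IB; ring.
- rewrite -(AB f sf x Ux) -(AB g sg x Ux) -(AB _ (smooth_lin oV a sf sg) x Ux).
  exact: IA.
Qed.

(** The constant depends on [A] and [K] only; this uniformity in [f] becomes the continuity of the
    operators. *)
Lemma lop_bound k A (K : set M) : compact K -> K `<=` U -> lop k A ->
  exists2 C : R, 0 <= C & forall f (e : R), smooth_on V f -> 0 <= e ->
    (forall s x, (size s <= k)%N -> K x -> `|pderivs s f (phi x)| <= e) ->
    forall x, K x -> `|A f x| <= C * e.
Proof.
move=> cK KU; elim=> {A} [c s sc sk||A B _ [C C0 hC] _ [D D0 hD]|A B _ [C C0 hC] AB].
- have [C C0 hC] := smooth_bounded cK KU sc.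
  exists C => // f e sf e0 he x Kx.
  by rewrite normrM; apply: ler_pM; rewrite ?normr_ge0//; [exact: hC|exact: he].
- by exists 0 => // f e _ _ _ x _; rewrite normr0 mul0r.
- exists (C + D); first exact: addr_ge0.
  move=> f e sf e0 he x Kx; rewrite mulrDl.
  by apply: le_trans (ler_normD _ _) _; apply: lerD; [exact: hC|exact: hD].
- by exists C => // f e sf e0 he x Kx; rewrite -(AB f sf x (KU x Kx)); exact: hC.
Qed.

End FiniteOrderOperators.

Section OperatorPullback.
Variables (R : realType) (m0 n0 m n m' n' : nat).
Variables (U0 : set 'M[R]_(m0, n0)) (U : set 'M[R]_(m, n)) (V : set 'M[R]_(m', n')).
Variables (phi : 'M[R]_(m, n) -> 'M[R]_(m', n')) (psi : 'M[R]_(m0, n0) -> 'M[R]_(m, n)).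
Hypotheses (oU0 : open U0) (oU : open U).
Hypothesis UU : forall x, U0 x -> U (psi x).
Hypothesis spsi : forall i j, smooth_on U0 (fun x => psi x i j).

Lemma lop_pull k A : lop U V phi k A ->
  lop U0 V (fun x => phi (psi x)) k (fun f x => A f (psi x)).
Proof.
elim=> {A} [c s sc sk||A B _ IA _ IB|A B _ IA AB].
- exact: (lop_gen _ _ (smooth_pull oU0 oU sc UU spsi) sk).
- exact: lop_zero.
- exact: lop_add IA IB.
- by apply: (lop_ext IA) => f sf x Ux; exact: AB (UU Ux).
Qed.

End OperatorPullback.

(** * Elementary functions and cutoffs *)

Section OneVariable.
Variable R : realType.
Implicit Types (h : R -> R) (V : set R).

(** The input of [smooth_comp1]: smoothness in one variable is witnessed by a sequence of all
    derivatives. *)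
Definition tower V (d : nat -> R -> R) :=
  forall k y, V y -> is_derive y (1 : R) (d k) (d k.+1 y).

(** The sequence is obtained by iterating a choice of derivative inside the class [C]. *)
Lemma tower_coind V (C : (R -> R) -> Prop) :
  (forall h, C h -> exists2 g, C g & forall y, V y -> is_derive y (1 : R) h (g y)) ->
  forall h, C h -> exists2 d, tower V d & d 0%N = h.
Proof.
move=> hC h Ch.
pose T := {f : R -> R | C f}.
pose next (f : T) : T :=
  let w := cid2 (hC (projT1 f) (projT2 f)) in exist _ (s2val w) (s2valP w).
pose d k := projT1 (iter k next (exist _ h Ch)).
exists d => // k y Vy; rewrite /d iterS.
by case: (iter k next _) => f Cf /=; rewrite /next /=; case: cid2 => g Cg dg /=; exact: dg.
Qed.

Lemma tower_exp : exists2 d, tower setT d & d 0%N = @expR R.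
Proof.
apply: (@tower_coind _ (fun f => f = @expR R)) => // h ->.
by exists expR => // y _; exact: is_derive_expR.
Qed.

Lemma tower_cos_sin (b : bool) :
  exists2 d, tower setT d & d 0%N = if b then @cos R else @sin R.
Proof.
apply: (@tower_coind _ (fun f => exists u v : R, f = fun x => u * cos x + v * sin x)).
  move=> h [u [v ->]].
  exists (fun x => v * cos x + - u * sin x); first by exists v, (- u).
  move=> y _; apply: is_derive_eq.
  by rewrite /GRing.scale /=; ring.
case: b; [exists 1, 0|exists 0, 1]; apply/funext => x; ring.
Qed.

Lemma is_derive_inv (y : R) : y != 0 -> is_derive y (1 : R) (fun x : R => x^-1) (- y ^- 2).
Proof.
by move=> y0; apply: is_derive_eq (is_deriveV y0 (is_derive_id y 1)) _; rewrite [LHS]mulr1.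
Qed.

Lemma is_derive_horner (p : {poly R}) (y : R) :
  is_derive y (1 : R) (horner p) p^`().[y].
Proof. by apply: DeriveDef; [exact: derivable_horner|rewrite -derive1E -derivE]. Qed.

Lemma tower_inv : exists2 d, tower [set x : R | x != 0] d & d 0%N = (fun x => x^-1).
Proof.
apply: (@tower_coind _ (fun f => exists (a : R) k, f = fun x => a * x^-1 ^+ k)).
  move=> h [a [k ->]].
  exists (fun x => - (a * k%:R) * x^-1 ^+ k.+1); first by exists (- (a * k%:R)), k.+1.
  move=> y /= y0.
  have E : (fun x => a * x^-1 ^+ k) = (fun x => (a *: 'X^k).[x^-1]).
    by apply/funext => x; rewrite hornerZ hornerXn.
  rewrite E; apply: (is_derive_eq (is_derive_comp1 (is_derive_inv y0) (is_derive_horner _ _))).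
  rewrite derivZ derivXn hornerZ hornerMn hornerXn.
  case: k {E} => [|k]; first by rewrite !mulr0n !mulr0 oppr0 !mul0r.
  rewrite -mulr_natl /= !exprS !exprVn invfM expr0 mulr1 ; ring.
by exists 1, 1%N; apply/funext => x; rewrite mul1r expr1.
Qed.

Lemma tower_ln : exists2 d, tower [set x : R | 0 < x] d & d 0%N = @ln R.
Proof.
have [d td d0] := tower_inv.
exists (fun k => if k is k'.+1 then d k' else @ln R) => // -[|k] y /= y0.
  by rewrite d0; exact: is_derive1_ln.
by apply: td; rewrite /= gt_eqF.
Qed.

Lemma poly_le_exp (p : {poly R}) (a : R) : 0 < a ->
  exists2 C : R, 0 <= C & forall t, 0 <= t -> `|p.[t]| <= C * expR (a * t).
Proof.
elim/poly_ind: p a => [|p c IH] a a0.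
  by exists 0 => // t _; rewrite horner0 normr0 mul0r.
(* Half of the exponent serves the induction hypothesis, the other half absorbs the extra factor t
   through 1 + x <= exp x. *)
have a2 : 0 < a / 2 by rewrite divr_gt0.
have [C C0 hC] := IH _ a2.
exists (C * (a / 2)^-1 + `|c|); first by rewrite addr_ge0// mulr_ge0// invr_ge0 ltW.
move=> t t0; rewrite hornerMXaddC mulrDl.
apply: le_trans (ler_normD _ _) _; apply: lerD; last first.
  rewrite ler_peMr//.
  by rewrite -expR0 ler_expR mulr_ge0// ltW.
rewrite normrM (ger0_norm t0).
have -> : a * t = a / 2 * t + a / 2 * t by field.
rewrite expRD mulrACA; apply: ler_pM => //; first exact: hC.
rewrite ler_pdivlMl//.
by apply: le_trans (expR_ge1Dx _); rewrite lerDr.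
Qed.

(* The functions p(1/x) exp(-1/x) are closed under differentiation. *)
Definition flat (p : {poly R}) (x : R) : R :=
  if 0 < x then p.[x^-1] * expR (- x^-1) else 0.

(** A quadratic bound forces the derivative at 0 to vanish; 0 is the only point where the derivative
    in [tower_flat] is not a direct computation. *)
Lemma flat_small p : exists2 C : R, 0 <= C & forall x, `|flat p x| <= C * x ^+ 2.
Proof.
(* The factor X^2, evaluated at 1/x, turns a bound by exp(1/x) into a quadratic one. *)
have [C C0 hC] := @poly_le_exp (p * 'X ^+ 2) 1 ltr01.
exists C => // x; rewrite /flat; case: ltP => [x0|_]; last first.
  by rewrite normr0 mulr_ge0// sqr_ge0.
have xi : 0 <= x^-1 by rewrite invr_ge0 ltW.
have := hC _ xi; rewrite mul1r hornerM hornerXn normrM (ger0_norm (exprn_ge0 _ xi)) => h.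
rewrite normrM (ger0_norm (expR_ge0 _)) expRN ler_pdivrMr ?expR_gt0//.
by move: h; rewrite exprVn ler_pdivrMr ?exprn_gt0// mulrAC.
Qed.

Lemma tower_flat : exists2 d, tower setT d & d 0%N = flat 1.
Proof.
apply: (@tower_coind _ (fun f => exists p, f = flat p)); last by exists 1.
(* For x > 0 the derivative of p(1/x) exp(-1/x) is x^(-2) (p - p')(1/x) exp(-1/x). *)
move=> h [p ->]; exists (flat ('X ^+ 2 * (p - p^`()))); first by eexists.
move=> y _; case: (ltgtP 0 y) => [y0|y0|<-].
- have E : \forall z \near y, (fun z => p.[z^-1] * expR (- z^-1)) z = flat p z.
    have : \forall z \near y, 0 < z by exact: lt_nbhsr.
    by apply: filterS => z z0; rewrite /flat z0.
  apply: near_eq_is_derive E _.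
  have dV := is_derive_inv (lt0r_neq0 y0).
  have d1 := is_derive_comp1 dV (is_derive_horner p _).
  have d2 := is_derive_comp1 (is_deriveN dV) (is_derive_expR _).
  apply: (is_derive_eq (is_deriveM d1 d2)).
  rewrite /flat y0 hornerM hornerXn hornerD hornerN /GRing.scale /= exprVn; ring.
- have E : \forall z \near y, (fun=> 0) z = flat p z.
    have : \forall z \near y, z < 0 by exact: lt_nbhsl.
    by apply: filterS => z z0; rewrite /flat ltNge (ltW z0).
  apply: near_eq_is_derive E _.
  have -> : flat ('X ^+ 2 * (p - p^`())) y = 0 by rewrite /flat ltNge (ltW y0).
  exact: is_derive_cst.
- have -> : flat ('X ^+ 2 * (p - p^`())) 0 = 0 by rewrite /flat ltxx.
  have [C C0 hC] := flat_small p.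
  have h0 : (fun t : R => t^-1 *: ((flat p \o shift 0) (t *: 1) - flat p 0)) t @[t --> 0^'] --> (0 : R).
    apply/cvgr0Pnorm_le => e e0.
    near=> t.
    have t0 : t != 0 by near: t; exact: nbhs_dnbhs_neq.
    rewrite /= addr0 [t *: 1]mulr1 {2}/flat ltxx subr0 normrM.
    apply: (@le_trans _ _ (C * `|t|)).
      rewrite normfV ler_pdivrMl ?normr_gt0// mulrCA -expr2 -normrX.
      by rewrite (ger0_norm (sqr_ge0 t)); exact: hC.
    apply: (@le_trans _ _ ((C + 1) * `|t|)); first by rewrite ler_wpM2r ?lerDl.
    rewrite -ler_pdivlMl ?ltr_wpDl//.
    near: t; apply: dnbhs0_le; rewrite mulr_gt0// invr_gt0 ltr_wpDl//.
  apply: DeriveDef; first by apply/cvg_ex; exists 0.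
  exact: cvg_lim.
Unshelve. all: by end_near. Qed.

(** Meant for a squared norm: 1 on the ball of radius 1/2 and 0 outside the unit ball. As 1/4 < 1,
    the two terms of the denominator never vanish together. *)
Definition cutoff (r : R) : R := flat 1 (1 - r) / (flat 1 (1 - r) + flat 1 (r - 4^-1)).

Lemma flat1_ge0 r : 0 <= flat 1 r.
Proof. by rewrite /flat; case: ifP => // _; rewrite hornerE mul1r expR_ge0. Qed.

Lemma flat1_gt0 r : 0 < r -> 0 < flat 1 r.
Proof. by rewrite /flat => ->; rewrite hornerE mul1r expR_gt0. Qed.

Lemma cutoff_den_gt0 r : 0 < flat 1 (1 - r) + flat 1 (r - 4^-1).
Proof.
have [r1|r1] := ltP r 1.
  by rewrite ltr_pwDl ?flat1_ge0// flat1_gt0// subr_gt0.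
by rewrite ltr_wpDl ?flat1_ge0// flat1_gt0// subr_gt0; lra.
Qed.

Lemma cutoff_near r : r <= 4^-1 -> cutoff r = 1.
Proof.
move=> r4; rewrite /cutoff {3}/flat subr_gt0 ltNge r4 /= addr0 divff// gt_eqF//.
by rewrite flat1_gt0// subr_gt0; lra.
Qed.

Lemma cutoff_far r : 1 <= r -> cutoff r = 0.
Proof. by move=> r1; rewrite /cutoff {1}/flat subr_gt0 ltNge r1 mul0r. Qed.

Variables (m n : nat) (U : set 'M[R]_(m, n)).
Hypothesis oU : open U.
Implicit Types f : 'M[R]_(m, n) -> R.

Lemma smooth_tower V h f : (exists2 d, tower V d & d 0%N = h) ->
  (forall x, U x -> V (f x)) -> smooth_on U f -> smooth_on U (fun x => h (f x)).
Proof. by case=> d td <- UV sf; exact: (smooth_comp1 oU 0%N td UV sf). Qed.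

Lemma smooth_exp f : smooth_on U f -> smooth_on U (fun x => expR (f x)).
Proof. exact: (smooth_tower tower_exp (fun _ _ => I)). Qed.

Lemma smooth_cos f : smooth_on U f -> smooth_on U (fun x => cos (f x)).
Proof. exact: (smooth_tower (tower_cos_sin true) (fun _ _ => I)). Qed.

Lemma smooth_sin f : smooth_on U f -> smooth_on U (fun x => sin (f x)).
Proof. exact: (smooth_tower (tower_cos_sin false) (fun _ _ => I)). Qed.

Lemma smooth_inv f : (forall x, U x -> f x != 0) ->
  smooth_on U f -> smooth_on U (fun x => (f x)^-1).
Proof. exact: (smooth_tower tower_inv). Qed.

Lemma smooth_ln f : (forall x, U x -> 0 < f x) ->
  smooth_on U f -> smooth_on U (fun x => ln (f x)).
Proof. exact: (smooth_tower tower_ln). Qed.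

Lemma smooth_cutoff f : smooth_on U f -> smooth_on U (fun x => cutoff (f x)).
Proof.
move=> sf.
have s1 : smooth_on U (fun x => flat 1 (1 - f x)).
  exact: (smooth_tower tower_flat (fun _ _ => I)
            (smooth_sub_fun oU (smooth_cst oU 1) sf)).
have s2 : smooth_on U (fun x => flat 1 (f x - 4^-1)).
  exact: (smooth_tower tower_flat (fun _ _ => I)
            (smooth_sub_fun oU sf (smooth_cst oU _))).
apply: (smooth_mul oU s1); apply: smooth_inv (smooth_add oU s1 s2) => x _.
by rewrite gt_eqF// cutoff_den_gt0.
Qed.

End OneVariable.

(** * Complex valued smooth functions *)

Section ComplexParts.
Variable R : rcfType.
Implicit Types z w : R[i].
Local Notation Re := (@complex.Re R).
Local Notation Im := (@complex.Im R).

Lemma complexP z w : Re z = Re w -> Im z = Im w -> z = w.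
Proof. by case: z w => a b [c d] /= -> ->. Qed.

Lemma ReD z w : Re (z + w) = Re z + Re w.
Proof. by case: z w => a b [c d]. Qed.

Lemma ImD z w : Im (z + w) = Im z + Im w.
Proof. by case: z w => a b [c d]. Qed.

Lemma ReM z w : Re (z * w) = Re z * Re w - Im z * Im w.
Proof. by case: z w => a b [c d]. Qed.

Lemma ImM z w : Im (z * w) = Re z * Im w + Im z * Re w.
Proof. by case: z w => a b [c d]. Qed.

Lemma ReN z : Re (- z) = - Re z.
Proof. by case: z. Qed.

Lemma Re_sum (I : Type) (r : seq I) (P : pred I) (F : I -> R[i]) :
  Re (\sum_(i <- r | P i) F i) = \sum_(i <- r | P i) Re (F i).
Proof. by elim/big_rec2: _ => // i x y _ <-; rewrite ReD. Qed.

Lemma Im_sum (I : Type) (r : seq I) (P : pred I) (F : I -> R[i]) :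
  Im (\sum_(i <- r | P i) F i) = \sum_(i <- r | P i) Im (F i).
Proof. by elim/big_rec2: _ => // i x y _ <-; rewrite ImD. Qed.

End ComplexParts.

Section ComplexSmooth.
Variables (R : realType) (m n : nat).
Local Notation M := 'M[R]_(m, n).
Local Notation Re := (@complex.Re R).
Local Notation Im := (@complex.Im R).
Implicit Types (F G : M -> R[i]) (f : M -> R) (U : set M) (x : M).

Definition csmooth U F :=
  smooth_on U (fun x => Re (F x)) /\ smooth_on U (fun x => Im (F x)).

Definition cpderivs (s : seq ('I_m * 'I_n)) F : M -> R[i] := foldr (@cpderiv R m n) F s.

Lemma Re_cpderivs s F : (fun x => Re (cpderivs s F x)) = pderivs s (fun x => Re (F x)).
Proof. by elim: s => //= ij s ->. Qed.

Lemma Im_cpderivs s F : (fun x => Im (cpderivs s F x)) = pderivs s (fun x => Im (F x)).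
Proof. by elim: s => //= ij s ->. Qed.

Lemma cpderivsE s F x : cpderivs s F x =
  pderivs s (fun x => Re (F x)) x +i* pderivs s (fun x => Im (F x)) x.
Proof. by rewrite -Re_cpderivs -Im_cpderivs; case: (cpderivs s F x). Qed.

Lemma cpderivs_cat s t F : cpderivs (s ++ t) F = cpderivs s (cpderivs t F).
Proof. by rewrite /cpderivs foldr_cat. Qed.

Lemma csmooth_cpderivs U F s : csmooth U F -> csmooth U (cpderivs s F).
Proof.
move=> [sr si]; split; rewrite ?Re_cpderivs ?Im_cpderivs; exact: smooth_pderivs.
Qed.

Lemma cpderivs_near F G s x : (\forall y \near x, F y = G y) ->
  \forall y \near x, cpderivs s F y = cpderivs s G y.
Proof.
move=> FG; elim: s => [|ij s IH]; first exact: FG.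
have := near_join IH; apply: filterS => y hy; rewrite /= /cpderiv.
congr (_ +i* _).
  by apply: pderiv_near; apply: filterS hy => z ->.
by apply: pderiv_near; apply: filterS hy => z ->.
Qed.

Lemma cpderivs_near_eq F G s x : (\forall y \near x, F y = G y) ->
  cpderivs s F x = cpderivs s G x.
Proof. by move=> h; exact: (nbhs_singleton (@cpderivs_near F G s x h)). Qed.

Variables (U : set M) (oU : open U).

Lemma near_on (P : M -> Prop) x : (forall y, U y -> P y) -> U x ->
  \forall y \near x, P y.
Proof. by move=> UP Ux; apply: filterS UP _; exact: open_nbhs_nbhs. Qed.

Lemma cpderivs_on F G s : (forall x, U x -> F x = G x) ->
  forall x, U x -> cpderivs s F x = cpderivs s G x.
Proof. by move=> FG x Ux; apply: cpderivs_near_eq; exact: near_on Ux. Qed.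

Lemma csmooth_ext F G : (forall x, U x -> F x = G x) -> csmooth U F -> csmooth U G.
Proof.
move=> FG [sr si]; split.
  by apply: (smooth_ext oU _ sr) => x Ux; rewrite FG.
by apply: (smooth_ext oU _ si) => x Ux; rewrite FG.
Qed.

Lemma csmooth_cst a : csmooth U (fun=> a).
Proof. by split; exact: smooth_cst. Qed.

Lemma csmooth_add F G : csmooth U F -> csmooth U G -> csmooth U (fun x => F x + G x).
Proof.
move=> [Fr Fi] [Gr Gi]; split.
  by under eq_fun do rewrite ReD; exact: (smooth_add oU Fr Gr).
by under eq_fun do rewrite ImD; exact: (smooth_add oU Fi Gi).
Qed.

Lemma csmooth_mul F G : csmooth U F -> csmooth U G -> csmooth U (fun x => F x * G x).
Proof.
move=> [Fr Fi] [Gr Gi]; split.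
  under eq_fun do rewrite ReM.
  exact: (smooth_sub_fun oU (smooth_mul oU Fr Gr) (smooth_mul oU Fi Gi)).
under eq_fun do rewrite ImM.
exact: (smooth_add oU (smooth_mul oU Fr Gi) (smooth_mul oU Fi Gr)).
Qed.

Lemma csmooth_bigsum (I : Type) (r : seq I) (P : pred I) (F : I -> M -> R[i]) :
  (forall i, csmooth U (F i)) -> csmooth U (fun x => \sum_(i <- r | P i) F i x).
Proof.
move=> sF; elim: r => [|i r IH].
  under eq_fun do rewrite big_nil; exact: csmooth_cst.
under eq_fun do rewrite big_cons.
by case: (P i); [exact: (csmooth_add (sF i) IH)|exact: IH].
Qed.

Lemma csmooth_real f : smooth_on U f -> csmooth U (fun x => (f x)%:C).
Proof. by move=> sf; split=> //=; exact: smooth_cst. Qed.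

Lemma csmooth_lin (a : R[i]) F G : csmooth U F -> csmooth U G ->
  csmooth U (fun x => a * F x + G x).
Proof. by move=> sF sG; exact: (csmooth_add (csmooth_mul (csmooth_cst a) sF) sG). Qed.

Lemma cpderiv_add F G ij x : csmooth U F -> csmooth U G -> U x ->
  cpderiv ij (fun y => F y + G y) x = cpderiv ij F x + cpderiv ij G x.
Proof.
move=> [Fr Fi] [Gr Gi] Ux; rewrite /cpderiv.
apply: complexP; rewrite ?ReD ?ImD /=.
  have -> : (fun y => Re (F y + G y)) = (fun y => Re (F y) + Re (G y)).
    by apply/funext => y; rewrite ReD.
  exact: (pderiv_add ij Fr Gr Ux).
have -> : (fun y => Im (F y + G y)) = (fun y => Im (F y) + Im (G y)).
  by apply/funext => y; rewrite ImD.
exact: (pderiv_add ij Fi Gi Ux).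
Qed.

Lemma cpderiv_mul F G ij x : csmooth U F -> csmooth U G -> U x ->
  cpderiv ij (fun y => F y * G y) x = F x * cpderiv ij G x + G x * cpderiv ij F x.
Proof.
move=> [Fr Fi] [Gr Gi] Ux; rewrite /cpderiv.
apply: complexP; rewrite ?ReD ?ImD ?ReM ?ImM /=.
  have -> : (fun y => Re (F y * G y)) =
            (fun y => Re (F y) * Re (G y) + (- Im (F y)) * Im (G y)).
    by apply/funext => y; rewrite ReM mulNr.
  have sN := smooth_opp oU Fi.
  rewrite (pderiv_add ij (smooth_mul oU Fr Gr) (smooth_mul oU sN Gi) Ux).
  rewrite (pderiv_mul ij Fr Gr Ux) (pderiv_mul ij sN Gi Ux).
  have -> : pderiv ij (fun y => - Im (F y)) x = - pderiv ij (fun y => Im (F y)) x.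
    have := @pderiv_lin R m n U oU (-1) _ (fun=> 0) ij x Fi (smooth_cst oU 0) Ux.
    rewrite pderiv_cst addr0 mulN1r => <-.
    by congr (pderiv ij _ x); apply/funext => y; rewrite mulN1r addr0.
  by ring.
have -> : (fun y => Im (F y * G y)) = (fun y => Re (F y) * Im (G y) + Im (F y) * Re (G y)).
  by apply/funext => y; rewrite ImM.
rewrite (pderiv_add ij (smooth_mul oU Fr Gi) (smooth_mul oU Fi Gr) Ux).
rewrite (pderiv_mul ij Fr Gi Ux) (pderiv_mul ij Fi Gr Ux); ring.
Qed.

Lemma cpderiv_cst (a : R[i]) ij x : cpderiv ij (fun=> a) x = 0.
Proof. by apply: complexP; rewrite /= pderiv_cst. Qed.

Lemma cpderiv_lin (a : R[i]) F G ij x : csmooth U F -> csmooth U G -> U x ->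
  cpderiv ij (fun y => a * F y + G y) x = a * cpderiv ij F x + cpderiv ij G x.
Proof.
move=> sF sG Ux; have sa := csmooth_cst a.
rewrite (cpderiv_add ij (csmooth_mul sa sF) sG Ux).
by rewrite (cpderiv_mul ij sa sF Ux) cpderiv_cst mulr0 addr0.
Qed.

Lemma cpderivs_lin (a : R[i]) F G s x : csmooth U F -> csmooth U G -> U x ->
  cpderivs s (fun y => a * F y + G y) x = a * cpderivs s F x + cpderivs s G x.
Proof.
move=> sF sG; elim: s x => [//|ij s IH] x Ux.
rewrite [LHS](_ : _ = cpderiv ij (fun y => a * cpderivs s F y + cpderivs s G y) x).
  exact: (cpderiv_lin a ij (csmooth_cpderivs s sF) (csmooth_cpderivs s sG) Ux).
exact: (cpderivs_on [:: ij] IH Ux).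
Qed.

Lemma cpderivs_perm F s t x : csmooth U F -> U x -> perm_eq s t ->
  cpderivs s F x = cpderivs t F x.
Proof.
move=> [Fr Fi] Ux st; rewrite !cpderivsE.
by rewrite (pderivs_perm oU Fr Ux st) (pderivs_perm oU Fi Ux st).
Qed.

End ComplexSmooth.

Section ComplexPull.
Variables (R : realType) (m n : nat).
Local Notation M := 'M[R]_(m, n).
Local Notation Re := (@complex.Re R).
Local Notation Im := (@complex.Im R).
Implicit Types (f : M -> R) (x : M).
Variables (U : set M) (oU : open U).

Lemma csmooth_pull m' n' (phi : M -> 'M[R]_(m', n')) (V : set 'M[R]_(m', n'))
    (F : 'M[R]_(m', n') -> R[i]) :
  open V -> csmooth V F -> (forall x, U x -> V (phi x)) ->
  (forall i j, smooth_on U (fun x => phi x i j)) -> csmooth U (fun x => F (phi x)).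
Proof.
move=> oV [Fr Fi] UV sphi.
by split; [exact: (smooth_pull oU oV Fr UV sphi)|exact: (smooth_pull oU oV Fi UV sphi)].
Qed.

Lemma cpderiv_pull m' n' (phi : M -> 'M[R]_(m', n')) (V : set 'M[R]_(m', n'))
    (F : 'M[R]_(m', n') -> R[i]) ij x :
  open V -> csmooth V F -> (forall x, U x -> V (phi x)) ->
  (forall i j, smooth_on U (fun x => phi x i j)) -> U x ->
  cpderiv ij (fun y => F (phi y)) x
  = \sum_kl (pderiv ij (fun y => phi y kl.1 kl.2) x)%:C * cpderiv kl F (phi x).
Proof.
move=> oV [Fr Fi] UV sphi Ux; apply: complexP.
  rewrite Re_sum; apply: etrans (pderiv_pull ij oV Fr UV sphi Ux) _.
  by apply: eq_bigr => kl _; rewrite ReM /= mul0r subr0.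
rewrite Im_sum; apply: etrans (pderiv_pull ij oV Fi UV sphi Ux) _.
by apply: eq_bigr => kl _; rewrite ImM /= mul0r addr0.
Qed.

Lemma csmooth_cexp (z : R[i]) f : smooth_on U f -> csmooth U (fun x => cexp (z * (f x)%:C)).
Proof.
move=> sf.
have sa := smooth_mul oU (smooth_cst oU (Re z)) sf.
have sb := smooth_mul oU (smooth_cst oU (Im z)) sf.
have Ea x : Re (z * (f x)%:C) = Re z * f x by rewrite ReM mulr0 subr0.
have Eb x : Im (z * (f x)%:C) = Im z * f x by rewrite ImM mulr0 add0r.
split; rewrite /cexp /=; under eq_fun do rewrite Ea Eb.
  exact: (smooth_mul oU (smooth_exp oU sa) (smooth_cos oU sb)).
exact: (smooth_mul oU (smooth_exp oU sa) (smooth_sin oU sb)).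
Qed.

End ComplexPull.

Section VectorSmooth.
Variables (R : realType) (m n : nat).
Local Notation M := 'M[R]_(m, n).
Local Notation Re := (@complex.Re R).
Local Notation Im := (@complex.Im R).
Variables (U : set M) (oU : open U).

Lemma vsmooth_sum (W : vectType R[i]) (I : Type) (r : seq I) (P : pred I)
    (F : I -> M -> R[i]) (w : I -> W) : (forall i, csmooth U (F i)) ->
  vsmooth_on U (fun x => \sum_(i <- r | P i) F i x *: w i).
Proof.
move=> sF [j b].
have [sr si] : csmooth U (fun x => \sum_(i <- r | P i) F i x * coord (vbasis {:W}) j (w i)).
  apply: (csmooth_bigsum oU) => i.
  exact: (csmooth_mul oU (sF i) (csmooth_cst oU _)).
rewrite /rcoord /=.
have E x : coord (vbasis {:W}) j (\sum_(i <- r | P i) F i x *: w i) =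
           \sum_(i <- r | P i) F i x * coord (vbasis {:W}) j (w i).
  by rewrite linear_sum /=; apply: eq_bigr => i _; rewrite linearZ.
by case: b; under eq_fun do rewrite E.
Qed.

Lemma vsmooth_coord (W : vectType R[i]) (f : M -> W) i :
  vsmooth_on U f -> csmooth U (fun x => coord (vbasis {:W}) i (f x)).
Proof. by move=> sf; split; [exact: (sf (i, false))|exact: (sf (i, true))]. Qed.

(** The basis [vbasis] of [R[i]^o] is unspecified, so [rcoord] does not simply return the real and
    imaginary parts; the two pairs are related by multiplication with a constant. *)
Lemma vsmooth_scalar (f : M -> R[i]) : vsmooth_on (W := R[i]^o) U f <-> csmooth U f.
Proof.
split=> [sf|sf].
  have E x : f x = \sum_(i < \dim {:R[i]^o}) coord (vbasis {:R[i]^o}) i (f x) * (vbasis {:R[i]^o})`_i.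
    have := coord_vbasis (memvf (f x : R[i]^o)); rewrite {1}/GRing.scale /=.
    by move=> {1}->.
  apply: (csmooth_ext oU (fun x _ => esym (E x))).
  apply: (csmooth_bigsum oU) => i.
  exact: (csmooth_mul oU (vsmooth_coord i sf) (csmooth_cst oU _)).
have := @vsmooth_sum R[i]^o 'I_1 (index_enum 'I_1) xpredT (fun=> f) (fun=> 1) (fun=> sf).
by under eq_fun do rewrite big_ord1 /GRing.scale /= mulr1.
Qed.

End VectorSmooth.

(** * Homogeneous polynomials and jets *)

Section PolynomialFunctions.
Variables (R : realType) (q : nat).
Local Notation P := (mpoly q R[i]).
Local Notation oT := (@openT 'cV[R]_q).
Implicit Types (p : P) (k : multinom q) (x v : 'cV[R]_q).

Definition evalc x : 'I_q -> R[i] := fun i => (x i ord0)%:C.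

Definition polyfun p : 'cV[R]_q -> R[i] := fun x => meval (evalc x) p.

Definition mlist k : seq ('I_q * 'I_1) :=
  flatten [seq nseq (k j) (j, ord0) | j <- enum 'I_q].

Lemma mlist0 : mlist mnm0 = [::].
Proof. by rewrite /mlist; elim: (enum _) => //= i s ->; rewrite mnm0E. Qed.

Let good p := csmooth setT (polyfun p) /\
  forall j x, cpderiv (j, ord0) (polyfun p) x = polyfun (mderiv j p) x.

(** Smoothness and the derivative formula are proved together, because the rules for sums and
    products presuppose smoothness; constants and variables generate all polynomials. *)
Lemma polyfun_good p : good p.
Proof.
have goodD p1 p2 : good p1 -> good p2 -> good (p1 + p2).
  move=> [s1 d1] [s2 d2].
  have E r1 r2 : polyfun (r1 + r2) = (fun x => polyfun r1 x + polyfun r2 x).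
    by apply/funext => x; rewrite /polyfun mevalD.
  split; first by rewrite E; exact: (csmooth_add oT s1 s2).
  by move=> j x; rewrite E (cpderiv_add (j, ord0) s1 s2 I) mderivD E d1 d2.
have goodM p1 p2 : good p1 -> good p2 -> good (p1 * p2).
  move=> [s1 d1] [s2 d2].
  have E r1 r2 : polyfun (r1 * r2) = (fun x => polyfun r1 x * polyfun r2 x).
    by apply/funext => x; rewrite /polyfun mevalM.
  split; first by rewrite E; exact: (csmooth_mul oT s1 s2).
  move=> j x; rewrite E (cpderiv_mul oT (j, ord0) s1 s2 I) mderivM d1 d2.
  by rewrite /polyfun mevalD !mevalM addrC [X in X + _]mulrC.
have goodC a : good (mpolyC q a).
  have E b : polyfun (mpolyC q b) = fun=> b by apply/funext => x; rewrite /polyfun mevalC.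
  split; first by rewrite E; exact: (csmooth_cst oT a).
  by move=> j x; rewrite E cpderiv_cst mderivC /polyfun meval0.
have goodX i : good (mpolyX R[i] (mnm1 i)).
  have E : polyfun (mpolyX R[i] (mnm1 i)) = fun x => (x i ord0)%:C.
    by apply/funext => x; rewrite /polyfun mevalXU.
  split; first by rewrite E; exact: (csmooth_real oT (smooth_coord oT i ord0)).
  move=> j x; rewrite E /cpderiv /= pderiv_coord pderiv_cst mderivX mnm1E.
  rewrite /polyfun mevalZ; have [->|ij] := eqVneq i j; last first.
    by rewrite mul0r; congr (_ +i* _); rewrite xpair_eqE (negbTE ij).
  have -> : mnm_sub (mnm1 j) (mnm1 j) = mnm0 by apply/mnmP => l; rewrite mnmBE mnm0E subnn.
  by rewrite mpolyX0 meval1 mulr1 eqxx.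
have good1 : good 1 by rewrite -[1]/(mpolyC q 1); exact: goodC.
have good0 : good 0 by rewrite -(mpolyC0 q); exact: goodC.
rewrite [p]mpolyE; apply: (big_ind good good0 goodD) => m _.
rewrite -mul_mpolyC; apply: (goodM _ _ (goodC _)); rewrite mpolyXE_id.
apply: (big_ind good good1 goodM) => i _.
elim: (m i) => [|k IH]; first by rewrite expr0; exact: good1.
by rewrite exprS; exact: (goodM _ _ (goodX i) IH).
Qed.

Lemma csmooth_polyfun p : csmooth setT (polyfun p).
Proof. by have [] := polyfun_good p. Qed.

Lemma cpderiv_polyfun p j : cpderiv (j, ord0) (polyfun p) = polyfun (mderiv j p).
Proof. by apply/funext => x; have [_ ->] := polyfun_good p. Qed.

Lemma cpderivs_polyfun p k : cpderivs (mlist k) (polyfun p) = polyfun (mderivm k p).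
Proof.
rewrite mderivm_foldr /mlist; elim: (enum _) => //= j s IH.
rewrite cpderivs_cat IH foldr_cat.
by elim: (k j) => //= i ->; rewrite cpderiv_polyfun.
Qed.

Definition mfact k : nat := (\prod_(j < q) (k j)`!)%N.

Lemma mfact_neq0 k : (mfact k)%:R != 0 :> R[i].
Proof. by rewrite pnatr_eq0 -lt0n prodn_gt0// => j; exact: fact_gt0. Qed.

Lemma polyfun0 p : polyfun p 0 = mcoeff mnm0 p.
Proof.
rewrite {2}[p]mpolyE {1}[p]mpolyE /polyfun !raddf_sum /=; apply: eq_bigr => m _.
rewrite mevalZ mcoeffZ mevalX mcoeffX; congr (_ * _).
have [->|/eqP m0] := eqVneq m mnm0.
  by rewrite big1// => i _; rewrite mnm0E expr0.
suff [i mi] : exists i, m i != 0%N.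
  by rewrite (bigD1 i)//= /evalc mxE expr0n (negbTE mi) mul0r.
apply/existsP; apply: contra_notT m0; rewrite negb_exists => /forallP h.
by apply/mnmP => i; rewrite mnm0E; apply/eqP; rewrite -[_ == _]negbK h.
Qed.

Lemma cpderivs_polyfun0 p k :
  cpderivs (mlist k) (polyfun p) 0 = mcoeff k p * (mfact k)%:R.
Proof.
rewrite cpderivs_polyfun polyfun0 mcoeff_mderivm addm0 mulr_natr.
by congr (_ *+ _); apply: eq_bigr => i _; rewrite ffactnn.
Qed.

(** Real points suffice, since the derivatives at 0 recover the complex coefficients. *)
Lemma polyfun_inj p1 p2 : polyfun p1 =1 polyfun p2 -> p1 = p2.
Proof.
move=> E; apply/mpolyP => k; apply: (mulIf (mfact_neq0 k)).
by rewrite -!cpderivs_polyfun0; congr (cpderivs _ _ _); apply/funext.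
Qed.

(** A list without duplicates, easier to reindex than the bounded type that indexes the sum in
    [opD_mpoly]. *)
Definition mdegs l : seq (multinom q) :=
  [seq bmnm b | b <- enum {: bmultinom q l.+1} & mdeg (bmnm b) == l].

Lemma mem_mdegs l k : (k \in mdegs l) = (mdeg k == l).
Proof.
apply/mapP/eqP => [[b]|kl]; first by rewrite mem_filter => /andP[/eqP + _] ->.
have kb : (mdeg k < l.+1)%N by rewrite kl.
by exists (BMultinom kb) => //; rewrite mem_filter /= kl eqxx mem_enum.
Qed.

Lemma mdegs_uniq l : uniq (mdegs l).
Proof.
rewrite map_inj_uniq; first by apply: filter_uniq; exact: enum_uniq.
by move=> b1 b2 E; exact: val_inj.
Qed.

Lemma sum_mdegs (V : nmodType) l (G : multinom q -> V) :
  \sum_(b : bmultinom q l.+1 | mdeg (bmnm b) == l) G (bmnm b) = \sum_(k <- mdegs l) G k.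
Proof. by rewrite big_map big_filter big_enum_cond. Qed.

(** The terms that survive have k_j > 0, and these k are exactly the shifts, by the j-th unit
    multi-index, of the multi-indices of degree [l]. *)
Lemma mdegs_shift (V : nmodType) l j (G : multinom q -> V) :
  (forall k, k j = 0%N -> G k = 0) ->
  \sum_(k <- mdegs l.+1) G k = \sum_(k <- mdegs l) G (mnm_add k (mnm1 j)).
Proof.
move=> G0; rewrite (bigID (fun k : multinom q => k j != 0%N)) /= [X in _ + X]big1 ?addr0.
  rewrite -big_filter -(big_map (fun k => mnm_add k (mnm1 j)) xpredT).
  apply: perm_big; apply: uniq_perm.
  - by rewrite filter_uniq ?mdegs_uniq.
  - by rewrite map_inj_uniq ?mdegs_uniq//; exact: addIm.
  move=> k; rewrite mem_filter mem_mdegs; apply/andP/mapP => [[kj /eqP kl]|[k']].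
    have E : k = mnm_add (mnm_sub k (mnm1 j)) (mnm1 j).
      rewrite submK//; apply/mnm_lepP => i; rewrite mnm1E.
      by have [<-|//] := eqVneq j i; rewrite lt0n.
    exists (mnm_sub k (mnm1 j)) => //; rewrite mem_mdegs.
    by move: kl; rewrite {1}E mdegD mdeg1 addn1 => -[->].
  rewrite mem_mdegs => /eqP kl ->.
  by rewrite mnmDE mnm1E eqxx addn1 mdegD mdeg1 kl addn1.
by move=> k; rewrite negbK => /eqP /G0.
Qed.

Lemma ytildeE k : ytilde R k = ((mfact k)%:R)^-1 *: mpolyX R[i] k.
Proof. by rewrite /ytilde /mfact natr_prod. Qed.

(** The homogeneous part of degree [l] of the Taylor series at 0; the factorials sit in [ytilde]. *)
Definition jet l (u : 'cV[R]_q -> R[i]) : P :=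
  \sum_(k <- mdegs l) cpderivs (mlist k) u 0 *: ytilde R k.

Lemma polyfun_jet l u v : polyfun (jet l u) v =
  \sum_(k <- mdegs l) cpderivs (mlist k) u 0 * polyfun (ytilde R k) v.
Proof.
by rewrite /polyfun raddf_sum /=; apply: eq_bigr => k _; rewrite mevalZ.
Qed.

Lemma ytilde_shift k j v :
  (k j).+1%:R * polyfun (ytilde R (mnm_add k (mnm1 j))) v
  = (v j ord0)%:C * polyfun (ytilde R k) v.
Proof.
rewrite !ytildeE /polyfun !mevalZ mpolyXD mevalM mevalXU.
have -> : mfact (mnm_add k (mnm1 j)) = ((k j).+1 * mfact k)%N.
  rewrite /mfact (bigD1 j)//= [in RHS](bigD1 j)//= mulnA.
  rewrite mnmDE mnm1E eqxx addn1 factS; congr (_ * _)%N.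
  by apply: eq_bigr => i ij; rewrite mnmDE mnm1E eq_sym (negbTE ij) addn0.
rewrite natrM invfM !mulrA divff ?pnatr_eq0// mul1r.
by rewrite mulrC mulrA.
Qed.

Lemma perm_mlist_shift k j :
  perm_eq (mlist (mnm_add k (mnm1 j))) ((j, ord0) :: mlist k).
Proof.
apply/seq.permP => a; rewrite -cat1s count_cat !count_flatten !sumnE !big_map.
have -> : count a [:: (j, ord0)] = (\sum_(i <- enum 'I_q) count a (nseq (mnm1 j i) (i, ord0)))%N.
  rewrite big_enum /= (bigD1 j)//= mnm1E eqxx /= big1 => [|i ij]; first by rewrite !addn0.
  by rewrite mnm1E eq_sym (negbTE ij).
rewrite -!enumT -big_split /=; apply: eq_bigr => i _.
by rewrite mnmDE nseqD count_cat addnC.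
Qed.

End PolynomialFunctions.

(** * Jets along lines through the origin *)

Section LineJets.
Variables (R : realType) (q : nat) (U : set 'cV[R]_q) (u : 'cV[R]_q -> R[i]).
Hypotheses (oU : open U) (su : csmooth U u).
Local Notation e0 := (ord0 : 'I_1, ord0 : 'I_1).
Local Notation line v := (fun t : 'M[R]_1 => t ord0 ord0 *: v).

Lemma smooth_line (v : 'cV[R]_q) (V : set 'M[R]_1) i j : open V ->
  smooth_on V (fun t => (line v t) i j).
Proof.
move=> oV; under eq_fun do rewrite mxE.
exact: (smooth_mul oV (smooth_coord oV _ _) (smooth_cst oV _)).
Qed.

Lemma open_line (v : 'cV[R]_q) : open (line v @^-1` U).
Proof.
have /continuousP : continuous (line v); last exact.
move=> t; apply: mx_continuous => i j.
exact: smooth_continuous (smooth_line v i j openT) I.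
Qed.

Lemma pderiv_line (v : 'cV[R]_q) i j (t : 'M[R]_1) :
  pderiv e0 (fun t => (line v t) i j) t = v i j.
Proof.
have -> : (fun t => (line v t) i j) = (fun t : 'M[R]_1 => t ord0 ord0 * v i j).
  by apply/funext => s; rewrite mxE.
have s1 := smooth_coord (@openT 'M[R]_1) ord0 ord0.
have s2 := smooth_cst (@openT 'M[R]_1) (v i j).
by rewrite (pderiv_mul e0 s1 s2 I) pderiv_cst pderiv_coord mulr0 add0r mulr1.
Qed.

(** The multinomial expansion of the l-th power of the derivative along [v], stated at every point
    of the line so that the induction can differentiate it. *)
Lemma line_derivative (v : 'cV[R]_q) l (t : 'M[R]_1) : U (line v t) ->
  cpderivs (nseq l e0) (fun t => u (line v t)) t
  = l`!%:R * \sum_(k <- mdegs q l) polyfun (ytilde R k) v * cpderivs (mlist k) u (line v t).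
Proof.
elim: l t => [|l IH] t Ut.
  have -> : mdegs q 0 = [:: mnm0].
    apply: perm_small_eq => //; apply: uniq_perm; rewrite ?mdegs_uniq// => k.
    by rewrite mem_mdegs inE mdeg_eq0.
  rewrite big_seq1 /= ytildeE /polyfun mevalZ mpolyX0 meval1 mulr1.
  have -> : mfact (mnm0 : multinom q) = 1%N by rewrite /mfact big1// => i _; rewrite mnm0E.
  by rewrite mlist0 invr1 !mul1r.
have oV : open (line v @^-1` U) by exact: open_line.
have UV : forall t, (line v @^-1` U) t -> U (line v t) by [].
have sk k := csmooth_cpderivs (mlist k) su.
have sl k : csmooth (line v @^-1` U) (fun t => cpderivs (mlist k) u (line v t)).
  exact: (csmooth_pull oV oU (sk k) UV (fun i j => smooth_line v i j oV)).
rewrite [LHS](@cpderivs_on _ _ _ _ oV _ _ [:: e0] IH t Ut) /=.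
pose c k := polyfun (ytilde R k) v.
pose S (r : seq (multinom q)) (t : 'M[R]_1) :=
  \sum_(k <- r) c k * cpderivs (mlist k) u (line v t).
have sS r : csmooth (line v @^-1` U) (S r).
  by apply: (csmooth_bigsum oV) => k; exact: (csmooth_mul oV (csmooth_cst oV _) (sl k)).
have -> : cpderiv e0 (fun t => l`!%:R * S (mdegs q l) t) t
    = l`!%:R * cpderiv e0 (S (mdegs q l)) t.
  rewrite (cpderiv_mul oV e0 (csmooth_cst oV _) (sS _) Ut) cpderiv_cst.
  by rewrite mulr0 addr0.
have dl k : cpderiv e0 (fun t => cpderivs (mlist k) u (line v t)) t =
   \sum_(j < q) (v j ord0)%:C * cpderivs (mlist (mnm_add k (mnm1 j))) u (line v t).
  rewrite (cpderiv_pull e0 oU (sk k) UV (fun i j => smooth_line v i j oV) Ut).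
  rewrite (reindex (fun j : 'I_q => (j, ord0 : 'I_1))) /=; last first.
    exists (fun ij : 'I_q * 'I_1 => ij.1) => [j _|[i j] _]; first by [].
    by rewrite /= (ord1 j).
  apply: eq_bigr => j _; rewrite pderiv_line; congr (_ * _).
  by rewrite (cpderivs_perm oU su Ut (perm_mlist_shift k j)).
have dS r : cpderiv e0 (S r) t = \sum_(k <- r) c k *
   \sum_(j < q) (v j ord0)%:C * cpderivs (mlist (mnm_add k (mnm1 j))) u (line v t).
  elim: r => [|k r IHr].
    rewrite big_nil -[RHS](cpderiv_cst 0 e0 t); congr (cpderiv _ _ _).
    by apply/funext => x; rewrite /S big_nil.
  rewrite big_cons -dl -IHr.
  have -> : S (k :: r) = fun x => c k * cpderivs (mlist k) u (line v x) + S r x.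
    by apply/funext => x; rewrite /S big_cons.
  exact: (cpderiv_lin oV (c k) e0 (sl k) (sS r) Ut).
rewrite dS factS mulnC natrM -mulrA; congr (_ * _).
transitivity (\sum_(k <- mdegs q l) \sum_(j < q)
    c k * ((v j ord0)%:C * cpderivs (mlist (mnm_add k (mnm1 j))) u (line v t))).
  by apply: eq_bigr => k _; rewrite mulr_sumr.
rewrite exchange_big /= mulr_sumr.
transitivity (\sum_(j < q) \sum_(k <- mdegs q l.+1)
    (k j)%:R * (c k * cpderivs (mlist k) u (line v t))).
  apply: eq_bigr => j _; rewrite [RHS](@mdegs_shift _ _ _ j); last first.
    by move=> k ->; rewrite mul0r.
  apply: eq_bigr => k _.
  rewrite mnmDE mnm1E eqxx addn1 [RHS]mulrA /c ytilde_shift.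
  by rewrite [LHS]mulrCA [LHS]mulrA.
(* The factors k_j collected from the shifts sum to the degree, which is the factor l + 1 missing in
   the factorial. *)
rewrite exchange_big /= [LHS]big_seq [RHS]big_seq; apply: eq_bigr => k.
rewrite mem_mdegs => /eqP kl.
by rewrite -mulr_suml -natr_sum -mdegE kl.
Qed.

(** A homogeneous polynomial is known from its values, so jets reduce to derivatives in one
    variable; [jet_twist] and [jet_power] rest on this. *)
Lemma line_jet (v : 'cV[R]_q) l : U 0 ->
  cpderivs (nseq l e0) (fun t => u (line v t)) 0 = l`!%:R * polyfun (jet l u) v.
Proof.
move=> U0; rewrite line_derivative; last by rewrite /= mxE scale0r.
rewrite polyfun_jet; congr (_ * _); apply: eq_bigr => k _.
by rewrite mulrC mxE scale0r.
Qed.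

End LineJets.

(** * Derivatives along the hyperplane x_n = 0 and transversal to it *)

Section AffineReparametrization.
Variables (R : realType).

(** A partial derivative sees only the restriction to one line, which makes functions on spaces of
    different dimensions comparable. *)
Lemma pderiv_line_eq m n m' n' (f : 'M[R]_(m, n) -> R) (g : 'M[R]_(m', n') -> R) ij kl x y :
  (forall t : R, f (t *: delta_mx ij.1 ij.2 + x) = g (t *: delta_mx kl.1 kl.2 + y)) ->
  pderiv ij f x = pderiv kl g y.
Proof.
move=> E; rewrite /pderiv /derive.
have E0 := E 0; rewrite !scale0r !add0r in E0.
suff -> : (fun h : R => h^-1 *: ((f \o shift x) (h *: delta_mx ij.1 ij.2) - f x))
  = (fun h : R => h^-1 *: ((g \o shift y) (h *: delta_mx kl.1 kl.2) - g y)) by [].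
by apply/funext => h /=; rewrite E E0.
Qed.

Lemma cpderiv_line_eq m n m' n' (F : 'M[R]_(m, n) -> R[i]) (G : 'M[R]_(m', n') -> R[i])
    ij kl x y :
  (forall t : R, F (t *: delta_mx ij.1 ij.2 + x) = G (t *: delta_mx kl.1 kl.2 + y)) ->
  cpderiv ij F x = cpderiv kl G y.
Proof.
by move=> E; rewrite /cpderiv; congr (_ +i* _);
  apply: (@pderiv_line_eq _ _ _ _ _ _ ij kl) => t; rewrite E.
Qed.

Lemma cpderivs_translate m n (F : 'M[R]_(m, n) -> R[i]) s w x :
  cpderivs s (fun y => F (w + y)) x = cpderivs s F (w + x).
Proof.
elim: s x => [//|ij s IH] x /=; rewrite (_ : cpderivs s _ = fun y => cpderivs s F (w + y)).
  by apply: cpderiv_line_eq => t; rewrite addrCA.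
by apply/funext.
Qed.

Variable p : nat.
Local Notation wd := (widen_ord (leqnSn p)).
Local Notation en := (ord_max : 'I_p.+1, ord0 : 'I_1).

Lemma ord_widenP (i : 'I_p.+1) : (exists j, i = wd j) \/ i = ord_max.
Proof.
have [ip|ip] := ltnP i p; first by left; exists (Ordinal ip); exact: val_inj.
by right; apply: val_inj; apply/eqP; rewrite eqn_leq /= -ltnS ltn_ord ip.
Qed.

Lemma embx_widen (x : 'cV[R]_p) j k : embx x (wd j) k = x j k.
Proof.
rewrite castmxE (_ : cast_ord _ (wd j) = lshift 1 j); last exact: val_inj.
by rewrite col_mxEu cast_ord_id.
Qed.

Lemma embx_max (x : 'cV[R]_p) k : embx x ord_max k = 0.
Proof.
rewrite castmxE (_ : cast_ord _ ord_max = rshift p (ord0 : 'I_1)); last first.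
  by apply: val_inj; rewrite /= addn0.
by rewrite col_mxEd mxE.
Qed.

Lemma cVnP (x y : 'cV[R]_p.+1) : (forall j, x (wd j) ord0 = y (wd j) ord0) ->
  x ord_max ord0 = y ord_max ord0 -> x = y.
Proof.
move=> h1 h2; apply/matrixP => i j; rewrite (ord1 j).
by have [[k ->]|->] := ord_widenP i.
Qed.

Lemma embx_lin (a : R) (x y : 'cV[R]_p) : embx (a *: x + y) = a *: embx x + embx y.
Proof.
by apply: cVnP => [j|]; rewrite !mxE ?embx_widen ?embx_max ?mxE ?mulr0 ?addr0.
Qed.

Lemma embx0 : embx (0 : 'cV[R]_p) = 0.
Proof. by apply: cVnP => [j|]; rewrite ?embx_widen ?embx_max !mxE. Qed.

Lemma embx_delta j : embx (delta_mx j ord0 : 'cV[R]_p) = delta_mx (wd j) ord0.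
Proof.
apply: cVnP => [i|]; rewrite ?embx_widen ?embx_max !mxE ?eqxx ?andbT.
  by congr (_%:R); apply/eqP/eqP => [->//|/(congr1 val) /= /val_inj].
by case: eqP => // /(congr1 val) /= E; have := ltn_ord j; rewrite -E ltnn.
Qed.

Definition wlist (s : seq ('I_p * 'I_1)) : seq ('I_p.+1 * 'I_1) :=
  [seq (wd ij.1, ij.2) | ij <- s].

Lemma cpderivs_embx (F : 'cV[R]_p.+1 -> R[i]) s x :
  cpderivs s (fun x' => F (embx x')) x = cpderivs (wlist s) F (embx x).
Proof.
elim: s x => [//|[i j] s IH] x /=.
rewrite (_ : cpderivs s _ = fun y => cpderivs (wlist s) F (embx y)).
  by apply: cpderiv_line_eq => t; rewrite (ord1 j) embx_lin embx_delta.
by apply/funext.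
Qed.

Lemma dlastE m (F : 'cV[R]_p.+1 -> R[i]) : dlast m F = cpderivs (nseq m en) F.
Proof. by rewrite /dlast; elim: m => //= m ->. Qed.

Lemma dfirstE l (F : 'cV[R]_p.+1 -> R[i]) : dfirst l F = cpderivs (wlist (mlist l)) F.
Proof.
rewrite /dfirst /mlist; elim: (enum _) => //= j s ->.
rewrite /wlist map_cat cpderivs_cat; elim: (l j) => //= i ->.
by [].
Qed.

Lemma opD_translate m l (F : 'cV[R]_p.+1 -> R[i]) x :
  opD m l F x = opD m l (fun y => F (embx x + y)) 0.
Proof.
apply: val_inj; rewrite /= /opD_mpoly; apply: eq_bigr => k _.
by rewrite !dlastE !dfirstE -!cpderivs_cat cpderivs_translate embx0 addr0.
Qed.

(** Mixed derivatives commute, so those in x_n can be taken before the others; what remains is the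
    jet in x' of a single function on the hyperplane. *)
Lemma opD_jet U m l (F : 'cV[R]_p.+1 -> R[i]) : open U -> csmooth U F -> U 0 ->
  mpoly_of_dhomog (opD m l F 0) = jet l (fun x => dlast m F (embx x)).
Proof.
move=> oU sF U0; rewrite /= /opD_mpoly.
rewrite (@sum_mdegs p _ l (fun k => dlast m (dfirst k F) (embx 0) *: ytilde R k)).
apply: eq_bigr => k _; congr (_ *: _).
rewrite cpderivs_embx dlastE dfirstE -!cpderivs_cat dlastE -cpderivs_cat embx0.
by apply: (cpderivs_perm oU sF U0); rewrite perm_catC.
Qed.

Lemma csmooth_embx U (F : 'cV[R]_p.+1 -> R[i]) : open U -> csmooth U F ->
  csmooth ((@embx R p) @^-1` U) (fun x => F (embx x)).
Proof.
move=> oU sF.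
have se V i j : open V -> smooth_on V (fun x : 'cV[R]_p => embx x i j).
  move=> oV; have [[k ->]|->] := ord_widenP i.
    under eq_fun do rewrite embx_widen; exact: smooth_coord.
  by under eq_fun do rewrite embx_max; exact: smooth_cst.
have oV : open ((@embx R p) @^-1` U).
  have /continuousP : continuous (@embx R p); last exact.
  move=> t; apply: mx_continuous => i j.
  exact: smooth_continuous (se setT i j openT) I.
have UV : forall x, ((@embx R p) @^-1` U) x -> U (embx x) by [].
exact: (csmooth_pull oV oU sF UV (fun i j => se _ i j oV)).
Qed.

(** In the direction x_n the multiplier [C] and the speed [s] are constant and [Psi] is affine, so
    each derivative yields one factor [s] and no lower order term. *)
Lemma dlast_twist (O : set 'cV[R]_p.+1) (F C : 'cV[R]_p.+1 -> R[i])
    (Psi : 'cV[R]_p.+1 -> 'cV[R]_p.+1) (s : 'cV[R]_p.+1 -> R) m :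
  open O -> csmooth setT F ->
  (forall (t : R) x, O x -> C (t *: delta_mx ord_max ord0 + x) = C x) ->
  (forall (t : R) x, O x -> s (t *: delta_mx ord_max ord0 + x) = s x) ->
  (forall (t : R) x, O x ->
     Psi (t *: delta_mx ord_max ord0 + x) = (t * s x) *: delta_mx ord_max ord0 + Psi x) ->
  forall x, O x -> dlast m (fun x => C x * F (Psi x)) x
    = C x * (s x ^+ m)%:C * dlast m F (Psi x).
Proof.
move=> oO sF hC hs hPsi; rewrite !dlastE.
elim: m => [|m IH] x Ox; first by rewrite /= expr0 mulr1.
rewrite [LHS](@cpderivs_on _ _ _ _ oO _ _ [:: en] IH x Ox) /=.
pose G := cpderivs (nseq m en) F.
have sG : csmooth setT G by exact: csmooth_cpderivs.
(* An affine map that reproduces [Psi] on the line through [x] in the direction x_n, once [x] is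
   translated to [Psi x]; the chain rule is applied to it, as [Psi] is controlled along these lines
   only. *)
pose phi (z : 'cV[R]_p.+1) := Psi x + s x *: (z - Psi x).
have oT := @openT 'cV[R]_p.+1.
have sphi i j : smooth_on setT (fun z => phi z i j).
  under eq_fun do rewrite !mxE.
  exact: (smooth_add oT (smooth_cst oT _) (smooth_mul oT (smooth_cst oT _)
    (smooth_add oT (smooth_coord oT i j) (smooth_cst oT _)))).
have sK : csmooth setT (fun z => G (phi z)).
  exact: (csmooth_pull oT oT sG (fun _ _ => I) sphi).
rewrite (@cpderiv_line_eq _ _ _ _ _
   (fun z => (C x * (s x ^+ m)%:C) * G (phi z) + 0) _ en x (Psi x)); last first.
  move=> t; rewrite hC// hs// hPsi// addr0; congr (_ * G _).
  by rewrite /phi addrK addrC scalerA mulrC.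
rewrite (cpderiv_lin oT _ en sK (csmooth_cst oT 0) I) cpderiv_cst addr0.
rewrite (cpderiv_pull en oT sG (fun _ _ => I) sphi I).
have dphi (kl : 'I_p.+1 * 'I_1) : pderiv en (fun z => phi z kl.1 kl.2) (Psi x) = s x * (kl == en)%:R.
  have -> : (fun z => phi z kl.1 kl.2) =
      (fun z => s x * z kl.1 kl.2 + ((1 - s x) * Psi x kl.1 kl.2)).
    apply/funext => z; rewrite !mxE; ring.
  rewrite (pderiv_lin oT _ en (smooth_coord oT _ _) (smooth_cst oT _) I).
  by rewrite pderiv_cst addr0 pderiv_coord -surjective_pairing.
rewrite (bigD1 en)// big1 ?addr0 => [|kl /andP[_ /negbTE kn]]; last first.
  by rewrite dphi kn mulr0 mul0r.
rewrite dphi eqxx mulr1 /phi subrr scaler0 addr0 exprSr rmorphM /=.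
by rewrite addr0 !mulrA.
Qed.

End AffineReparametrization.

(** * Jets in one variable and Bol's lemma *)

Section OneVariableJets.
Variable R : realType.
Local Notation e0 := (ord0 : 'I_1, ord0 : 'I_1).
Local Notation T := 'M[R]_1.
Local Notation oT := (@openT T).
Implicit Types (b : R) (t : T) (G w : T -> R[i]).

(** The real line is encoded as the 1 by 1 matrices, so that the calculus of partial derivatives
    applies to it. *)
Definition aff (a b : R) : T -> R := fun t => a + t ord0 ord0 * b.

Lemma smooth_aff (O : set T) a b : open O -> smooth_on O (aff a b).
Proof.
by move=> oO; exact: (smooth_add oO (smooth_cst oO a)
  (smooth_mul oO (smooth_coord oO ord0 ord0) (smooth_cst oO b))).
Qed.

Lemma pderiv_aff a b t : pderiv e0 (aff a b) t = b.
Proof.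
have s1 := smooth_coord oT ord0 ord0; have s2 := smooth_cst oT b.
have -> : aff a b = (fun t : T => a + t ord0 ord0 * b) by [].
rewrite (pderiv_add e0 (smooth_cst oT a) (smooth_mul oT s1 s2) I).
by rewrite (pderiv_mul e0 s1 s2 I) !pderiv_cst pderiv_coord mulr0 !add0r mulr1.
Qed.

Lemma cpderiv_real m n (f : 'M[R]_(m, n) -> R) ij x :
  cpderiv ij (fun x => (f x)%:C) x = (pderiv ij f x)%:C.
Proof. by rewrite /cpderiv /= pderiv_cst. Qed.

Lemma cpderiv_aff a b t : cpderiv e0 (fun t => (aff a b t)%:C) t = b%:C.
Proof. by rewrite cpderiv_real pderiv_aff. Qed.

(** Leibniz's formula has only two terms, the second derivative of an affine function being 0. *)
Lemma leibniz_aff (O : set T) a b G N t : open O -> csmooth O G -> O t ->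
  cpderivs (nseq N.+1 e0) (fun t => (aff a b t)%:C * G t) t
  = (aff a b t)%:C * cpderivs (nseq N.+1 e0) G t
    + N.+1%:R * b%:C * cpderivs (nseq N e0) G t.
Proof.
move=> oO sG; have sa := csmooth_real oO (smooth_aff a b oO).
have sn N' := csmooth_cpderivs (nseq N' e0) sG.
elim: N t => [|N IH] t Ot.
  rewrite [LHS](cpderiv_mul oO e0 sa sG Ot) cpderiv_aff mul1r.
  by rewrite [G t * _]mulrC.
rewrite [LHS](@cpderivs_on _ _ _ _ oO _ _ [:: e0] IH t Ot) /=.
have sc := csmooth_mul oO (csmooth_cst oO (N.+1%:R * b%:C)) (sn N).
rewrite (cpderiv_add e0 (csmooth_mul oO sa (sn N.+1)) sc Ot).
rewrite (cpderiv_mul oO e0 sa (sn N.+1) Ot) cpderiv_aff.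
rewrite (cpderiv_mul oO e0 (csmooth_cst oO _) (sn N) Ot) cpderiv_cst mulr0 addr0.
rewrite -addrA; congr (_ + _); rewrite [X in X + _]mulrC -mulrDl.
by rewrite -[in RHS]natr1 [in RHS]mulrDl mul1r addrC.
Qed.

(** At 0, where the factor t vanishes, [leibniz_aff] trades each such factor for one derivative and
    multiplies by the number of derivatives. *)
Lemma power_jet (O : set T) G N : open O -> csmooth O G -> O 0 ->
  cpderivs (nseq N.+1 e0) (fun t => (aff 0 1 t)%:C ^+ N * G t) 0
  = N.+1`!%:R * cpderiv e0 G 0.
Proof.
move=> oO sG O0; elim: N => [|N IH].
  have -> : (fun t => (aff 0 1 t)%:C ^+ 0 * G t) = G.
    by apply/funext => t; rewrite expr0 mul1r.
  by rewrite mul1r.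
have -> : (fun t => (aff 0 1 t)%:C ^+ N.+1 * G t) =
    (fun t => (aff 0 1 t)%:C * ((aff 0 1 t)%:C ^+ N * G t)).
  by apply/funext => t; rewrite exprS mulrA.
have sN : csmooth O (fun t => (aff 0 1 t)%:C ^+ N * G t).
  apply: (csmooth_mul oO _ sG); elim: (N) => [|k IHk].
    by under eq_fun do rewrite expr0; exact: csmooth_cst.
  under eq_fun do rewrite exprS.
  exact: (csmooth_mul oO (csmooth_real oO (smooth_aff 0 1 oO)) IHk).
rewrite (leibniz_aff 0 1 N.+1 oO sN O0) IH.
by rewrite /aff mxE mul0r addr0 mul0r add0r mulr1 mulrA -natrM -factS.
Qed.

Section Bol.
Variable b : R.
Local Notation f := (aff 1 b).
Let O : set T := [set t | 0 < f t].

Lemma open_aff_gt0 a c : open [set t : T | 0 < aff a c t].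
Proof.
have ca : continuous (aff a c).
  by move=> t; exact: smooth_continuous (smooth_aff a c oT) I.
rewrite (_ : [set t | _] = aff a c @^-1` [set y : R | 0 < y]) //.
by move/continuousP : ca; apply; exact: open_gt.
Qed.

Let oO : open O.
Proof. exact: open_aff_gt0. Qed.

Let fO t : O t -> f t != 0.
Proof. by move=> h; rewrite gt_eqF. Qed.

Let g t : R := (f t)^-1.

Let sg : smooth_on O g.
Proof. exact: (smooth_inv oO fO (smooth_aff 1 b oO)). Qed.

Let dg t : O t -> pderiv e0 g t = - b * g t ^+ 2.
Proof.
move=> Ot; have sf := smooth_aff 1 b oO.
have E : forall t, O t -> (fun t => f t * g t) t = (fun=> 1) t.
  by move=> s /fO fs; rewrite /g divff.
have := pderiv_on e0 oO E Ot; rewrite pderiv_cst (pderiv_mul e0 sf sg Ot) pderiv_aff.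
move=> /(congr1 (fun z => g t * z)); rewrite mulr0 mulrDr mulrA {1}/g mulVf ?fO// mul1r.
by move=> /eqP; rewrite addr_eq0 => /eqP ->; rewrite expr2; ring.
Qed.

Let sgk k : smooth_on O (fun t => g t ^+ k).
Proof.
elim: k => [|k IH]; first by under eq_fun do rewrite expr0; exact: smooth_cst.
by under eq_fun do rewrite exprS; exact: (smooth_mul oO sg IH).
Qed.

Let dgk k t : O t -> pderiv e0 (fun t => g t ^+ k) t = - k%:R * b * g t ^+ k.+1.
Proof.
move=> Ot; elim: k => [|k IH].
  by under eq_fun do rewrite expr0; rewrite pderiv_cst oppr0 !mul0r.
under eq_fun do rewrite exprS.
rewrite (pderiv_mul e0 sg (sgk k) Ot) IH (dg Ot) -natr1 !exprS; ring.
Qed.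

Let sigma t : T := (t ord0 ord0 * g t)%:M.

Let ssigma i j : smooth_on O (fun t => sigma t i j).
Proof.
have -> : (fun t => sigma t i j) = (fun t => t ord0 ord0 * g t).
  by apply/funext => t; rewrite mxE (ord1 i) (ord1 j) eqxx mulr1n.
exact: (smooth_mul oO (smooth_coord oO _ _) sg).
Qed.

Let dsigma t : O t -> pderiv e0 (fun t => sigma t ord0 ord0) t = g t ^+ 2.
Proof.
move=> Ot; have -> : (fun t => sigma t ord0 ord0) = (fun t => t ord0 ord0 * g t).
  by apply/funext => s; rewrite mxE eqxx mulr1n.
rewrite (pderiv_mul e0 (smooth_coord oO _ _) sg Ot) dg// pderiv_coord eqxx mulr1.
have Eg : g t = g t ^+ 2 * f t by rewrite expr2 -mulrA /g mulVf ?fO// mulr1.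
by rewrite [X in _ + X]Eg /aff; ring.
Qed.

(* Bol's lemma for t |-> t / (1 + b t): the weights 1 - N and 1 + N are
   intertwined by the N-th derivative. *)
Lemma bol w N t : csmooth setT w -> 0 < f t ->
  cpderivs (nseq N e0) (fun t => (f t)%:C ^+ N * ((g t)%:C * w (sigma t))) t
  = ((g t) ^+ N.+1)%:C * cpderivs (nseq N e0) w (sigma t).
Proof.
move=> sw.
have sws k : csmooth O (fun t => cpderivs (nseq k e0) w (sigma t)).
  exact: (csmooth_pull oO oT (csmooth_cpderivs _ sw) (fun _ _ => I) ssigma).
have sG k : csmooth O (fun t => (f t)%:C ^+ k * ((g t)%:C * w (sigma t))).
  apply: (csmooth_mul oO _ (csmooth_mul oO (csmooth_real oO sg) (sws 0%N))).
  elim: k => [|k IH]; first by under eq_fun do rewrite expr0; exact: csmooth_cst.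
  under eq_fun do rewrite exprS.
  exact: (csmooth_mul oO (csmooth_real oO (smooth_aff 1 b oO)) IH).
elim: N t => [|N IH] t Ot; first by rewrite /cpderivs /= expr0 mul1r expr1.
have -> : (fun t => (f t)%:C ^+ N.+1 * ((g t)%:C * w (sigma t))) =
   (fun t => (f t)%:C * ((f t)%:C ^+ N * ((g t)%:C * w (sigma t)))).
  by apply/funext => s; rewrite exprS -mulrA.
(* Differentiating the induction hypothesis brings the derivative - (N + 1) b g^(N + 2) of g^(N +
   1); multiplied by f it cancels the second term of Leibniz's formula, since f g = 1. *)
rewrite (leibniz_aff 1 b N oO (sG N) Ot) (IH t Ot).
rewrite [cpderivs (nseq N.+1 e0) _ t](@cpderivs_on _ _ _ _ oO _ _ [:: e0] IH t Ot).
have -> : cpderivs [:: e0] (fun t => ((g t) ^+ N.+1)%:C * cpderivs (nseq N e0) w (sigma t)) t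
  = (g t ^+ N.+1)%:C * ((g t ^+ 2)%:C * cpderivs (nseq N.+1 e0) w (sigma t))
    + cpderivs (nseq N e0) w (sigma t) * (- N.+1%:R * b * g t ^+ N.+2)%:C.
  rewrite /= (cpderiv_mul oO e0 (csmooth_real oO (sgk N.+1)) (sws N) Ot).
  rewrite cpderiv_real (dgk N.+1 Ot); congr (_ * _ + _).
  rewrite (cpderiv_pull e0 oT (csmooth_cpderivs _ sw) (fun _ _ => I) ssigma Ot).
  rewrite (bigD1 e0)// big1 ?addr0 => [|[i j] /negP[]]; last first.
    by rewrite (ord1 i) (ord1 j).
  by rewrite /= (dsigma Ot) addr0.
have fg : (f t)%:C * (g t)%:C = 1 :> R[i] by rewrite -rmorphM /= /g divff ?fO.
have -> : (- N.+1%:R * b * g t ^+ N.+2)%:C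
   = - N.+1%:R * b%:C * ((g t)%:C * (g t ^+ N.+1)%:C) :> R[i].
  by rewrite exprS !rmorphM /= rmorphN /= rmorph_nat.
have -> : (g t ^+ N.+2)%:C = (g t)%:C * (g t ^+ N.+1)%:C :> R[i] by rewrite exprS rmorphM.
have -> : (g t ^+ 2)%:C = (g t)%:C * (g t)%:C :> R[i] by rewrite expr2 rmorphM.
move: (cpderivs (nseq N.+1 e0) _ _) (cpderivs (nseq N e0) _ _) => X Y.
rewrite mulrDr !mulrA [(f t)%:C * _]mulrC.
have -> : (g t ^+ N.+1)%:C * (f t)%:C * (g t)%:C * (g t)%:C * X =
  (g t)%:C * (g t ^+ N.+1)%:C * X * ((f t)%:C * (g t)%:C) by ring.
have -> : (f t)%:C * Y * - N.+1%:R * b%:C * (g t)%:C * (g t ^+ N.+1)%:C =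
  - (N.+1%:R * b%:C * (g t ^+ N.+1)%:C * Y) * ((f t)%:C * (g t)%:C) by ring.
by rewrite fg !mulr1 addrNK.
Qed.

Lemma bol0 w N : csmooth setT w ->
  cpderivs (nseq N e0) (fun t => (f t)%:C ^+ N * (((f t)^-1)%:C * w ((t ord0 ord0 / f t)%:M))) 0
  = cpderivs (nseq N e0) w 0.
Proof.
move=> sw; have f0 : f 0 = 1 by rewrite /aff mxE mul0r addr0.
have := @bol w N 0 sw; rewrite f0 => /(_ ltr01) ->.
rewrite /g f0 invr1 expr1n mul1r /sigma mxE mul0r; congr (cpderivs _ _ _).
by apply/matrixP => i j; rewrite !mxE mul0rn.
Qed.

End Bol.

End OneVariableJets.

Section ComplexExponential.
Variable R : realType.
Implicit Types z w : R[i].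

Lemma cexp0 : cexp (0 : R[i]) = 1.
Proof. by rewrite /cexp /= expR0 cos0 sin0 mulr1 mulr0. Qed.

Lemma cexpD z w : cexp (z + w) = cexp z * cexp w.
Proof.
by apply: complexP; rewrite ?ReM ?ImM /cexp /= ReD ImD expRD ?cosD ?sinD; ring.
Qed.

Lemma cexp_neq0 z : cexp z != 0.
Proof.
apply/eqP => z0; have := cexpD z (- z); rewrite z0 mul0r subrr cexp0 => /eqP.
by rewrite oner_eq0.
Qed.

Lemma cexpN z : cexp (- z) = (cexp z)^-1.
Proof.
apply: (mulfI (cexp_neq0 z)).
by rewrite -cexpD subrr cexp0 divff ?cexp_neq0.
Qed.

Lemma cexpMn z n : cexp (n%:R * z) = cexp z ^+ n.
Proof.
elim: n => [|n IH]; first by rewrite mul0r cexp0 expr0.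
by rewrite -natr1 mulrDl mul1r cexpD IH exprSr.
Qed.

Lemma cexp_real (r : R) : cexp r%:C = (expR r)%:C.
Proof. by rewrite /cexp /= cos0 sin0 mulr1 mulr0. Qed.

Lemma cexp_ln (r : R) : 0 < r -> cexp (ln r)%:C = r%:C.
Proof. by move=> r0; rewrite cexp_real lnK. Qed.

End ComplexExponential.

(** * Jets under projective changes of coordinates *)

Section TwistedJets.
Variables (R : realType) (p : nat).
Local Notation V := 'cV[R]_p.
Local Notation e0 := (ord0 : 'I_1, ord0 : 'I_1).
Local Notation oT := (@openT 'cV[R]_p).
Implicit Types (u : V -> R[i]) (b : 'rV[R]_p) (x v : V).

Definition pairing b x : R := (b *m x) ord0 ord0.

Lemma pairingZ b (t : R) x : pairing b (t *: x) = t * pairing b x.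
Proof. by rewrite /pairing -scalemxAr mxE. Qed.

Lemma pairing0 b : pairing b 0 = 0.
Proof. by rewrite /pairing mulmx0 mxE. Qed.

Lemma smooth_mulmx m (A : 'M[R]_(m, p)) (O : set V) i j : open O ->
  smooth_on O (fun x => (A *m x) i j).
Proof.
move=> oO; under eq_fun do rewrite mxE; apply: (smooth_bigsum oO) => k.
exact: (smooth_mul oO (smooth_cst oO _) (smooth_coord oO _ _)).
Qed.

Lemma smooth_pairing b (O : set V) : open O -> smooth_on O (fun x => 1 + pairing b x).
Proof.
by move=> oO; exact: (smooth_add oO (smooth_cst oO 1) (smooth_mulmx b ord0 ord0 oO)).
Qed.

Definition halfspace b : set V := [set x | 0 < 1 + pairing b x].

Lemma open_halfspace b : open (halfspace b).
Proof.
have c : continuous (fun x => 1 + pairing b x).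
  by move=> x; exact: smooth_continuous (smooth_pairing b oT) I.
rewrite (_ : halfspace b = (fun x => 1 + pairing b x) @^-1` [set y : R | 0 < y])//.
by move/continuousP : c; apply; exact: open_gt.
Qed.

Lemma halfspace0 b : halfspace b 0.
Proof. by rewrite /halfspace /= pairing0 addr0. Qed.

Lemma near_halfspace b : \forall x \near (0 : V), halfspace b x.
Proof. exact: (open_nbhs_nbhs (conj (@open_halfspace b) (halfspace0 b))). Qed.

Lemma csmooth_twist b (mu : R[i]) :
  csmooth (halfspace b) (fun x => cexp (mu * (ln (1 + pairing b x))%:C)).
Proof.
have oO := @open_halfspace b.
exact: (csmooth_cexp oO mu (smooth_ln oO (fun _ h => h) (smooth_pairing b oO))).
Qed.

Lemma jet_near l u u' : (\forall x \near (0 : V), u x = u' x) -> jet l u = jet l u'.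
Proof.
move=> uu'; apply: eq_bigr => k _; congr (_ *: _).
exact: cpderivs_near_eq uu'.
Qed.

Lemma near_line v (P : V -> Prop) : (\forall x \near (0 : V), P x) ->
  \forall t \near (0 : 'M[R]_1), P ((t : 'M[R]_1) ord0 ord0 *: v).
Proof.
move=> nP.
have c : {for (0 : 'M[R]_1), continuous (fun t : 'M[R]_1 => t ord0 ord0 *: v)}.
  apply: mx_continuous => i j.
  exact: smooth_continuous (smooth_line v i j openT) I.
have E : (0 : 'M[R]_1) ord0 ord0 *: v = 0 by rewrite mxE scale0r.
by move: nP; rewrite -{1}E; exact: c.
Qed.

(** The map x |-> A x / (1 + b x) sends t v to the multiple t / (1 + t b v) of A v. For mu = 1 - l
    the multiplier along this line is (1 + t b v)^(l - 1), as in [bol0]; for l = 0 only the value at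
    0 matters. *)
Lemma jet_twist l u u' (kappa mu : R[i]) b (A : 'M[R]_p) v :
  csmooth setT u -> (l = 0%N \/ mu = 1 - l%:R) ->
  (\forall x \near (0 : V), u' x =
     kappa * cexp (- mu * (ln (1 + pairing b x))%:C)
       * u ((1 + pairing b x)^-1 *: (A *m x))) ->
  polyfun (jet l u') v = kappa * polyfun (jet l u) (A *m v).
Proof.
move=> su hl nu.
have oO := @open_halfspace b.
pose uh x := kappa * cexp (- mu * (ln (1 + pairing b x))%:C)
       * u ((1 + pairing b x)^-1 *: (A *m x)).
rewrite (jet_near l (u' := uh) nu).
have suh : csmooth (halfspace b) uh.
  apply: (csmooth_mul oO).
    exact: (csmooth_mul oO (csmooth_cst oO _) (csmooth_twist b _)).
  apply: (csmooth_pull oO oT su (fun _ _ => I)) => i j.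
  under eq_fun do rewrite mxE.
  apply: (smooth_mul oO _ (smooth_mulmx A i j oO)).
  apply: (smooth_inv oO _ (smooth_pairing b oO)) => x.
  by rewrite /halfspace /= => h; rewrite gt_eqF.
have lf : l`!%:R != 0 :> R[i] by rewrite pnatr_eq0 -lt0n fact_gt0.
apply: (mulfI lf).
rewrite -(line_jet oO suh v l (@halfspace0 b)) mulrCA -(line_jet oT su (A *m v) l I).
pose be := pairing b v.
case: hl => [->|hmu].
  by rewrite /cpderivs /= /uh mxE scale0r pairing0 addr0 ln1 mulr0 cexp0 mulr1
     mulmx0 scaler0 scale0r.
have oT1 := @openT 'M[R]_1.
pose w (t : 'M[R]_1) := u (t ord0 ord0 *: (A *m v)).
have sw : csmooth setT w.
  exact: (csmooth_pull oT1 oT su (fun _ _ => I) (fun i j => smooth_line (A *m v) i j oT1)).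
have skw : csmooth setT (fun t => kappa * w t + 0).
  exact: (csmooth_lin oT1 kappa sw (csmooth_cst oT1 0)).
have := cpderivs_lin oT1 kappa (nseq l e0) sw (csmooth_cst oT1 0) (I : setT (0 : 'M[R]_1)).
have -> : cpderivs (nseq l e0) (fun=> 0) (0 : 'M[R]_1) = 0 :> R[i].
  have : (fun=> 0 : R[i]) = cpderivs (nseq l e0) (fun _ : 'M[R]_1 => 0 : R[i]).
    elim: l {lf hmu} => //= k <-; apply/funext => t; by rewrite cpderiv_cst.
  by move/(congr1 (fun f => f 0)).
rewrite addr0 => <-; rewrite -(@bol0 R be _ l skw).
apply: cpderivs_near_eq.
have := near_line v (near_halfspace b).
apply: filterS => t; rewrite /halfspace /uh /= pairingZ -/be => h.
rewrite addr0 /w !mxE eqxx mulr1n.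
rewrite -[1 + _]/(aff 1 be t) in h *.
rewrite -scalemxAr scalerA [(_)^-1 * _]mulrC.
rewrite !mulrA; congr (_ * _); rewrite [RHS]mulrC; congr (_ * _).
have -> : - mu = l%:R - 1 by rewrite hmu opprB.
by rewrite mulrBl mul1r cexpD cexpN cexpMn cexp_ln// fmorphV.
Qed.

Lemma cpderiv_twist (mu : R[i]) (be : R) :
  cpderiv e0 (fun t : 'M[R]_1 => cexp (mu * (ln (aff 1 be t))%:C)) 0 = mu * be%:C.
Proof.
case: mu => a c.
have a0 : aff 1 be (0 : 'M[R]_1) = 1 by rewrite /aff mxE mul0r addr0.
have oO : open [set t : 'M[R]_1 | 0 < aff 1 be t] by exact: open_aff_gt0.
have O0 : [set t : 'M[R]_1 | 0 < aff 1 be t] 0 by rewrite /= a0.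
have dl : is_derive (0 : 'M[R]_1) (delta_mx ord0 ord0) (fun t => ln (aff 1 be t)) be.
  have da := smooth_is_derive e0 (smooth_aff 1 be oO) O0.
  have dln : is_derive (aff 1 be (0 : 'M[R]_1)) (1 : R) (@ln R) 1.
    by apply: is_derive_eq (is_derive1_ln _) _; rewrite ?a0 ?invr1.
  by have := is_derive_comp1 da dln; rewrite pderiv_aff mul1r.
have l0 : ln (aff 1 be (0 : 'M[R]_1)) = 0 by rewrite a0 ln1.
have dr : is_derive (ln (aff 1 be (0 : 'M[R]_1))) (1 : R) (fun y => expR (a * y) * cos (c * y)) a.
  rewrite l0; apply: is_derive_eq.
  by rewrite !mulr0 expR0 cos0 sin0 /GRing.scale /=; ring.
have di : is_derive (ln (aff 1 be (0 : 'M[R]_1))) (1 : R) (fun y => expR (a * y) * sin (c * y)) c.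
  rewrite l0; apply: is_derive_eq.
  by rewrite !mulr0 expR0 cos0 sin0 /GRing.scale /=; ring.
have [_ Er] := is_derive_comp1 dl dr; have [_ Ei] := is_derive_comp1 dl di.
have E t : (a +i* c) * (ln (aff 1 be t))%:C =
    (a * ln (aff 1 be t)) +i* (c * ln (aff 1 be t)).
  by apply: complexP; rewrite ?ReM ?ImM /= ?mulr0 ?subr0 ?add0r.
have -> : (a +i* c) * be%:C = (a * be) +i* (c * be).
  by apply: complexP; rewrite ?ReM ?ImM /= ?mulr0 ?subr0 ?add0r.
have -> : (fun t : 'M[R]_1 => cexp ((a +i* c) * (ln (aff 1 be t))%:C)) =
    (fun t => (expR (a * ln (aff 1 be t)) * cos (c * ln (aff 1 be t)))
           +i* (expR (a * ln (aff 1 be t)) * sin (c * ln (aff 1 be t)))).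
  by apply/funext => t; rewrite E.
by rewrite /cpderiv /=; apply: complexP; [exact: Er|exact: Ei].
Qed.

(** Along [v] the function is t^l times a smooth factor, whose first derivative at 0 is extracted by
    [power_jet]. The factor [mu] of the result is what forces the condition on lam_1. *)
Lemma jet_power l u' (kappa mu : R[i]) b v :
  (\forall x \near (0 : V), u' x =
     kappa * cexp (- mu * (ln (1 + pairing b x))%:C) * (pairing b x)%:C ^+ l) ->
  polyfun (jet l.+1 u') v = - mu * kappa * (pairing b v)%:C ^+ l.+1.
Proof.
move=> nu.
have oO := @open_halfspace b.
pose uh x := kappa * cexp (- mu * (ln (1 + pairing b x))%:C) * (pairing b x)%:C ^+ l.
rewrite (jet_near l.+1 (u' := uh) nu).
have suh : csmooth (halfspace b) uh.
  apply: (csmooth_mul oO).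
    exact: (csmooth_mul oO (csmooth_cst oO _) (csmooth_twist b _)).
  elim: (l) => [|k IH]; first by under eq_fun do rewrite expr0; exact: csmooth_cst.
  under eq_fun do rewrite exprS.
  exact: (csmooth_mul oO (csmooth_real oO (smooth_mulmx b ord0 ord0 oO)) IH).
have lf : l.+1`!%:R != 0 :> R[i] by rewrite pnatr_eq0 -lt0n fact_gt0.
apply: (mulfI lf); rewrite -(line_jet oO suh v l.+1 (@halfspace0 b)).
pose be := pairing b v.
have oO1 : open [set t : 'M[R]_1 | 0 < aff 1 be t] by exact: open_aff_gt0.
have O0 : [set t : 'M[R]_1 | 0 < aff 1 be t] 0 by rewrite /= /aff mxE mul0r addr0.
pose H (t : 'M[R]_1) := cexp (- mu * (ln (aff 1 be t))%:C).
have sH : csmooth [set t : 'M[R]_1 | 0 < aff 1 be t] H.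
  exact: (csmooth_cexp oO1 _ (smooth_ln oO1 (fun _ h => h) (smooth_aff 1 be oO1))).
pose G t := (kappa * be%:C ^+ l) * H t.
have sG : csmooth [set t : 'M[R]_1 | 0 < aff 1 be t] G.
  exact: (csmooth_mul oO1 (csmooth_cst oO1 _) sH).
have -> : (fun t : 'M[R]_1 => uh (t ord0 ord0 *: v)) =
    (fun t => (aff 0 1 t)%:C ^+ l * G t).
  apply/funext => t; rewrite /uh /G /H pairingZ -/be /aff add0r mulr1.
  rewrite rmorphM exprMn; ring.
rewrite (power_jet l oO1 sG O0); congr (_ * _).
rewrite (cpderiv_mul oO1 e0 (csmooth_cst oO1 _) sH O0) cpderiv_cst mulr0 addr0.
rewrite cpderiv_twist exprS -/be; ring.
Qed.

End TwistedJets.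

(** * Sections on the big cell *)

Section SignCharacters.
Variable R : realType.
Implicit Types (d : bool) (a : R).

Lemma sgnpowM d a b : sgnpow d (a * b) = sgnpow d a * sgnpow d b.
Proof. by case: d; rewrite /sgnpow ?sgrM ?mulr1. Qed.

Lemma sgnpow_gt0 d a : 0 < a -> sgnpow d a = 1.
Proof. by case: d => // a0; rewrite /sgnpow gtr0_sg. Qed.

Lemma sgnpow_sqr d a : a != 0 -> sgnpow d a * sgnpow d a = 1.
Proof.
move=> a0; rewrite -sgnpowM sgnpow_gt0// -expr2.
by rewrite exprn_even_gt0//= a0.
Qed.

Lemma sgnpow_neq0 d a : a != 0 -> sgnpow d a != 0.
Proof.
move=> a0; apply/eqP => h; have := sgnpow_sqr d a0.
by rewrite h mul0r => /eqP; rewrite eq_sym oner_eq0.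
Qed.

Lemma sgnpow_addb d1 d2 a : a != 0 -> sgnpow (d1 (+) d2) a = sgnpow d1 a * sgnpow d2 a.
Proof.
move=> a0; case: d1; case: d2; rewrite /= ?mul1r ?mulr1//.
by rewrite (sgnpow_sqr true a0).
Qed.

Variables (m n : nat) (U : set 'M[R]_(m, n)).
Hypothesis oU : open U.
Implicit Types f : 'M[R]_(m, n) -> R.

Lemma smooth_ln_norm f : (forall x, U x -> f x != 0) -> smooth_on U f ->
  smooth_on U (fun x => ln `|f x|).
Proof.
move=> f0 sf.
(* ln |f| is rewritten as half of ln (f^2), which involves no absolute value. *)
have s2 : smooth_on U (fun x => f x * f x) by exact: (smooth_mul oU sf sf).
have p2 x : U x -> 0 < f x * f x.
  by move=> /f0 h; rewrite -expr2 exprn_even_gt0//= h.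
have s3 := smooth_mul oU (smooth_cst oU (2^-1)) (smooth_ln oU p2 s2).
apply: (smooth_ext oU _ s3) => x Ux.
have fx : 0 < `|f x| by rewrite normr_gt0 f0.
have -> : f x * f x = `|f x| * `|f x| by rewrite -normrM ger0_norm// -expr2 sqr_ge0.
by rewrite lnM ?posrE//; field.
Qed.

Lemma smooth_sgnpow d f : (forall x, U x -> f x != 0) -> smooth_on U f ->
  smooth_on U (fun x => sgnpow d (f x)).
Proof.
move=> f0 sf; case: d; last exact: (smooth_cst oU 1).
(* The sign of f is f exp(- ln |f|). *)
have s1 := smooth_exp oU (smooth_opp oU (smooth_ln_norm f0 sf)).
apply: (smooth_ext oU _ (smooth_mul oU sf s1)) => x Ux.
have fx : 0 < `|f x| by rewrite normr_gt0 f0.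
rewrite expRN lnK ?posrE// /sgnpow {1}[f x]numEsg mulfK//.
by rewrite gt_eqF.
Qed.

End SignCharacters.

(** * Coordinates on the open set N_- P *)

Section BigCell.
Variables (R : realType) (q : nat).
Hypothesis q0 : (0 < q)%N.
Local Notation G := 'M[R]_q.+1.
Implicit Types (g : G) (x : 'cV[R]_q) (y : 'rV[R]_q).

Definition corner g : R := g ord0 ord0.
Definition col0 g : 'cV[R]_q := dlsubmx (g : 'M[R]_(1 + q, 1 + q)).
(** The coset of [g] is the line spanned by its first column; this is the affine chart of the
    projective space where the first entry is non-zero. *)
Definition xcoord g : 'cV[R]_q := (corner g)^-1 *: col0 g.

Lemma lshift1_ord0 : lshift q (ord0 : 'I_1) = (ord0 : 'I_(1 + q)).
Proof. exact: val_inj. Qed.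

Lemma corner_block (A : 'M[R]_1) (B : 'rV[R]_q) (C : 'cV[R]_q) (D : 'M[R]_q) :
  corner (block_mx A B C D) = A ord0 ord0.
Proof.
have := block_mxEul A B C D ord0 ord0.
by rewrite !lshift1_ord0.
Qed.

Lemma col0_block (A : 'M[R]_1) (B : 'rV[R]_q) (C : 'cV[R]_q) (D : 'M[R]_q) :
  col0 (block_mx A B C D) = C.
Proof. by rewrite /col0 block_mxKdl. Qed.

Lemma cell_blockE g : g = block_mx ((corner g)%:M : 'M[R]_1)
  (ursubmx (g : 'M[R]_(1 + q, 1 + q))) (col0 g) (drsubmx (g : 'M[R]_(1 + q, 1 + q))).
Proof.
have <- : ulsubmx (g : 'M[R]_(1 + q, 1 + q)) = (corner g)%:M.
  apply/matrixP => i j; rewrite (ord1 i) (ord1 j) !mxE eqxx mulr1n /corner.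
  by rewrite !lshift1_ord0.
by rewrite /col0 (@submxK R 1 q 1 q g).
Qed.

Lemma col0E g j : col0 g j ord0 = g (lift ord0 j) ord0.
Proof.
rewrite !mxE lshift1_ord0; congr (g _ _); exact: val_inj.
Qed.

(** The scalar by which exp(t1 H0) exp(t2 J0) acts on the lower right block. *)
Definition cfac (t1 t2 : R) : R := expR ((t2 - t1) / q%:R).

Lemma parabE e (g0 : 'M[R]_q) t1 t2 y :
  elM e g0 *m expH q t1 *m expJ q t2 *m expNp y =
  block_mx ((e * expR t1)%:M : 'M[R]_1) ((e * expR t1) *: y) 0 (cfac t1 t2 *: g0).
Proof.
rewrite /elM /expH /expJ /expNp !(@mulmx_block R 1 q 1 q 1 q) ?mul0mx ?mulmx0 ?mulmx1 ?mul1mx.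
rewrite ?(add0r, addr0, mul0mx, mulmx0, mulmx1) -?scalar_mxM ?mulr1 ?mul_scalar_mx.
have -> // : g0 *m (expR (- t1 / q%:R))%:M *m (expR (t2 / q%:R))%:M = cfac t1 t2 *: g0.
rewrite -mulmxA -scalar_mxM mul_mx_scalar -expRD /cfac; congr (expR _ *: _); ring.
Qed.

Lemma cfac_exp t1 t2 : cfac t1 t2 ^+ q = expR (t2 - t1).
Proof.
rewrite /cfac -expRM_natl; congr expR; rewrite mulrC divfK// pnatr_eq0.
by rewrite -lt0n.
Qed.

Lemma det_parab e (g0 : 'M[R]_q) t1 t2 y :
  \det (elM e g0 *m expH q t1 *m expJ q t2 *m expNp y) = e * \det g0 * expR t2.
Proof.
rewrite parabE (@det_ublock R 1 q) det_scalar1 detZ cfac_exp expRD expRN.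
by field; rewrite gt_eqF ?expR_gt0.
Qed.

Lemma corner_parab g e (g0 : 'M[R]_q) t1 t2 y :
  corner (g *m (elM e g0 *m expH q t1 *m expJ q t2 *m expNp y))
  = corner g * (e * expR t1).
Proof.
rewrite parabE {1}(cell_blockE g) (@mulmx_block R 1 q 1 q 1 q) corner_block mulmx0 addr0.
by rewrite -scalar_mxM mxE eqxx mulr1n.
Qed.

Lemma col0_parab g e (g0 : 'M[R]_q) t1 t2 y :
  col0 (g *m (elM e g0 *m expH q t1 *m expJ q t2 *m expNp y))
  = (e * expR t1) *: col0 g.
Proof.
rewrite parabE {1}(cell_blockE g) (@mulmx_block R 1 q 1 q 1 q) col0_block mulmx0 addr0.
by rewrite mul_mx_scalar.
Qed.

Lemma xcoord_parab g e (g0 : 'M[R]_q) t1 t2 y : e != 0 ->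
  xcoord (g *m (elM e g0 *m expH q t1 *m expJ q t2 *m expNp y)) = xcoord g.
Proof.
move=> e0; rewrite /xcoord corner_parab col0_parab scalerA; congr (_ *: _).
by rewrite invfM divfK// mulf_neq0// gt_eqF// expR_gt0.
Qed.

Lemma corner_expNm x : corner (expNm x) = 1.
Proof. by rewrite /expNm corner_block mxE eqxx. Qed.

Lemma xcoord_expNm x : xcoord (expNm x) = x.
Proof. by rewrite /xcoord corner_expNm /expNm col0_block invr1 scale1r. Qed.

Lemma det_expNm x : \det (expNm x) = 1.
Proof. by rewrite /expNm (@det_lblock R 1 q) det_scalar1 det1 mulr1. Qed.

Lemma GLE r (g : 'M[R]_r) : GL g <-> \det g != 0.
Proof. by rewrite /GL /= unitmxE unitfE. Qed.

Lemma GL_expNm x : GL (expNm x).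
Proof. by apply/GLE; rewrite det_expNm oner_eq0. Qed.

Variables (b : bool * bool) (lam : R[i] * R[i]).

(* The inverse of the character of the parabolic subgroup through which I is
   induced, extended to the big cell by left N_- -invariance. *)
Definition chrV g : R[i] :=
  (sgnpow b.1 (corner g) * sgnpow b.2 (\det g * corner g))%:C *
  (cexp (- lam.1 * (ln `|corner g|)%:C) * cexp (- lam.2 * (ln `|\det g|)%:C)).

Lemma lfun_invE (W : vectType R[i]) (f h : 'End(W)) :
  (forall w, f (h w) = w) -> (forall w, h (f w) = w) -> forall w, (f^-1)%VF w = h w.
Proof.
move=> fh hf w; have kf : lker f == 0%VS.
  by apply/lker0P => u v /(congr1 h); rewrite !hf.
by rewrite -{1}(fh w) lker0_lfunK.
Qed.

(** An inverse [g1] of [g0] under [rho] is taken as data: [g0] itself will do for the trivial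
    representation, and [invmx g0] for [varpi]. *)
Lemma inducing_invE (W : vectType R[i]) (rho : 'M[R]_q -> 'End(W)) (e : R)
    (g0 g1 : 'M[R]_q) (t1 t2 : R) (w : W) :
  e = 1 \/ e = -1 -> SLpm g0 ->
  (forall w, rho g0 (rho g1 w) = w) -> (forall w, rho g1 (rho g0 w) = w) ->
  ((inducing rho b lam e g0 t1 t2)^-1)%VF w =
  ((sgnpow b.1 e * sgnpow b.2 (\det g0))%:C *
   (cexp (- lam.1 * t1%:C) * cexp (- lam.2 * t2%:C))) *: rho g1 w.
Proof.
move=> he hg h01 h10.
have e0 : e != 0 by case: he => ->; rewrite ?oppr_eq0 oner_eq0.
have d0 : \det g0 != 0 by case: hg => ->; rewrite ?oppr_eq0 oner_eq0.
pose s := sgnpow b.1 e * sgnpow b.2 (\det g0).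
have ss : s%:C * s%:C = 1 :> R[i].
  by rewrite -rmorphM /= /s mulrACA !sgnpow_sqr ?mulr1.
pose k := s%:C * cexp (lam.1 * t1%:C + lam.2 * t2%:C).
pose k' := s%:C * (cexp (- lam.1 * t1%:C) * cexp (- lam.2 * t2%:C)).
have kk : k * k' = 1.
  rewrite /k /k' mulrACA ss mul1r -!cexpD !mulNr -opprD subrr cexp0 //.
have := @lfun_invE W (inducing rho b lam e g0 t1 t2) (k' *: rho g1) _ _ w.
rewrite /inducing -/s -/k scale_lfunE; apply => v; rewrite !scale_lfunE !linearZ /= scalerA.
  by rewrite mulrC kk scale1r h01.
by rewrite kk scale1r h10.
Qed.

(** The corner is multiplied by e exp(t1) and the determinant by e det(g0) exp(t2). Their absolute
    values carry t1 and t2, and the sign of det(g0) is that of the product of the two factors, where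
    [e] occurs squared. *)
Lemma chrV_parab g e (g0 : 'M[R]_q) t1 t2 y : GL g -> corner g != 0 ->
  e = 1 \/ e = -1 -> SLpm g0 ->
  chrV (g *m (elM e g0 *m expH q t1 *m expJ q t2 *m expNp y)) =
  (sgnpow b.1 e * sgnpow b.2 (\det g0))%:C *
   (cexp (- lam.1 * t1%:C) * cexp (- lam.2 * t2%:C)) * chrV g.
Proof.
move=> /GLE dg a0 he hg; rewrite /chrV corner_parab det_mulmx det_parab.
have ne : `|e| = 1 by case: he => ->; rewrite ?normrN normr1.
have nd : `|\det g0| = 1 by case: hg => ->; rewrite ?normrN normr1.
have e0 : e != 0 by rewrite -normr_eq0 ne oner_eq0.
have na : 0 < `|corner g| by rewrite normr_gt0.
have nDg : 0 < `|\det g| by rewrite normr_gt0.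
have E1 : ln `|corner g * (e * expR t1)| = ln `|corner g| + t1.
  rewrite !normrM ne mul1r (ger0_norm (expR_ge0 _)) lnM ?posrE ?expR_gt0//.
  by rewrite expRK.
have E2 : ln `|\det g * (e * \det g0 * expR t2)| = ln `|\det g| + t2.
  rewrite !normrM ne nd !mul1r (ger0_norm (expR_ge0 _)) lnM ?posrE ?expR_gt0//.
  by rewrite expRK.
have E3 : sgnpow b.1 (corner g * (e * expR t1)) = sgnpow b.1 (corner g) * sgnpow b.1 e.
  by rewrite !sgnpowM (sgnpow_gt0 _ (expR_gt0 _)) mulr1.
have E4 : sgnpow b.2 (\det g * (e * \det g0 * expR t2) * (corner g * (e * expR t1)))
   = sgnpow b.2 (\det g * corner g) * sgnpow b.2 (\det g0).
  have -> : \det g * (e * \det g0 * expR t2) * (corner g * (e * expR t1))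
    = (\det g * corner g) * \det g0 * (e * e) * (expR t2 * expR t1) by ring.
  rewrite (sgnpowM _ _ (expR t2 * _)) (sgnpowM _ _ (e * e)) (sgnpowM _ _ (\det g0)).
  rewrite (sgnpowM _ e e) sgnpow_sqr//.
  by rewrite (sgnpow_gt0 _ (mulr_gt0 (expR_gt0 _) (expR_gt0 _))) !mulr1.
rewrite E1 E2 E3 E4 !rmorphD /= !mulrDr !cexpD !rmorphM /=; ring.
Qed.

Lemma triv_repE (g0 : 'M[R]_q) w : triv_rep g0 w = w.
Proof. by rewrite /triv_rep id_lfunE. Qed.

Lemma cell_decomposition g : GL g -> corner g != 0 ->
  exists (e : R) (g0 : 'M[R]_q) (t1 t2 : R) (y : 'rV[R]_q), [/\ e = 1 \/ e = -1, SLpm g0 &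
    g = expNm (xcoord g) *m (elM e g0 *m expH q t1 *m expJ q t2 *m expNp y)].
Proof.
move=> /GLE dg a0.
pose B := ursubmx (g : 'M[R]_(1 + q, 1 + q)).
pose D := drsubmx (g : 'M[R]_(1 + q, 1 + q)).
pose h := D - xcoord g *m B.
have gE : g = expNm (xcoord g) *m (block_mx ((corner g)%:M : 'M[R]_1) B 0 h).
  rewrite /expNm (@mulmx_block R 1 q 1 q 1 q) !mul1mx !mul0mx !addr0 mul_mx_scalar.
  rewrite /xcoord scalerA divff// scale1r -/(xcoord g) /h.
  by rewrite -/(xcoord g) addrC subrK {1}(cell_blockE g).
have dh : \det g = corner g * \det h.
  by rewrite {1}gE det_mulmx det_expNm mul1r (@det_ublock R 1 q) det_scalar1.
have dh0 : \det h != 0 by apply: contra_neq dg => h0; rewrite dh h0 mulr0.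
have na : 0 < `|corner g| by rewrite normr_gt0.
have ndh : 0 < `|\det h| by rewrite normr_gt0.
(* The corner forces [t1]; then [t2] is chosen so that the q-th power of [cfac], which is exp(t2 -
   t1), equals |det h|, and h divided by [cfac] has determinant 1 or -1. *)
pose t1 := ln `|corner g|; pose t2 := ln `|\det h| + t1.
have cE : cfac t1 t2 ^+ q = `|\det h| by rewrite cfac_exp /t2 addrK lnK.
have c0 : cfac t1 t2 != 0 by rewrite /cfac gt_eqF// expR_gt0.
exists (Num.sg (corner g)), ((cfac t1 t2)^-1 *: h), t1, t2, ((corner g)^-1 *: B).
split.
- by case: sgrP a0 => // _ _; [left|right].
- rewrite /SLpm /= detZ exprVn cE.
  case: (ltrP 0 (\det h)) => hh; first by left; rewrite gtr0_norm// mulVf.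
  by right; rewrite ler0_norm// invrN mulNr mulVf.
have Et : expR t1 = `|corner g| by rewrite lnK.
by rewrite parabE Et -numEsg !scalerA !divff// !scale1r.
Qed.

Lemma Ind_cell f g : Ind (@triv_rep R q) b lam f -> GL g -> corner g != 0 ->
  f g = chrV g * f (expNm (xcoord g)).
Proof.
move=> [_ _ hf] Gg a0.
have [e [g0 [t1 [t2 [y [he hg E]]]]]] := cell_decomposition Gg a0.
have G1 := GL_expNm (xcoord g).
have c1 : corner (expNm (xcoord g)) != 0 by rewrite corner_expNm oner_eq0.
rewrite {1}E hf// (@inducing_invE _ _ e g0 g0)// => [|w|w]; rewrite ?triv_repE//.
rewrite [in RHS]E chrV_parab// -E.
have -> : chrV (expNm (xcoord g)) = 1.
  rewrite /chrV corner_expNm det_expNm mulr1 normr1 ln1 !mulr0 cexp0 !mulr1.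
  by rewrite !sgnpow_gt0// ?mulr1.
by rewrite mulr1.
Qed.

End BigCell.

(** * Extension of germs by a cutoff *)

Section OpenCell.
Variables (R : realType) (q : nat).
Hypothesis q0 : (0 < q)%N.
Local Notation G := 'M[R]_q.+1.
Local Notation oG := (@openT G).
Local Notation oV := (@openT 'cV[R]_q).
Implicit Types (g : G) (x : 'cV[R]_q).

Lemma smooth_det r (U : set 'M[R]_r) : open U -> smooth_on U (fun y => \det y).
Proof.
move=> oU; rewrite /determinant; apply: (smooth_bigsum oU) => s.
apply: (smooth_mul oU (smooth_cst oU _)).
by apply: (smooth_bigprod oU) => i; exact: (smooth_coord oU).
Qed.

Lemma open_neq0 m n (U : set 'M[R]_(m, n)) (f : 'M[R]_(m, n) -> R) : open U ->
  smooth_on U f -> open [set x | U x /\ f x != 0].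
Proof.
move=> oU sf; rewrite openE => x [Ux fx].
have nU : \forall y \near x, U y by exact: open_nbhs_nbhs.
have nf : \forall y \near x, f y != 0.
  have cf := smooth_continuous sf Ux.
  have : nbhs (f x) [set y : R | y != 0].
    by apply: open_nbhs_nbhs; split => //; exact: open_neq.
  exact: cf.
by apply: filterS2 nU nf => y; split.
Qed.

Lemma open_GL r : open (@GL R r).
Proof.
have := open_neq0 (@openT 'M[R]_r) (smooth_det openT).
by congr open; apply/seteqP; split=> y /=; rewrite GLE; [case|split].
Qed.

Definition cell : set G := [set g | GL g /\ corner g != 0].

Lemma smooth_corner (U : set G) : open U -> smooth_on U (@corner R q).
Proof. by move=> oU; exact: smooth_coord. Qed.

Lemma open_cell : open cell.
Proof. by apply: open_neq0; [exact: open_GL|exact: smooth_corner (@open_GL _)]. Qed.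

Lemma smooth_col0 (U : set G) i j : open U -> smooth_on U (fun g => col0 g i j).
Proof.
move=> oU; rewrite (ord1 j); under eq_fun do rewrite col0E.
exact: smooth_coord.
Qed.

Lemma smooth_xcoord i j : smooth_on cell (fun g => xcoord g i j).
Proof.
have oC := open_cell; under eq_fun do rewrite mxE.
apply: (smooth_mul oC _ (smooth_col0 i j oC)).
by apply: (smooth_inv oC _ (smooth_corner oC)) => g [].
Qed.

(** A polynomial, hence smooth, substitute for the matrix norm, which is a maximum of absolute
    values. *)
Definition nsq x : R := \sum_j x j ord0 * x j ord0.

Lemma smooth_nsq (U : set 'cV[R]_q) : open U -> smooth_on U nsq.
Proof.
move=> oU; apply: (smooth_bigsum oU) => j.
exact: (smooth_mul oU (smooth_coord oU _ _) (smooth_coord oU _ _)).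
Qed.

Lemma nsqZ a x : nsq (a *: x) = a ^+ 2 * nsq x.
Proof. by rewrite /nsq mulr_sumr; apply: eq_bigr => j _; rewrite mxE; ring. Qed.

Lemma nsq_ent x j : x j ord0 ^+ 2 <= nsq x.
Proof.
rewrite /nsq (bigD1 j)//= -expr2 lerDl; apply: sumr_ge0 => i _.
by rewrite -expr2 sqr_ge0.
Qed.

Lemma nsq_gt0 x : x != 0 -> 0 < nsq x.
Proof.
apply: contra_neqT; rewrite -leNgt => x0; apply/matrixP => i j; rewrite mxE (ord1 j).
have /le_trans /(_ x0) := nsq_ent x i.
by rewrite le_eqVlt ltNge sqr_ge0 orbF sqrf_eq0 => /eqP.
Qed.

Lemma nsq_near0 : \forall x \near (0 : 'cV[R]_q), nsq x <= 4^-1.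
Proof.
have c := smooth_continuous (smooth_nsq oV) (I : setT (0 : 'cV[R]_q)).
have E : nsq 0 = 0 by rewrite -(scale0r (0 : 'cV[R]_q)) nsqZ expr0n mul0r.
have : nbhs (nsq 0) [set y : R | y < 4^-1].
  by apply: open_nbhs_nbhs; split; [exact: open_lt|rewrite /= E].
move=> /c h'; have h : \forall x \near (0 : 'cV[R]_q), nsq x < 4^-1 by exact: h'.
by apply: filterS h => x /ltW.
Qed.

Lemma csmooth_cover (m n : nat) (U U1 U2 : set 'M[R]_(m, n)) F :
  (forall z, U z -> U1 z \/ U2 z) -> csmooth U1 F -> csmooth U2 F -> csmooth U F.
Proof.
move=> hU [r1 i1] [r2 i2]; split=> s x Ux; have [U1x|U2x] := hU x Ux.
- exact: r1.
- exact: r2.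
- exact: i1.
- exact: i2.
Qed.

Variables (b : bool * bool) (lam : R[i] * R[i]).
Local Notation chi := (chrV b lam).

Lemma csmooth_chrV : csmooth cell chi.
Proof.
have oC := open_cell; have sa := smooth_corner oC.
have a0 g : cell g -> corner g != 0 by case.
have sd := smooth_det oC.
have d0 g : cell g -> \det g != 0 by case=> /GLE.
have da0 g : cell g -> \det g * corner g != 0.
  by move=> Cg; rewrite mulf_neq0 ?d0 ?a0.
apply: (csmooth_mul oC).
  apply: (csmooth_real oC); apply: (smooth_mul oC).
    exact: (smooth_sgnpow oC b.1 a0 sa).
  exact: (smooth_sgnpow oC b.2 da0 (smooth_mul oC sd sa)).
apply: (csmooth_mul oC).
  exact: (csmooth_cexp oC _ (smooth_ln_norm oC a0 sa)).
exact: (csmooth_cexp oC _ (smooth_ln_norm oC d0 sd)).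
Qed.

Definition coef g : R[i] := chi g * (cutoff (nsq (xcoord g)))%:C.

Lemma csmooth_coef : csmooth cell coef.
Proof.
have oC := open_cell.
apply: (csmooth_mul oC csmooth_chrV); apply: (csmooth_real oC).
apply: (smooth_cutoff oC).
exact: (smooth_pull oC oV (smooth_nsq oV) (fun _ _ => I) smooth_xcoord).
Qed.

(* Extends the germ of psi at the origin of the big cell to a section in I. *)
Definition cut (psi : 'cV[R]_q -> R[i]) : G -> R[i]^o := fun g =>
  if (g \in unitmx) && (corner g != 0) then coef g * psi (xcoord g) else 0.

Lemma cut_cell psi g : cell g -> cut psi g = coef g * psi (xcoord g).
Proof. by move=> [Gg a0]; rewrite /cut a0 andbT; rewrite /GL /= in Gg; rewrite Gg. Qed.

(** The region where the squared norm of x exceeds 1, written without division so that it extends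
    over corner 0. As [cut] vanishes on this open set, it is smooth across the boundary of the
    cell. *)
Definition far : set G := [set g | GL g /\ corner g ^+ 2 < nsq (col0 g)].

Lemma open_far : open far.
Proof.
have s : smooth_on (@GL R q.+1) (fun g => nsq (col0 g) - corner g ^+ 2).
  have oU := @open_GL q.+1.
  apply: (smooth_sub_fun oU).
    exact: (smooth_pull oU oV (smooth_nsq oV) (fun _ _ => I) (fun i j => smooth_col0 i j oU)).
  by apply: (smooth_mul oU); exact: smooth_corner.
rewrite openE => g [Gg hg].
have nU : \forall y \near g, GL y by apply: open_nbhs_nbhs; split => //; exact: open_GL.
have nf : \forall y \near g, 0 < nsq (col0 y) - corner y ^+ 2.
  have cf := smooth_continuous s Gg.
  have : nbhs (nsq (col0 g) - corner g ^+ 2) [set y : R | 0 < y].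
    by apply: open_nbhs_nbhs; split; [exact: open_gt|rewrite /= subr_gt0].
  exact: cf.
by apply: filterS2 nU nf => y Gy; rewrite subr_gt0; split.
Qed.

Lemma cut_far psi g : ~ (cell g /\ nsq (xcoord g) < 1) -> cut psi g = 0.
Proof.
move=> h; rewrite /cut; case: ifP => // /andP[Gg a0].
rewrite /coef cutoff_far ?mulr0 ?mul0r// leNgt; apply/negP => n1.
by apply: h; split.
Qed.

(** When the corner is 0, the rest of the first column of an invertible matrix is not. *)
Lemma GL_cell_far g : GL g -> cell g \/ far g.
Proof.
move=> Gg; have [a0|a0] := eqVneq (corner g) 0; last by left; split.
right; split=> //; rewrite a0 expr0n; apply: nsq_gt0; apply/eqP => u0.
move/GLE : Gg => /eqP; apply.
by rewrite (cell_blockE g) a0 u0 (@det_ublock R 1 q) det_scalar1 mul0r.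
Qed.

Lemma csmooth_cut psi : csmooth setT psi -> csmooth (@GL R q.+1) (cut psi).
Proof.
move=> sp; apply: (csmooth_cover GL_cell_far).
  apply: (csmooth_ext open_cell (fun g Cg => esym (cut_cell psi Cg))).
  apply: (csmooth_mul open_cell csmooth_coef).
  exact: (csmooth_pull open_cell oV sp (fun _ _ => I) smooth_xcoord).
apply: (csmooth_ext open_far _ (csmooth_cst open_far 0)) => g [Gg hg].
rewrite cut_far// => -[[_ a0]]; rewrite /xcoord nsqZ exprVn.
by rewrite mulrC ltr_pdivrMr ?mul1r ?exprn_even_gt0//= => /(lt_trans hg); rewrite ltxx.
Qed.

(** The cutoff and the germ are composed with [xcoord], which is invariant under the parabolic
    subgroup; the equivariance is that of [chrV]. *)
Lemma cut_Ind psi : csmooth setT psi -> Ind (@triv_rep R q) b lam (cut psi).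
Proof.
move=> sp; split.
- by apply/(vsmooth_scalar (@open_GL q.+1)); exact: csmooth_cut.
- by move=> g; rewrite /GL /= /cut => /negP/negbTE ->.
move=> g e g0 t1 t2 y Gg he hg.
rewrite (inducing_invE b lam t1 t2 (cut psi g) (rho := @triv_rep R q) (g1 := g0) he hg) => [|w|w];
  rewrite ?triv_repE//.
set P := elM e g0 *m _ *m _ *m _.
have ne : `|e| = 1 by case: he => ->; rewrite ?normrN normr1.
have e0 : e != 0 by rewrite -normr_eq0 ne oner_eq0.
have d0 : \det g0 != 0 by case: hg => ->; rewrite ?oppr_eq0 oner_eq0.
have GP : GL (g *m P).
  apply/GLE; rewrite det_mulmx det_parab// !mulf_neq0//; first by apply/GLE.
  by rewrite gt_eqF// expR_gt0.
have ce : corner (g *m P) = corner g * (e * expR t1) by exact: corner_parab.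
have cE : (corner (g *m P) != 0) = (corner g != 0).
  by rewrite ce !mulf_eq0 (negbTE e0) (gt_eqF (expR_gt0 _)) /= orbF.
have [a0|a0] := eqVneq (corner g) 0.
  by rewrite /cut cE a0 eqxx !andbF scaler0.
have C1 : cell g by split.
have C2 : cell (g *m P) by split=> //; rewrite cE.
rewrite (cut_cell psi C1) (cut_cell psi C2) /coef.
rewrite xcoord_parab// chrV_parab// -[_ *: _]/(_ * _).
by rewrite !mulrA.
Qed.

Lemma cut_expNm psi x : cut psi (expNm x) = (cutoff (nsq x))%:C * psi x.
Proof.
rewrite cut_cell; last by split; [exact: GL_expNm|rewrite corner_expNm oner_eq0].
rewrite /coef xcoord_expNm /chrV corner_expNm det_expNm mulr1 normr1 ln1 !mulr0 cexp0 !mulr1.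
by rewrite !sgnpow_gt0// !mul1r.
Qed.

Lemma cut_near psi : \forall x \near (0 : 'cV[R]_q), cut psi (expNm x) = psi x.
Proof.
by apply: filterS nsq_near0 => x hx; rewrite cut_expNm cutoff_near// mul1r.
Qed.

End OpenCell.

Section IndSpace.
Variables (R : realType) (q : nat) (W : vectType R[i]) (rho : 'M[R]_q -> 'End(W)).
Variables (b : bool * bool) (lam : R[i] * R[i]).
Local Notation I := (Ind rho b lam).
Implicit Types (f h : 'M[R]_q.+1 -> W).

Lemma vsmooth_lin m n (U : set 'M[R]_(m, n)) (a : R[i]) (f h : 'M[R]_(m, n) -> W) :
  open U -> vsmooth_on U f -> vsmooth_on U h ->
  vsmooth_on U (fun g => a *: f g + h g).
Proof.
move=> oU sf sh [j c].
have [sr si] := csmooth_lin oU a (vsmooth_coord j sf) (vsmooth_coord j sh).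
rewrite /rcoord /=.
have E x : coord (vbasis {:W}) j (a *: f x + h x) =
    a * coord (vbasis {:W}) j (f x) + coord (vbasis {:W}) j (h x).
  by rewrite linearP.
by case: c; under eq_fun do rewrite E.
Qed.

Lemma Ind_lin (a : R[i]) f h : I f -> I h -> I (fun g => a *: f g + h g).
Proof.
move=> [sf f0 hf] [sh h0 hh]; split.
- exact: vsmooth_lin (@open_GL _ _) sf sh.
- by move=> g Gg; rewrite f0// h0// scaler0 addr0.
- by move=> g e g0 t1 t2 y Gg he hg; rewrite hf// hh// linearP.
Qed.

Lemma smooth_mulmxl m n (A : 'M[R]_m) (O : set 'M[R]_(m, n)) i j : open O ->
  smooth_on O (fun y => (A *m y) i j).
Proof.
move=> oO; under eq_fun do rewrite mxE; apply: (smooth_bigsum oO) => k.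
exact: (smooth_mul oO (smooth_cst oO _) (smooth_coord oO _ _)).
Qed.

Lemma GL_mul r (g h : 'M[R]_r) : GL g -> GL h -> GL (g *m h).
Proof. by rewrite /GL /= unitmx_mul => -> ->. Qed.

Lemma GL_inv r (g : 'M[R]_r) : GL g -> GL (invmx g).
Proof. by rewrite /GL /= unitmx_inv. Qed.

Lemma Ind_ltransl (h : 'M[R]_q.+1) f : GL h -> I f -> I (ltransl h f).
Proof.
move=> Gh [sf f0 hf]; have Gi := GL_inv Gh; split.
- move=> c; have oU := @open_GL R q.+1.
  apply: (smooth_pull oU oU (sf c)) => [g Gg|i j]; first exact: GL_mul.
  exact: smooth_mulmxl.
- move=> g Gg; apply: f0; apply: contra_not Gg => Gg.
  by have := GL_mul Gh Gg; rewrite mulmxA mulmxV ?mul1mx.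
- move=> g e g0 t1 t2 y Gg he hg; have := hf _ e g0 t1 t2 y (GL_mul Gi Gg) he hg.
  by rewrite -mulmxA.
Qed.

Lemma Ind_zero : I (fun=> 0).
Proof.
split=> [c|//|g e g0 t1 t2 y _ _ _]; last by rewrite linear0.
rewrite /rcoord linear0; case: (c.2); exact: smooth_cst (@open_GL _ _) _.
Qed.

End IndSpace.

(** * Translations by elements of G' *)

Section Embedding.
Variables (R : realType) (q : nat).
Local Notation wd := (widen_ord (leqnSn q)).
Implicit Types (g h : 'M[R]_q).

Lemma cast_wd (e : (q.+1 = q + 1)%N) i : cast_ord e (wd i) = lshift 1 i.
Proof. exact: val_inj. Qed.

Lemma cast_max (e : (q.+1 = q + 1)%N) : cast_ord e ord_max = rshift q (ord0 : 'I_1).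
Proof. by apply: val_inj; rewrite /= addn0. Qed.

Lemma embG_ww g i j : embG g (wd i) (wd j) = g i j.
Proof. by rewrite castmxE /= !cast_wd block_mxEul. Qed.

Lemma embG_wm g i : embG g (wd i) ord_max = 0.
Proof. by rewrite castmxE /= cast_wd cast_max block_mxEur mxE. Qed.

Lemma embG_mw g j : embG g ord_max (wd j) = 0.
Proof. by rewrite castmxE /= cast_wd cast_max block_mxEdl mxE. Qed.

Lemma embG_mm g : embG g ord_max ord_max = 1.
Proof. by rewrite castmxE /= !cast_max block_mxEdr mxE eqxx. Qed.

Lemma mxnP (A B : 'M[R]_q.+1) :
  (forall i j, A (wd i) (wd j) = B (wd i) (wd j)) ->
  (forall i, A (wd i) ord_max = B (wd i) ord_max) ->
  (forall j, A ord_max (wd j) = B ord_max (wd j)) ->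
  A ord_max ord_max = B ord_max ord_max -> A = B.
Proof.
move=> h1 h2 h3 h4; apply/matrixP => i j.
by have [[i' ->]|->] := ord_widenP i; have [[j' ->]|->] := ord_widenP j.
Qed.

Lemma embGM g h : embG (g *m h) = embG g *m embG h.
Proof.
apply: mxnP => [i j|i|j|]; rewrite ?embG_ww ?embG_wm ?embG_mw ?embG_mm [in RHS]mxE.
all: rewrite big_ord_recr /= ?embG_ww ?embG_wm ?embG_mw ?embG_mm ?mul0r ?mulr0 ?addr0.
- by rewrite mxE; apply: eq_bigr => k _; rewrite !embG_ww.
- by rewrite big1 ?add0r ?mulr1// => k _; rewrite embG_wm mulr0.
- by rewrite big1 ?add0r ?mulr0// => k _; rewrite embG_mw mul0r.
- by rewrite big1 ?add0r ?mulr1// => k _; rewrite embG_mw mul0r.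
Qed.

Lemma embG1 : embG (1%:M : 'M[R]_q) = 1%:M.
Proof.
have wm i : (wd i == ord_max) = false.
  by apply/negbTE; rewrite -val_eqE /= neq_ltn ltn_ord.
apply: mxnP => [i j|i|j|].
- by rewrite embG_ww !mxE; congr (_%:R); rewrite -!val_eqE.
- by rewrite embG_wm mxE wm.
- by rewrite embG_mw mxE eq_sym wm.
- by rewrite embG_mm mxE eqxx.
Qed.

Lemma det_embG g : \det (embG g) = \det g.
Proof.
have det_cast r r' (e : r = r') (A : 'M[R]_r) : \det (castmx (e, e) A) = \det A.
  by case: r' / e; rewrite castmx_id.
by rewrite /embG det_cast det_ublock det1 mulr1.
Qed.

Lemma GL_embG g : GL (embG g) <-> GL g.
Proof. by rewrite !GLE det_embG. Qed.

Lemma embG_inv h : GL h -> embG (invmx h) = invmx (embG h).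
Proof.
move=> Gh; have GE : embG h \in unitmx by have /GL_embG := Gh.
rewrite -[LHS]mulmx1 -(mulmxV GE) mulmxA -embGM mulVmx//.
by rewrite embG1 mul1mx.
Qed.

Lemma smooth_embG (U : set 'M[R]_q) i j : open U -> smooth_on U (fun g => embG g i j).
Proof.
move=> oU; have [[i' ->]|->] := ord_widenP i; have [[j' ->]|->] := ord_widenP j.
- by under eq_fun do rewrite embG_ww; exact: smooth_coord.
- by under eq_fun do rewrite embG_wm; exact: smooth_cst.
- by under eq_fun do rewrite embG_mw; exact: smooth_cst.
- by under eq_fun do rewrite embG_mm; exact: smooth_cst.
Qed.

Lemma continuous_embG : continuous (@embG R q).
Proof.
move=> g; apply: mx_continuous => i j.
exact: smooth_continuous (smooth_embG i j openT) I.
Qed.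

End Embedding.

Section BlockEntries.
Variables (T : Type) (r : nat) (A : 'M[T]_1) (B : 'rV[T]_r) (C : 'cV[T]_r) (D : 'M[T]_r).
Local Notation M := (block_mx A B C D : 'M[T]_r.+1).

Lemma lift0_rshift (j : 'I_r) : lift ord0 j = rshift 1 j :> 'I_r.+1.
Proof. exact: val_inj. Qed.

Lemma lshift_ord0 : ord0 = lshift r (ord0 : 'I_1) :> 'I_r.+1.
Proof. exact: val_inj. Qed.

Lemma block_ul : M ord0 ord0 = A ord0 ord0.
Proof. rewrite lshift_ord0; exact: block_mxEul. Qed.

Lemma block_ur j : M ord0 (lift ord0 j) = B ord0 j.
Proof. rewrite lift0_rshift lshift_ord0; exact: block_mxEur. Qed.

Lemma block_dl i : M (lift ord0 i) ord0 = C i ord0.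
Proof. rewrite lift0_rshift lshift_ord0; exact: block_mxEdl. Qed.

Lemma block_dr i j : M (lift ord0 i) (lift ord0 j) = D i j.
Proof. rewrite !lift0_rshift; exact: block_mxEdr. Qed.

End BlockEntries.

(** * Translation by P' in the coordinates x *)

Section MasterFormula.
Variables (R : realType) (p : nat).
Hypothesis p0 : (0 < p)%N.
Local Notation wd := (widen_ord (leqnSn p)).
Local Notation wd' := (widen_ord (leqnSn p.+1)).
Variables (alpha : bool * bool) (lam : R[i] * R[i]).
Variable f : 'M[R]_p.+2 -> R[i]^o.
Hypothesis If : Ind (@triv_rep R p.+1) alpha lam f.

Definition resx (x : 'cV[R]_p.+1) : 'cV[R]_p := \col_j x (wd j) ord0.

Lemma resx_embx (x : 'cV[R]_p) : resx (embx x) = x.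
Proof. by apply/matrixP => i j; rewrite mxE embx_widen (ord1 j). Qed.

Lemma embG_expNm (x : 'cV[R]_p) : embG (expNm x) = expNm (embx x).
Proof.
have E r (y : 'cV[R]_r) i : expNm y (lift ord0 i) ord0 = y i ord0.
  by rewrite -col0E /expNm col0_block.
have E0 r (y : 'cV[R]_r) i j : expNm y i (lift ord0 j) = (i == lift ord0 j)%:R.
  have -> : lift ord0 j = rshift 1 j by exact: val_inj.
  rewrite /expNm; case: (@splitP 1 r i) => k ik.
    have -> : i = lshift r k by exact: val_inj.
    apply: etrans (block_mxEur _ _ _ _ k j) _; rewrite mxE; case: eqP => // /(congr1 val) /= e.
    by have := ltn_ord k; rewrite e.
  have -> : i = rshift 1 k by exact: val_inj.
  apply: etrans (block_mxEdr _ _ _ _ k j) _.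
  by rewrite mxE; congr (_%:R); apply/eqP/eqP => [->|/rshift_inj].
have E1 r (y : 'cV[R]_r) : expNm y ord0 ord0 = 1 by rewrite -/(corner _) corner_expNm.
apply: mxnP => [i j|i|j|].
- rewrite embG_ww; case: (unliftP ord0 j) => [j' ->|->].
    have Ej : wd' (lift ord0 j') = lift ord0 (wd j') by exact: val_inj.
    by rewrite Ej !E0 -Ej; congr (_%:R); apply/eqP/eqP => [->|/(congr1 val) /= /val_inj].
  have -> : wd' ord0 = ord0 by exact: val_inj.
  case: (unliftP ord0 i) => [i' ->|->].
    have Ei : wd' (lift ord0 i') = lift ord0 (wd i') by exact: val_inj.
    by rewrite Ei !E embx_widen.
  have -> : wd' ord0 = ord0 by exact: val_inj.
  by rewrite !E1.
- rewrite embG_wm; have -> : ord_max = lift ord0 ord_max :> 'I_p.+2 by exact: val_inj.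
  by rewrite E0; case: eqP => // /(congr1 val) /= e; have := ltn_ord i; rewrite e ltnn.
- rewrite embG_mw; have Em : ord_max = lift ord0 ord_max :> 'I_p.+2 by exact: val_inj.
  case: (unliftP ord0 j) => [j' ->|->].
    have Ej : wd' (lift ord0 j') = lift ord0 (wd j') by exact: val_inj.
    rewrite Ej E0; case: eqP => // /(congr1 val) /= e.
    by move: e; rewrite /bump /= add1n => -[e]; have := ltn_ord j'; rewrite /= -e ltnn.
  have -> : wd' ord0 = ord0 by exact: val_inj.
  by rewrite Em E embx_max.
- rewrite embG_mm; have -> : ord_max = lift ord0 ord_max :> 'I_p.+2 by exact: val_inj.
  by rewrite E0 eqxx.
Qed.

Section OneElement.
Variables (e t1 t2 : R) (g0 : 'M[R]_p) (b : 'rV[R]_p).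
Hypotheses (he : e = 1 \/ e = -1) (hg : SLpm g0).
Let P := elM e g0 *m expH p t1 *m expJ p t2 *m expNp b.
Let al := e * expR t1.
Let c := cfac p t1 t2.

(** The first column of exp(x) is (1, x', x_n), to which the matrix diag(P, 1) is applied. *)
Lemma embGP_col (x : 'cV[R]_p.+1) :
  corner (embG P *m expNm x) = al * (1 + pairing b (resx x)) /\
  col0 (embG P *m expNm x) =
    embx (c *: (g0 *m resx x)) + x ord_max ord0 *: delta_mx ord_max ord0.
Proof.
have PE : P = block_mx (al%:M : 'M[R]_1) (al *: b) 0 (c *: g0) by exact: parabE.
have cE i : (embG P *m expNm x) i ord0 =
    embG P i ord0 + \sum_(j < p) embG P i (wd' (lift ord0 j)) * resx x j ord0
    + embG P i ord_max * x ord_max ord0.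
  rewrite mxE big_ord_recl -/(corner _) corner_expNm mulr1 -addrA; congr (_ + _).
  rewrite big_ord_recr /=; congr (_ + _).
    apply: eq_bigr => j _; rewrite -col0E /expNm col0_block mxE.
    by congr (embG P i _ * _); exact: val_inj.
  rewrite -col0E /expNm col0_block; congr (embG P i _ * _); exact: val_inj.
have w0 : wd' (ord0 : 'I_p.+1) = ord0 by exact: val_inj.
have wl i : lift ord0 (wd i) = wd' (lift ord0 i) by exact: val_inj.
have lm : lift ord0 (ord_max : 'I_p.+1) = ord_max by exact: val_inj.
split.
  rewrite /corner cE -{1 2}w0 embG_ww PE block_ul mxE eqxx mulr1n -w0 embG_wm mul0r addr0.
  rewrite mulrDr mulr1; congr (_ + _); rewrite /pairing mxE mulr_sumr; apply: eq_bigr => j _.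
  by rewrite embG_ww block_ur !mxE mulrA.
apply: cVnP => [i|]; rewrite col0E cE [in RHS]mxE [X in _ = _ + X]mxE mxE ?embx_widen ?embx_max.
  rewrite wl embG_wm mul0r addr0 -{1}w0 embG_ww PE block_dl mxE add0r.
  have -> : (wd i == ord_max) = false by apply/negbTE; rewrite -val_eqE /= neq_ltn ltn_ord.
  rewrite mulr0 addr0 !mxE mulr_sumr; apply: eq_bigr => j _.
  by rewrite embG_ww block_dr !mxE mulrA.
rewrite lm embG_mm mul1r -{1}w0 embG_mw add0r big1 => [|j _]; last by rewrite embG_mw mul0r.
by rewrite !eqxx mulr1.
Qed.

Lemma det_embGP (x : 'cV[R]_p.+1) : \det (embG P *m expNm x) = e * \det g0 * expR t2.
Proof. by rewrite det_mulmx det_expNm mulr1 det_embG det_parab. Qed.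

Lemma unit_sign : e != 0 /\ \det g0 != 0.
Proof.
split; first by case: he => ->; rewrite ?oppr_eq0 oner_eq0.
by case: hg => ->; rewrite ?oppr_eq0 oner_eq0.
Qed.

Lemma al_neq0 : al != 0.
Proof. by rewrite mulf_neq0 ?unit_sign.1// gt_eqF ?expR_gt0. Qed.

Lemma GL_embGP : GL (embG P).
Proof.
apply/GL_embG/GLE; rewrite det_parab// !mulf_neq0 ?unit_sign.1 ?unit_sign.2//.
by rewrite gt_eqF ?expR_gt0.
Qed.

(* In the coordinates x, translation by diag(P, 1) is x |-> Psi x with multiplier
   kap (1 + b x)^(-lam.1). *)
Definition kap : R[i] := (sgnpow alpha.1 e * sgnpow alpha.2 (\det g0))%:C *
  (cexp (- lam.1 * t1%:C) * cexp (- lam.2 * t2%:C)).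

Definition Psi (x : 'cV[R]_p.+1) : 'cV[R]_p.+1 :=
  embx ((1 + pairing b (resx x))^-1 *: (((al^-1 * c) *: g0) *m resx x))
  + (x ord_max ord0 * (al * (1 + pairing b (resx x)))^-1) *: delta_mx ord_max ord0.

Lemma embxZ (a : R) (x : 'cV[R]_p) : embx (a *: x) = a *: embx x.
Proof. by rewrite -[a *: x]addr0 embx_lin embx0 addr0. Qed.

(** Positivity of 1 + b x' holds near 0, where germs live; this factor is then invisible to the sign
    characters and enters only through its power of exponent - lam_1. *)
Lemma Ind_translate (x : 'cV[R]_p.+1) : 0 < 1 + pairing b (resx x) ->
  f (embG P *m expNm x) =
  kap * cexp (- lam.1 * (ln (1 + pairing b (resx x)))%:C) * f (expNm (Psi x)).
Proof.
move=> h; have [cc c0] := embGP_col x; have [e0 d0] := unit_sign.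
have Gh : GL (embG P *m expNm x) by apply: GL_mul GL_embGP (GL_expNm x).
have h0 : 1 + pairing b (resx x) != 0 by rewrite gt_eqF.
have ca : corner (embG P *m expNm x) != 0 by rewrite cc mulf_neq0 ?al_neq0.
rewrite (Ind_cell (ltn0Sn p) If Gh ca).
have -> : xcoord (embG P *m expNm x) = Psi x.
  rewrite /xcoord cc c0 scalerDr scalerA /Psi; congr (_ + _); last by rewrite [_^-1 * _]mulrC.
  rewrite -embxZ; congr embx; rewrite -!scalemxAl !scalerA invfM; congr (_ *: _); ring.
suff -> : chrV alpha lam (embG P *m expNm x) =
    kap * cexp (- lam.1 * (ln (1 + pairing b (resx x)))%:C) by [].
rewrite /chrV cc det_embGP /kap.
have ne : `|e| = 1 by case: he => ->; rewrite ?normrN normr1.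
have nd : `|\det g0| = 1 by case: hg => ->; rewrite ?normrN normr1.
have -> : ln `|e * \det g0 * expR t2| = t2.
  by rewrite !normrM ne nd !mul1r (ger0_norm (expR_ge0 _)) expRK.
have -> : ln `|al * (1 + pairing b (resx x))| = t1 + ln (1 + pairing b (resx x)).
  rewrite !normrM ne mul1r (ger0_norm (expR_ge0 _)) (gtr0_norm h).
  by rewrite lnM ?posrE ?expR_gt0// expRK.
have -> : sgnpow alpha.1 (al * (1 + pairing b (resx x))) = sgnpow alpha.1 e.
  by rewrite !sgnpowM (sgnpow_gt0 _ (expR_gt0 _)) (sgnpow_gt0 _ h) !mulr1.
have -> : sgnpow alpha.2 (e * \det g0 * expR t2 * (al * (1 + pairing b (resx x)))) =
   sgnpow alpha.2 (\det g0).
  rewrite !sgnpowM !(sgnpow_gt0 _ (expR_gt0 _)) (sgnpow_gt0 _ h) !mulr1.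
  by rewrite mulrAC sgnpow_sqr// mul1r.
rewrite rmorphD /= mulrDr cexpD; ring.
Qed.

End OneElement.

Lemma smooth_expNm r (U : set 'cV[R]_r) i j : open U -> smooth_on U (fun x => expNm x i j).
Proof.
move=> oU; case: (unliftP ord0 i) => [i' ->|->]; case: (unliftP ord0 j) => [j' ->|->].
- by under eq_fun do rewrite /expNm block_dr; exact: smooth_cst.
- by under eq_fun do rewrite /expNm block_dl; exact: smooth_coord.
- by under eq_fun do rewrite /expNm block_ur; exact: smooth_cst.
- by under eq_fun do rewrite /expNm block_ul; exact: smooth_cst.
Qed.

Lemma csmooth_coordinates (A : 'M[R]_p.+2) : GL A -> csmooth setT (fun x => f (A *m expNm x)).
Proof.
move=> GA; have [sf _ _] := If.
have oG := @open_GL R p.+2; have oT := @openT 'cV[R]_p.+1.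
apply: (csmooth_pull oT oG ((vsmooth_scalar oG _).1 sf)) => [x _|i j].
  exact: GL_mul GA (GL_expNm x).
under eq_fun do rewrite mxE; apply: (smooth_bigsum oT) => k.
exact: (smooth_mul oT (smooth_cst oT _) (smooth_expNm k j oT)).
Qed.

Lemma csmooth_chart : csmooth setT (fun x => f (expNm x)).
Proof.
have := csmooth_coordinates (A := 1%:M) _; under eq_fun do rewrite mul1mx.
by apply; rewrite /GL /= unitmx1.
Qed.

Lemma polyfunZ q l (P : dhomog q R[i] l) (a : R) v :
  polyfun P (a *: v) = (a ^+ l)%:C * polyfun P v.
Proof.
rewrite /polyfun !mevalE mulr_sumr big_seq [RHS]big_seq; apply: eq_bigr => k kP.
have kl : mdeg k = l := dhomog_mf (dhomog_is_dhomog P) kP.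
rewrite mulrCA; congr (_ * _); rewrite -kl mdegE -prodrXr rmorph_prod -big_split /=.
by apply: eq_bigr => i _; rewrite /evalc mxE rmorphM exprMn rmorphXn.
Qed.

Lemma polyfun_scale q l (P : dhomog q R[i] l) (k : R[i]) v :
  polyfun (k *: P : dhomog q R[i] l) v = k * polyfun P v.
Proof. by rewrite /polyfun -mevalZ; congr meval; exact: linearZ. Qed.

Lemma polyfun_poly_rep q l (P : dhomog q R[i] l) (g : 'M[R]_q) v :
  polyfun (poly_rep g P) v = polyfun P (invmx g *m v).
Proof.
rewrite /polyfun /= /subst_inv comp_mpoly_meval; apply: meval_eq => i.
rewrite tnth_mktuple raddf_sum /= /evalc mxE rmorph_sum; apply: eq_bigr => k _.
by rewrite mevalZ mevalXU rmorphM.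
Qed.

Section OneElementJets.
Variables (e t1 t2 : R) (g0 : 'M[R]_p) (b : 'rV[R]_p).
Hypotheses (he : e = 1 \/ e = -1) (hg : SLpm g0).
Let P := elM e g0 *m expH p t1 *m expJ p t2 *m expNp b.
Let al := e * expR t1.
Let c := cfac p t1 t2.

(** [Psi] divides x_n by al (1 + b x'), so m derivatives in x_n raise the weight from lam_1 to lam_1
    + m. *)
Lemma dlast_translate m (x : 'cV[R]_p) : halfspace b x ->
  dlast m (fun y => f (embG P *m expNm y)) (embx x) =
  kap e t1 t2 g0 * (al^-1 ^+ m)%:C
    * cexp (- (lam.1 + m%:R) * (ln (1 + pairing b x))%:C)
    * dlast m (fun y => f (expNm y))
       (embx ((1 + pairing b x)^-1 *: (((al^-1 * c) *: g0) *m x))).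
Proof.
move=> hx; have oT := @openT 'cV[R]_p.+1.
pose O : set 'cV[R]_p.+1 := [set y | 0 < 1 + pairing b (resx y)].
have spr : smooth_on setT (fun y => 1 + pairing b (resx y)).
  apply: (smooth_pull oT (@openT 'cV[R]_p) (smooth_pairing b openT) (fun _ _ => I)) => i j.
  under eq_fun do rewrite mxE; exact: smooth_coord.
have oO : open O.
  have cp : continuous (fun y => 1 + pairing b (resx y)).
    by move=> y; exact: smooth_continuous spr I.
  rewrite (_ : O = (fun y => 1 + pairing b (resx y)) @^-1` [set z : R | 0 < z])//.
  by move/continuousP : cp; apply; exact: open_gt.
have Ox : O (embx x) by rewrite /O /= resx_embx.
pose C (y : 'cV[R]_p.+1) :=
  kap e t1 t2 g0 * cexp (- lam.1 * (ln (1 + pairing b (resx y)))%:C).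
pose s (y : 'cV[R]_p.+1) := (al * (1 + pairing b (resx y)))^-1.
have Er (t : R) y : resx (t *: delta_mx ord_max ord0 + y) = resx y.
  apply/matrixP => i j; rewrite !mxE.
  have -> : (wd i == ord_max) = false by apply/negbTE; rewrite -val_eqE /= neq_ltn ltn_ord.
  by rewrite mulr0 add0r.
rewrite dlastE (@cpderivs_on _ _ _ _ oO _ (fun y => C y * f (expNm (Psi e t1 t2 g0 b y)))
   _ _ (embx x) Ox); last by move=> y Oy; exact: Ind_translate.
rewrite -dlastE.
rewrite (@dlast_twist _ _ O _ C (Psi e t1 t2 g0 b) s m oO csmooth_chart _ _ _ _ Ox).
- have -> : Psi e t1 t2 g0 b (embx x)
     = embx ((1 + pairing b x)^-1 *: (((al^-1 * c) *: g0) *m x)).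
    by rewrite /Psi resx_embx embx_max mul0r scale0r addr0.
  congr (_ * _); rewrite /C /s resx_embx invfM exprMn rmorphM /= opprD mulrDl cexpD.
  have -> : cexp (- m%:R * (ln (1 + pairing b x))%:C) = ((1 + pairing b x)^-1 ^+ m)%:C.
    by rewrite mulNr cexpN cexpMn cexp_ln// -rmorphXn /= -fmorphV /= exprVn.
  ring.
- by move=> t y _; rewrite /C Er.
- by move=> t y _; rewrite /s Er.
- move=> t y _; rewrite /Psi Er !mxE !eqxx mulr1 mulrDl scalerDl addrCA.
  by rewrite /s.
Qed.

(** The case b = 0 is available for every pair (m, l) and serves the classification; the other two
    give the equivariance under N'_+ needed for existence. *)
Lemma opD_equivariant m l :
  [\/ b = 0, l = 0%N | lam.1 + m%:R = 1 - l%:R] ->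
  opD m l (fun y => f (embG P *m expNm y)) 0 =
  (kap e t1 t2 g0 * (al^-1 ^+ m * (al^-1 * c) ^+ l)%:C)
    *: poly_rep (invmx g0) (opD m l (fun y => f (expNm y)) 0).
Proof.
move=> hb.
have GP := GL_embGP t1 t2 b he hg.
have oT := @openT 'cV[R]_p.+1.
apply: val_inj; apply: polyfun_inj => v.
rewrite [val _](opD_jet m l oT (csmooth_coordinates GP) I).
(* For b = 0 the twisting factor is 1 whatever the weight, so 1 - l may be chosen to meet the
   hypothesis of [jet_twist]. *)
pose mu := if b == 0 then 1 - l%:R else lam.1 + m%:R.
have hmu : l = 0%N \/ mu = 1 - l%:R.
  rewrite /mu; case: hb => [->|->|->]; first by rewrite eqxx; right.
    by left.
  by right; case: ifP.
pose u x := dlast m (fun y => f (expNm y)) (embx x).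
have su : csmooth setT u.
  have s := csmooth_cpderivs (nseq m (ord_max, ord0)) csmooth_chart.
  by have := csmooth_embx oT s; rewrite /u dlastE.
have := @jet_twist R p l u (fun x => dlast m (fun y => f (embG P *m expNm y)) (embx x))
  (kap e t1 t2 g0 * (al^-1 ^+ m)%:C) mu b ((al^-1 * c) *: g0) v su hmu.
move=> ->; last first.
  apply: filterS (near_halfspace b) => x hx; rewrite dlast_translate//.
  rewrite /mu; case: eqP => // b0; rewrite b0 /pairing mul0mx mxE addr0 ln1.
  by rewrite !mulr0.
rewrite [RHS](polyfun_scale _ _ v) polyfun_poly_rep invmxK.
rewrite -(opD_jet m l oT csmooth_chart I) -scalemxAl polyfunZ.
by rewrite rmorphM !mulrA.
Qed.

End OneElementJets.
End MasterFormula.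

(** * Existence of the operators *)

Section UniformBounds.
Variables (R : realType) (m n m' n' : nat).
Local Notation M := 'M[R]_(m, n).
Local Notation M' := 'M[R]_(m', n').
Variables (U : set M) (V : set M') (phi : M -> M').
Hypotheses (oU : open U) (oV : open V).
Hypothesis UV : forall x, U x -> V (phi x).
Hypothesis sphi : forall i j, smooth_on U (fun x => phi x i j).

Lemma pderivs_sum (X : set M) (I : Type) (r : seq I) (a : I -> R) (F : I -> M -> R) s x :
  open X -> (forall i, smooth_on X (F i)) -> X x ->
  pderivs s (fun y => \sum_(i <- r) a i * F i y) x = \sum_(i <- r) a i * pderivs s (F i) x.
Proof.
move=> oX sF Xx; elim: r => [|i r IH].
  have -> : (fun y : M => \sum_(i <- [::]) a i * F i y) = fun=> 0.
    by apply/funext => y; rewrite big_nil.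
  rewrite big_nil; suff -> : pderivs s (fun _ : M => 0 : R) = fun=> 0 by [].
  by elim: s => [//|ij s IH]; apply/funext => y; rewrite /= IH pderiv_cst.
have -> : (fun y => \sum_(i <- i :: r) a i * F i y) =
    fun y => a i * F i y + \sum_(i <- r) a i * F i y.
  by apply/funext => y; rewrite big_cons.
rewrite (pderivs_lin oX (a i) s (sF i) _ Xx); last first.
  by apply: (smooth_bigsum oX) => j; exact: (smooth_mul oX (smooth_cst oX _) (sF j)).
by rewrite big_cons IH.
Qed.

(** Induction on [k'] with [k] generalised: a derivative of [A f] is an operator of order k + 1
    applied to [f], so the sum k' + k is preserved. *)
Lemma lop_uniform_bound k k' A (K : set M) : compact K -> K `<=` U -> lop U V phi k A ->
  exists2 C : R, 0 <= C & forall f (e : R), smooth_on V f -> 0 <= e ->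
    (forall s x, (size s <= k' + k)%N -> K x -> `|pderivs s f (phi x)| <= e) ->
    forall s x, (size s <= k')%N -> K x -> `|pderivs s (A f) x| <= C * e.
Proof.
move=> cK KU; elim: k' k A => [|k' IH] k A lA.
  have [C C0 hC] := lop_bound cK KU lA.
  exists C => // f e sf e0 he s x; rewrite leqn0 => /nilP -> Kx.
  by apply: hC => // t y tk Ky; exact: he.
have [C C0 hC] := lop_bound cK KU lA.
have /(_ _)/cid2 h := IH k.+1 _ (lop_pderiv oU oV UV sphi _ lA).
pose D ij := s2val (h ij).
have D0 ij : 0 <= D ij by rewrite /D; case: (h ij).
have CD ij : D ij <= C + \sum_ij D ij.
  apply: (@le_trans _ _ (\sum_ij D ij)); last by rewrite lerDr.
  by rewrite (bigD1 ij)//= lerDl sumr_ge0.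
exists (C + \sum_ij D ij); first by rewrite addr_ge0// sumr_ge0.
move=> f e sf e0 he s x; case/lastP: s => [_ Kx|s ij].
  apply: (@le_trans _ _ (C * e)); last by rewrite ler_wpM2r// lerDl sumr_ge0.
  by apply: hC => // t y tk Ky; apply: he => //; apply: leq_trans tk (leq_addl _ _).
rewrite size_rcons ltnS pderivs_rcons => sk Kx.
apply: (@le_trans _ _ (D ij * e)); last by rewrite ler_wpM2r.
rewrite /D; case: (h ij) => E E0 /= hE; apply: hE => // t y tk Ky; apply: he => //.
by rewrite addSnnS.
Qed.

End UniformBounds.

(** * Left invariant vector fields *)

Section InvariantVectorFields.
Variables (R : realType) (r : nat).
Local Notation oG := (@open_GL R r.+1).
Local Notation oT := (@openT 'cV[R]_r).

Let id_smooth i j : smooth_on (@GL R r.+1) (fun g => id g i j).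
Proof. exact: smooth_coord oG i j. Qed.

(* The coordinate derivatives of x |-> f (g exp(x)) are given by left invariant
   vector fields, since the last columns of g exp(x) do not depend on x. *)
Lemma invariant_fields (s : seq ('I_r * 'I_1)) :
  exists2 A, lop (@GL R r.+1) (@GL R r.+1) id (size s) A &
    forall f g x, smooth_on (@GL R r.+1) f -> GL g ->
      pderivs s (fun y => f (g *m expNm y)) x = A f (g *m expNm x).
Proof.
have sm (g : 'M[R]_r.+1) i j : smooth_on setT (fun y : 'cV[R]_r => (g *m expNm y) i j).
  under eq_fun do rewrite mxE; apply: (smooth_bigsum oT) => k.
  exact: (smooth_mul oT (smooth_cst oT _) (smooth_expNm k j oT)).
have inG g : GL g -> forall y : 'cV[R]_r, setT y -> GL (g *m expNm y).
  by move=> Gg y _; exact: GL_mul Gg (GL_expNm y).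
elim: s => [|[j0 j1] s [A lA hA]].
  exists (fun f x => 1 * pderivs [::] f (id x)).
    by apply: lop_gen => //; exact: smooth_cst oG 1.
  by move=> f g x _ _; rewrite mul1r.
(* In the direction [j0] only column 0 of g exp(x) moves, with velocity the column
   [lift ord0 j0]. *)
pose B f (x : 'M[R]_r.+1) :=
  \sum_kl ((kl.2 == ord0)%:R * x kl.1 (lift ord0 j0)) * pderiv kl (A f) x.
exists B.
  apply: lop_big => kl.
  exact: (lop_mul oG (smooth_mul oG (smooth_cst oG _) (smooth_coord oG _ _))
    (lop_pderiv oG oG (fun _ h => h) id_smooth _ lA)).
move=> f g x sf Gg; rewrite (ord1 j1) /=.
have sA := lop_smooth oG oG (fun _ h => h) id_smooth lA sf.
have -> : pderivs s (fun y => f (g *m expNm y)) = fun y => A f (g *m expNm y).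
  by apply/funext => y; exact: hA.
rewrite (pderiv_pull (j0, ord0) oG sA (inG g Gg) (sm g) (I : setT x)).
apply: eq_bigr => kl _; congr (_ * _).
have -> : (fun y => (g *m expNm y) kl.1 kl.2) =
  (fun y => \sum_(k < r.+1) g kl.1 k * expNm y k kl.2).
  by apply/funext => y; rewrite mxE.
have -> : (fun y : 'cV[R]_r => \sum_(k < r.+1) g kl.1 k * expNm y k kl.2) =
   if kl.2 == ord0 then (fun y => \sum_(k < r) g kl.1 (lift ord0 k) * y k ord0 + g kl.1 ord0)
   else fun=> g kl.1 kl.2.
  case: eqP => [->|/eqP k0]; apply/funext => y.
    rewrite big_ord_recl addrC /expNm block_ul mxE eqxx mulr1; congr (_ + _).
    by apply: eq_bigr => k _; rewrite block_dl.
  case: (unliftP ord0 kl.2) k0 => [k ->|->]; last by rewrite eqxx.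
  move=> _; rewrite big_ord_recl /expNm block_ur mxE mulr0 add0r.
  rewrite (bigD1 k)//= block_dr mxE eqxx mulr1 big1 ?addr0// => i ik.
  by rewrite block_dr mxE (negbTE ik) mulr0.
have -> : (g *m expNm x) kl.1 (lift ord0 j0) = g kl.1 (lift ord0 j0).
  rewrite mxE big_ord_recl /expNm block_ur mxE mulr0 add0r.
  rewrite (bigD1 j0)//= block_dr mxE eqxx mulr1 big1 ?addr0// => i ij.
  by rewrite block_dr mxE (negbTE ij) mulr0.
case: eqP => _; last by rewrite pderiv_cst mul0r.
rewrite mul1r (pderiv_add _ _ (smooth_cst oT _) I); last first.
  by apply: (smooth_bigsum oT) => k;
     exact: (smooth_mul oT (smooth_cst oT _) (smooth_coord oT _ _)).
rewrite pderiv_cst addr0.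
have := @pderivs_sum R r 1 setT _ (index_enum 'I_r) (fun k => g kl.1 (lift ord0 k))
  (fun k (y : 'cV[R]_r) => y k ord0) [:: (j0, ord0)] x oT
  (fun k => smooth_coord oT k ord0) I.
rewrite /= => ->; rewrite (bigD1 j0)//= pderiv_coord eqxx mulr1 big1 ?addr0// => k kj.
by rewrite pderiv_coord xpair_eqE (negbTE kj) mulr0.
Qed.

End InvariantVectorFields.

(** * Real and imaginary parts as combinations of real coordinates *)

Section ScalarParts.
Variable R : realType.
Local Notation d := (\dim {:R[i]^o}).
Local Notation Re := (@complex.Re R).
Local Notation Im := (@complex.Im R).

Definition re_coef (c : 'I_d * bool) : R :=
  if c.2 then - Im (vbasis {:R[i]^o})`_c.1 else Re (vbasis {:R[i]^o})`_c.1.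
Definition im_coef (c : 'I_d * bool) : R :=
  if c.2 then Re (vbasis {:R[i]^o})`_c.1 else Im (vbasis {:R[i]^o})`_c.1.

Lemma scalar_parts (z : R[i]^o) :
  Re z = \sum_c re_coef c * rcoord c z /\ Im z = \sum_c im_coef c * rcoord c z.
Proof.
have E : z = \sum_(i < d) coord (vbasis {:R[i]^o}) i z * (vbasis {:R[i]^o})`_i.
  have := coord_vbasis (memvf (z : R[i]^o)); rewrite {1}/GRing.scale /=.
  by move=> {1}->.
split.
  rewrite {1}E Re_sum -(pair_bigA _ (fun i b => re_coef (i, b) * rcoord (i, b) z)) /=.
  apply: eq_bigr => i _; rewrite big_bool /re_coef /rcoord /= ReM; ring.
rewrite {1}E Im_sum -(pair_bigA _ (fun i b => im_coef (i, b) * rcoord (i, b) z)) /=.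
apply: eq_bigr => i _; rewrite big_bool /im_coef /rcoord /= ImM; ring.
Qed.

Variables (m n : nat) (U : set 'M[R]_(m, n)).
Hypothesis oU : open U.

Lemma smooth_close_parts : exists2 C : R, 0 <= C &
  forall (f h : 'M[R]_(m, n) -> R[i]^o) K k e, vsmooth_on U f -> vsmooth_on U h ->
  K `<=` U -> smooth_close K k e f h -> forall s x, (size s <= k)%N -> K x ->
  `|pderivs s (fun y => -1 * Re (f y) + Re (h y)) x| <= C * e /\
  `|pderivs s (fun y => -1 * Im (f y) + Im (h y)) x| <= C * e.
Proof.
exists (\sum_c (`|re_coef c| + `|im_coef c|)).
  by apply: sumr_ge0 => c _; rewrite addr_ge0.
move=> f h K k e sf sh KU fh s x sk Kx; have Ux := KU x Kx.
have key (co : 'I_d * bool -> R) (P : R[i] -> R) :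
    (forall z, P z = \sum_c co c * rcoord c (z : R[i]^o)) ->
    `|pderivs s (fun y => -1 * P (f y) + P (h y)) x| <= \sum_c `|co c| * e.
  move=> hP.
  have -> : (fun y => -1 * P (f y) + P (h y)) =
      fun y => \sum_c co c * (-1 * rcoord c (f y) + rcoord c (h y)).
    apply/funext => y; rewrite !hP mulr_sumr -big_split /=; apply: eq_bigr => c _; ring.
  rewrite (pderivs_sum _ _ _ oU); last by [].
    apply: le_trans (ler_norm_sum _ _ _) _; apply: ler_sum => c _.
    rewrite normrM ler_wpM2l//.
    rewrite (pderivs_lin oU (-1) s (sf c) (sh c) Ux) mulN1r addrC.
    by apply: ltW; exact: fh.
  by move=> c; exact: (smooth_lin oU (-1) (sf c) (sh c)).
(* Closeness bounds an absolute value by [e] only if there is a coordinate at all; one exists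
   because [R[i]^o] is not 0. *)
have e0 : 0 <= e.
  have [[z]|nod] := pselect (exists c : 'I_d * bool, True).
    by move=> _; apply: ltW; apply: le_lt_trans (normr_ge0 _) (fh z s x sk Kx).
  exfalso; apply: nod; have : (0 < d)%N.
    by rewrite lt0n dimv_eq0; apply/eqP => /vspaceP /(_ (1 : R[i]^o)); rewrite memvf memv0 oner_eq0.
  by move=> d0; exists (Ordinal d0, false).
rewrite mulr_suml; split.
  apply: le_trans (key re_coef Re _) _; first by move=> z; exact: (scalar_parts z).1.
  by apply: ler_sum => c _; rewrite ler_wpM2r// lerDl.
apply: le_trans (key im_coef Im _) _; first by move=> z; exact: (scalar_parts z).2.
by apply: ler_sum => c _; rewrite ler_wpM2r// lerDr.
Qed.

End ScalarParts.

Section RealScalars.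
Variable R : realType.
Implicit Types a b : R.

Lemma rcM a b : (a * b)%:C = a%:C * b%:C :> R[i]. Proof. exact: rmorphM. Qed.
Lemma rcD a b : (a + b)%:C = a%:C + b%:C :> R[i]. Proof. exact: rmorphD. Qed.
Lemma rcN a : (- a)%:C = - a%:C :> R[i]. Proof. exact: rmorphN. Qed.
Lemma rcV a : (a^-1)%:C = (a%:C)^-1 :> R[i]. Proof. exact: fmorphV. Qed.
Lemma rcn n : (n%:R : R)%:C = n%:R :> R[i]. Proof. exact: rmorph_nat. Qed.

End RealScalars.

(** * Equivariance, continuity and locality of the operators *)

Section Existence.
Variables (R : realType) (p : nat).
Hypothesis p0 : (0 < p)%N.
Variables (alpha beta : bool * bool) (lam nu : R[i] * R[i]).
Variables (W : vectType R[i]) (varpi : 'M[R]_p -> 'End(W)).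
Hypothesis hvarpi : irr_rep varpi.
Variables (m l : nat) (T : {linear dhomog p R[i] l -> W}).
Hypothesis hT : forall g u, SLpm g ->
  T ((sgnpow alpha.2 (\det g))%:C *: poly_rep g u)
  = (sgnpow beta.2 (\det g))%:C *: varpi g (T u).
Hypothesis hb : beta.1 = alpha.1 (+) odd (m + l).
Hypothesis hnu : nu = (lam.1 + (m + l)%:R + l%:R / p%:R, lam.2 - l%:R / p%:R).
Hypothesis hl : l = 0%N \/ lam.1 + m%:R = 1 - l%:R.
Local Notation Re := (@complex.Re R).
Local Notation Im := (@complex.Im R).
Local Notation I_ := (Ind (@triv_rep R p.+1) alpha lam).
Local Notation J_ := (Ind varpi beta nu).
Local Notation oG := (@open_GL R p.+2).
Local Notation oG' := (@open_GL R p.+1).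
Local Notation en := (ord_max : 'I_p.+1, ord0 : 'I_1).

Lemma SLpm_inv r (g : 'M[R]_r) : SLpm g ->
  [/\ SLpm (invmx g), g *m invmx g = 1%:M & invmx g *m g = 1%:M].
Proof.
move=> hg; have gu : g \in unitmx.
  by rewrite unitmxE unitfE; case: hg => ->; rewrite ?oppr_eq0 oner_eq0.
split; [|exact: mulmxV|exact: mulVmx].
by rewrite /SLpm /= det_inv; case: hg => ->; [left|right]; rewrite ?invrN invr1.
Qed.

Lemma varpiK g w : SLpm g ->
  varpi g (varpi (invmx g) w) = w /\ varpi (invmx g) (varpi g w) = w.
Proof.
case: hvarpi => r1 rM _ _ _ hg; have [hi gV Vg] := SLpm_inv hg.
by split; rewrite -comp_lfunE -rM// ?gV ?Vg r1 id_lfunE.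
Qed.

(* The operator opD at the origin, transported to g by translation. *)
Definition DD (f : 'M[R]_p.+2 -> R[i]^o) (g : 'M[R]_p.+1) : W :=
  if g \in unitmx then T (opD m l (fun x => f (embG g *m expNm x)) 0) else 0.

Lemma sgnpow_odd (e : R) N : e = 1 \/ e = -1 -> sgnpow (odd N) e = e ^+ N.
Proof.
case=> ->; first by rewrite expr1n sgnpow_gt0.
by rewrite -signr_odd; case: (odd N); rewrite /sgnpow ?sgrN ?sgr1 ?expr1 ?expr0.
Qed.

(** A derivative in x_n scales by the inverse of al, one in x' also by [cfac], which is exp((t2 -
    t1) / p). The l factors [cfac] shift the two weights by l / p in opposite directions, whence the
    form of nu. *)
Lemma weight_identity e t1 t2 (g0 : 'M[R]_p) : e = 1 \/ e = -1 ->
  kap alpha lam e t1 t2 g0 *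
    ((e * expR t1)^-1 ^+ m * ((e * expR t1)^-1 * cfac p t1 t2) ^+ l)%:C =
  (sgnpow alpha.1 e * e ^+ (m + l) * sgnpow alpha.2 (\det g0))%:C *
  (cexp (- (lam.1 + (m + l)%:R + l%:R / p%:R) * t1%:C)
     * cexp (- (lam.2 - l%:R / p%:R) * t2%:C)).
Proof.
move=> he; have eV : e^-1 = e by case: he => ->; rewrite ?invrN invr1.
have p1 : p%:R != 0 :> R by rewrite pnatr_eq0 -lt0n.
have -> : (e * expR t1)^-1 ^+ m * ((e * expR t1)^-1 * cfac p t1 t2) ^+ l =
   e ^+ (m + l) * expR (- ((m + l)%:R + l%:R / p%:R) * t1 + l%:R / p%:R * t2).
  rewrite exprMn mulrA -exprD invfM eV exprMn -[LHS]mulrA; congr (_ * _).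
  rewrite /cfac -expRN -!expRM_natl -expRD; congr expR; rewrite natrD; field.
  exact: p1.
rewrite /kap [(e ^+ _ * _)%:C]rcM -cexp_real.
have -> : (- ((m + l)%:R + l%:R / p%:R) * t1 + l%:R / p%:R * t2)%:C =
   - ((m + l)%:R + l%:R / p%:R) * t1%:C + l%:R / p%:R * t2%:C :> R[i].
  by rewrite !(rcD, rcM, rcN, rcV, rcn).
set s1 := sgnpow alpha.1 e; set s2 := sgnpow alpha.2 _.
rewrite !rcM.
have -> : - (lam.1 + (m + l)%:R + l%:R / p%:R) * t1%:C =
   - lam.1 * t1%:C + - ((m + l)%:R + l%:R / p%:R) * t1%:C by ring.
have -> : - (lam.2 - l%:R / p%:R) * t2%:C = - lam.2 * t2%:C + l%:R / p%:R * t2%:C by ring.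
rewrite !cexpD; ring.
Qed.

Lemma DD_equivariant f g e g0 t1 t2 y : I_ f -> GL g -> e = 1 \/ e = -1 -> SLpm g0 ->
  DD f (g *m (elM e g0 *m expH p t1 *m expJ p t2 *m expNp y))
  = ((inducing varpi beta nu e g0 t1 t2)^-1)%VF (DD f g).
Proof.
move=> If Gg he hg; rewrite /DD.
have GP : GL (elM e g0 *m expH p t1 *m expJ p t2 *m expNp y).
  by apply/GL_embG; exact: GL_embGP.
have GgP := GL_mul Gg GP.
have -> : (g *m (elM e g0 *m expH p t1 *m expJ p t2 *m expNp y) \in unitmx) = true by exact: GgP.
have -> : (g \in unitmx) = true by exact: Gg.
have GE : GL (embG g) by apply/GL_embG.
have If' := Ind_ltransl (GL_inv GE) If.
set P := elM e g0 *m _ *m _ *m _.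
have -> : (fun x => f (embG (g *m P) *m expNm x)) =
   (fun x => ltransl (invmx (embG g)) f (embG P *m expNm x)).
  by apply/funext => x; rewrite /ltransl invmxK embGM mulmxA.
have hyp : [\/ y = 0, l = 0%N | lam.1 + m%:R = 1 - l%:R].
  by case: hl => h; [constructor 2|constructor 3].
rewrite (opD_equivariant p0 If' t1 t2 he hg hyp) weight_identity//.
have [hi _ _] := SLpm_inv hg.
have -> : (fun x => ltransl (invmx (embG g)) f (expNm x)) = (fun x => f (embG g *m expNm x)).
  by apply/funext => x; rewrite /ltransl invmxK.
set Q := opD m l _ 0.
have di : \det (invmx g0) = \det g0.
  by rewrite det_inv; case: hg => ->; rewrite ?invrN invr1.
have [e0 d0] := unit_sign he hg.
(* [hT] at the inverse of g0; the sign attached to alpha_2 is its own inverse and passes to the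
   other side. *)
have hTi : T (poly_rep (invmx g0) Q) =
    (sgnpow alpha.2 (\det g0) * sgnpow beta.2 (\det g0))%:C *: varpi (invmx g0) (T Q).
  have := hT Q hi; rewrite linearZ /= di.
  move/(congr1 (fun w => (sgnpow alpha.2 (\det g0))%:C *: w)).
  by rewrite !scalerA -!rmorphM /= sgnpow_sqr// scale1r.
rewrite linearZ /= hTi scalerA.
rewrite (@inducing_invE _ _ beta nu W varpi e g0 (invmx g0))//; last first.
- by move=> w; exact: (varpiK w hg).2.
- by move=> w; exact: (varpiK w hg).1.
congr (_ *: _); rewrite hnu /= hb sgnpow_addb//.
rewrite sgnpow_odd// mulrAC -rcM; congr (_%:C * _).
by rewrite mulrA -[_ * _ * sgnpow alpha.2 _]mulrA sgnpow_sqr// mulr1.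
Qed.

Definition slist (k : multinom p) : seq ('I_p.+1 * 'I_1) :=
  nseq m en ++ wlist (mlist k).

(** [insubd] returns 0 when the degree of [k] is not [l]; only multi-indices of degree [l]
    matter. *)
Definition Ydh (k : multinom p) : dhomog p R[i] l := insubd (0 : dhomog p R[i] l) (ytilde R k).

Lemma opD_sum F : opD m l F 0 = \sum_(k <- mdegs p l) cpderivs (slist k) F 0 *: Ydh k.
Proof.
apply: val_inj => /=; rewrite /opD_mpoly.
rewrite (@sum_mdegs p _ l (fun k => dlast m (dfirst k F) (embx 0) *: ytilde R k)).
rewrite (raddf_sum (@mpoly_of_dhomog p R[i] l)) /= big_seq [RHS]big_seq.
apply: eq_bigr => k; rewrite mem_mdegs => /eqP kl.
have lE (a : R[i]) (Q : dhomog p R[i] l) : mpoly_of_dhomog (a *: Q) = a *: val Q.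
  exact: linearZ.
apply: etrans _ (esym (lE _ _)); rewrite insubdK; last first.
  by rewrite -topredE /=; apply: dhomogZ; rewrite dhomogX; apply/eqP.
by rewrite dlastE dfirstE -cpderivs_cat embx0.
Qed.

Lemma DD_sum f g : GL g -> DD f g =
  \sum_(k <- mdegs p l) cpderivs (slist k) (fun x => f (embG g *m expNm x)) 0 *: T (Ydh k).
Proof.
move=> Gg; rewrite /DD (_ : (g \in unitmx) = true)// opD_sum linear_sum.
by apply: eq_bigr => k _; rewrite linearZ.
Qed.

Lemma embG_GL (g : 'M[R]_p.+1) : GL g -> GL (embG g).
Proof. by move=> Gg; apply/GL_embG. Qed.

Lemma jets_lop (s : seq ('I_p.+1 * 'I_1)) :
  exists2 B, lop (@GL R p.+1) (@GL R p.+2) (@embG R p.+1) (size s) B &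
    forall (f : 'M[R]_p.+2 -> R) g, smooth_on (@GL R p.+2) f -> GL g ->
      pderivs s (fun x => f (embG g *m expNm x)) 0 = B f g.
Proof.
have [A lA hA] := @invariant_fields R p.+1 s.
exists (fun f x => A f (embG x)).
  exact: (lop_pull oG' oG embG_GL (fun i j => smooth_embG i j oG') lA).
move=> f g sf Gg; rewrite (hA f (embG g) 0 sf (embG_GL Gg)).
suff -> : expNm (0 : 'cV[R]_p.+1) = 1%:M by rewrite mulmx1.
by rewrite /expNm -scalar_mx_block.
Qed.

(** Multiplication by the complex coordinates of [T (Ydh k)] mixes real and imaginary parts, hence
    one real operator acting on Re f and another on Im f. *)
Lemma DD_lop (c : 'I_(\dim {:W}) * bool) : exists N A A',
  [/\ lop (@GL R p.+1) (@GL R p.+2) (@embG R p.+1) N A,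
      lop (@GL R p.+1) (@GL R p.+2) (@embG R p.+1) N A' &
  forall f g, csmooth (@GL R p.+2) f -> GL g ->
    rcoord c (DD f g) = A (fun x => Re (f x)) g + A' (fun x => Im (f x)) g].
Proof.
(* The sum is detached from [DD] so that its index list can vary in the induction. *)
suff : exists N A A',
  [/\ lop (@GL R p.+1) (@GL R p.+2) (@embG R p.+1) N A,
      lop (@GL R p.+1) (@GL R p.+2) (@embG R p.+1) N A' &
  forall f g, csmooth (@GL R p.+2) f -> GL g ->
    rcoord c (\sum_(k <- mdegs p l)
      cpderivs (slist k) (fun x => f (embG g *m expNm x)) 0 *: T (Ydh k))
     = A (fun x => Re (f x)) g + A' (fun x => Im (f x)) g].
  move=> [N [A [A' [lA lA' h]]]]; exists N, A, A'; split=> // f g sf Gg.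
  by rewrite DD_sum//; exact: h.
elim: (mdegs p l) => [|k r [N [A [A' [lA lA' h]]]]].
  exists 0%N, (fun _ _ => 0), (fun _ _ => 0); split; [exact: lop_zero|exact: lop_zero|].
  by move=> f g _ _; rewrite big_nil addr0 /rcoord linear0; case: (c.2).
have [B lB hB] := jets_lop (slist k).
pose z := coord (vbasis {:W}) c.1 (T (Ydh k)).
pose a1 := if c.2 then Im z else Re z.
pose a2 := if c.2 then Re z else - Im z.
exists (maxn (size (slist k)) N),
  (fun f x => a1 * B f x + A f x), (fun f x => a2 * B f x + A' f x).
have lB' := lop_mono (leq_maxl _ N) lB.
split.
- apply: lop_add; last exact: lop_mono (leq_maxr _ _) lA.
  exact: (lop_mul oG' (smooth_cst oG' a1) lB').
- apply: lop_add; last exact: lop_mono (leq_maxr _ _) lA'.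
  exact: (lop_mul oG' (smooth_cst oG' a2) lB').
move=> f g sf Gg; rewrite big_cons.
have rD w1 w2 : rcoord c (w1 + w2 : W) = rcoord c w1 + rcoord c w2.
  by rewrite /rcoord linearD; case: (c.2); rewrite ?ReD ?ImD.
rewrite rD h// cpderivsE.
rewrite (hB (fun x => Re (f x)) g sf.1 Gg) (hB (fun x => Im (f x)) g sf.2 Gg).
set X := B _ g; set Y := B _ g.
have -> : rcoord c ((X +i* Y) *: T (Ydh k)) = a1 * X + a2 * Y.
  rewrite /rcoord linearZ /= -/z /a1 /a2.
  case: (c.2); rewrite ?ReM ?ImM /=; ring.
ring.
Qed.

Lemma Ind_csmooth f : I_ f -> csmooth (@GL R p.+2) f.
Proof. by case=> sf _ _; exact/(vsmooth_scalar oG). Qed.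

Lemma DD_Ind f : I_ f -> J_ (DD f).
Proof.
move=> If; split; last by move=> g e g0 t1 t2 y *; exact: DD_equivariant.
  move=> c; have [N [A [A' [lA lA' h]]]] := DD_lop c.
  have [sr si] := Ind_csmooth If.
  apply: (smooth_ext oG' (fun g Gg => esym (h f g (conj sr si) Gg))).
  exact: (smooth_add oG'
    (lop_smooth oG' oG embG_GL (fun i j => smooth_embG i j oG') lA sr)
    (lop_smooth oG' oG embG_GL (fun i j => smooth_embG i j oG') lA' si)).
by move=> g; rewrite /GL /= /DD => /negP/negbTE ->.
Qed.

Lemma DD_linear (a : R[i]) f h : I_ f -> I_ h ->
  DD (fun g => a *: f g + h g) = (fun g => a *: DD f g + DD h g).
Proof.
move=> If Ih; apply/funext => g.
have [Gg|Gg] := boolP (g \in unitmx); last first.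
  by rewrite /DD (negbTE Gg) scaler0 addr0.
have GE := embG_GL Gg.
rewrite !DD_sum// scaler_sumr -big_split /=; apply: eq_bigr => k _.
rewrite scalerA -scalerDl; congr (_ *: _).
exact: (cpderivs_lin (@openT _) a (slist k) (csmooth_coordinates If GE)
   (csmooth_coordinates Ih GE) (I : setT (0 : 'cV[R]_p.+1))).
Qed.

(** Each real coordinate is an operator of finite order along [embG], so its derivatives on K' are
    controlled by finitely many derivatives on the compact image of K'. *)
Lemma DD_continuous f : I_ f ->
  forall (K' : set 'M[R]_p.+1) (k' : nat) (e : R),
    compact K' -> K' `<=` @GL R p.+1 -> 0 < e ->
  exists (K : set 'M[R]_p.+2) (k : nat) (d : R),
    [/\ compact K, K `<=` @GL R p.+2, 0 < d &
    forall h, I_ h -> smooth_close K k d f h -> smooth_close K' k' e (DD f) (DD h)].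
Proof.
move=> If K' k' e cK KG e0.
have se i j := smooth_embG i j oG'.
pose K := @embG R p.+1 @` K'.
have cK2 : compact K.
  apply: continuous_compact => //; apply: continuous_subspaceT.
  exact: continuous_embG.
have KG2 : K `<=` @GL R p.+2 by move=> _ [g Kg <-]; apply: embG_GL; exact: KG.
have [C0 C00 hC0] := smooth_close_parts oG.
have /(_ _)/cid bnd (c : 'I_(\dim {:W}) * bool) : exists NC : nat * R, 0 <= NC.2 /\
  forall h d, I_ h -> 0 <= d -> smooth_close K (k' + NC.1) d f h ->
    forall s x, (size s <= k')%N -> K' x ->
   `|pderivs s (fun y => rcoord c (DD h y)) x - pderivs s (fun y => rcoord c (DD f y)) x|
      <= NC.2 * d.
  have [N [A [A' [lA lA' hA]]]] := DD_lop c.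
  have [C1 C10 hC1] := lop_uniform_bound oG' oG embG_GL se k' cK KG lA.
  have [C2 C20 hC2] := lop_uniform_bound oG' oG embG_GL se k' cK KG lA'.
  exists (N, (C1 + C2) * C0); split; first by rewrite /= mulr_ge0// addr_ge0.
  move=> h d Ih d0 fh s x sk Kx; have Gx := KG x Kx.
  have [fr fi] := Ind_csmooth If; have [hr hi] := Ind_csmooth Ih.
  have [sf _ _] := If; have [sh _ _] := Ih.
  have hd := hC0 f h K _ d sf sh KG2 fh.
  pose ur y := -1 * Re (f y) + Re (h y); pose ui y := -1 * Im (f y) + Im (h y).
  have sur : smooth_on (@GL R p.+2) ur by exact: (smooth_lin oG (-1) fr hr).
  have sui : smooth_on (@GL R p.+2) ui by exact: (smooth_lin oG (-1) fi hi).
  have [sJf _ _] := DD_Ind If; have [sJh _ _] := DD_Ind Ih.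
  rewrite addrC -mulN1r -(pderivs_lin oG' (-1) s (sJf c) (sJh c) Gx).
  have E y : GL y -> -1 * rcoord c (DD f y) + rcoord c (DD h y) = 1 * A ur y + A' ui y.
    move=> Gy; rewrite (hA f y (conj fr fi) Gy) (hA h y (conj hr hi) Gy).
    rewrite /ur /ui (lop_lin oG embG_GL (-1) lA fr hr Gy).
    rewrite (lop_lin oG embG_GL (-1) lA' fi hi Gy); ring.
  rewrite (pderivs_on s oG' E Gx).
  have sA := lop_smooth oG' oG embG_GL se lA sur.
  have sA' := lop_smooth oG' oG embG_GL se lA' sui.
  rewrite (pderivs_lin oG' 1 s sA sA' Gx) mul1r.
  have Cd : 0 <= C0 * d by rewrite mulr_ge0.
  apply: le_trans (ler_normD _ _) _; rewrite -mulrA mulrDl; apply: lerD.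
    apply: (hC1 ur (C0 * d) sur Cd _ s x sk Kx) => t y tk Ky.
    by apply: (hd t (embG y) tk _).1; exists y.
  apply: (hC2 ui (C0 * d) sui Cd _ s x sk Kx) => t y tk Ky.
  by apply: (hd t (embG y) tk _).2; exists y.
pose NC c := projT1 (bnd c).
pose Ct := \sum_c (NC c).2.
have NC0 c : 0 <= (NC c).2 by rewrite /NC; case: (bnd c) => ? [].
have Ct0 : 0 <= Ct by apply: sumr_ge0.
(* [Ct] dominates the constants of all coordinates at once; adding 1 makes the denominator positive
   and the final inequality strict. *)
pose d := e / (Ct + 1).
have d0 : 0 < d by rewrite divr_gt0// ltr_wpDl.
exists K, (k' + \max_c (NC c).1)%N, d; split=> // h Ih fh c s x sk Kx.
have [_ hc] := projT2 (bnd c).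
apply: le_lt_trans (hc h d Ih (ltW d0) _ s x sk Kx) _.
  move=> c' s' y sk'; apply: fh; apply: leq_trans sk' _; rewrite leq_add2l.
  exact: (leq_bigmax c).
apply: (@le_lt_trans _ _ (Ct * d)).
  by rewrite ler_wpM2r ?(ltW d0)// /Ct (bigD1 c)//= lerDl sumr_ge0.
by rewrite /d mulrCA gtr_pMr// ltr_pdivrMr ?ltr_wpDl// mul1r ltrDl.
Qed.

(** If f vanished near diag(g, 1), then for y near g it would vanish at diag(y, 1) exp(x) for all
    small x, and with it all the jets that make up DD f y. *)
Lemma DD_local f : I_ f -> forall g, supp (DD f) g -> supp f (embG g).
Proof.
move=> If g [cg Gg]; split; last exact: embG_GL.
move=> B nB.
have [oB nB'] : nbhs (embG g) (interior B) /\ True by split => //; exact: nbhs_interior.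
have nG : nbhs g (fun y => GL y /\ interior B (embG y)).
  apply: filterI; first by apply: open_nbhs_nbhs; split => //; exact: oG'.
  exact: (continuous_embG oB).
have [y [/= Dy [Gy By]]] := cg _ nG.
apply: contrapT => /forallNP hB; move/eqP : Dy; apply.
rewrite DD_sum// big1// => k _.
rewrite (_ : cpderivs _ _ _ = 0) ?scale0r//.
have -> : (0 : R[i]) = cpderivs (slist k) (fun _ : 'cV[R]_p.+1 => 0 : R[i]) 0.
  elim: (slist k) => [//|ij s IH]; rewrite /= -[RHS]/(cpderiv ij _ 0).
  have -> : cpderivs s (fun _ : 'cV[R]_p.+1 => 0 : R[i]) = fun=> 0.
    elim: s {IH} => [//|ij' s IH]; rewrite /= IH; apply/funext => z; exact: cpderiv_cst.
  by rewrite cpderiv_cst.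
apply: cpderivs_near_eq.
have cA : {for (0 : 'cV[R]_p.+1), continuous (fun x => embG y *m expNm x)}.
  apply: mx_continuous => i j.
  have s : smooth_on setT (fun x : 'cV[R]_p.+1 => (embG y *m expNm x) i j).
    under eq_fun do rewrite mxE; apply: (smooth_bigsum openT) => a.
    exact: (smooth_mul openT (smooth_cst openT _) (smooth_expNm a j openT)).
  exact: smooth_continuous s I.
have n0 : nbhs (embG y *m expNm (0 : 'cV[R]_p.+1)) B.
  have -> : embG y *m expNm (0 : 'cV[R]_p.+1) = embG y.
    suff -> : expNm (0 : 'cV[R]_p.+1) = 1%:M by rewrite mulmx1.
    by rewrite /expNm -scalar_mx_block.
  exact: By.
have n1 : \forall x \near (0 : 'cV[R]_p.+1), B (embG y *m expNm x) by exact: cA.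
apply: filterS n1 => x Bx; apply: contrapT => fx; apply: (hB (embG y *m expNm x)).
by split=> //=; apply/eqP.
Qed.

Lemma DD_intertwining f h : I_ f -> GL h ->
  DD (ltransl (embG h) f) = ltransl h (DD f).
Proof.
move=> If Gh; apply/funext => g; rewrite /ltransl /DD.
have -> : (invmx h *m g \in unitmx) = (g \in unitmx).
  by rewrite unitmx_mul unitmx_inv (_ : (h \in unitmx) = true).
case: ifP => // _; congr (T (opD m l _ 0)); apply/funext => x.
by rewrite embGM embG_inv// mulmxA.
Qed.

Lemma DD_chart f x : I_ f -> DD f (expNm x) = T (opD m l (fun y => f (expNm y)) x).
Proof.
move=> If; rewrite /DD (_ : (expNm x \in unitmx) = true); last exact: GL_expNm.
rewrite (opD_translate m l (fun y => f (expNm y)) x).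
congr (T (opD m l _ 0)); apply/funext => y.
(* N_- is abelian: exp(x) exp(y) = exp(x + y). *)
rewrite embG_expNm; congr f; rewrite /expNm (@mulmx_block R 1 p.+1 1 p.+1 1 p.+1).
by rewrite !mulmx1 !mul1mx !mulmx0 !mul0mx !addr0 !add0r.
Qed.

Lemma DD_Diff : Diff I_ J_ DD.
Proof.
split; [exact: DD_Ind|exact: DD_linear|exact: DD_continuous|exact: DD_local|].
exact: DD_intertwining.
Qed.

End Existence.

(** * Operators as functionals on jets *)

Section TaylorRemainder.
Variables (R : realType) (q : nat).
Local Notation V := 'cV[R]_q.
Local Notation oT := (@openT V).
Implicit Types (phi : V -> R) (x : V).

Definition box : set V := [set x | forall j, `|x j ord0| <= 1].

Lemma box_compact : compact box.
Proof.
have c := @rV_compact R q (fun=> `[-1, 1]%classic) (fun=> @segment_compact R (-1) 1).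
have ct : continuous (fun v : 'rV[R]_q => v^T).
  move=> v; apply: mx_continuous => i j.
  have sv : smooth_on setT (fun v : 'rV[R]_q => v^T i j).
    under eq_fun do rewrite mxE; exact: smooth_coord openT _ _.
  exact: smooth_continuous sv I.
have := continuous_compact (continuous_subspaceT ct) c.
congr compact; apply/seteqP; split=> [_ [v hv <-] j|x hx].
  by rewrite mxE ler_norml; have := hv j; rewrite /= in_itv.
exists x^T; last by rewrite trmxK.
by move=> j; rewrite /= in_itv /= mxE -ler_norml; exact: hx.
Qed.

Lemma derive_coord phi x y : smooth_on setT phi ->
  'D_x phi y = \sum_j x j ord0 * pderiv (j, ord0) phi y.
Proof.
move=> sp; have dp := smooth_is_diff oT sp (I : setT y).
rewrite deriveE// diff_val (reindex (fun j : 'I_q => (j, ord0 : 'I_1))) //=.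
exists (fun ij : 'I_q * 'I_1 => ij.1) => [j _|[i j] _]; first by [].
by rewrite /= (ord1 j).
Qed.

(** A derivative of order M + 1 - r vanishes to order r at 0: the mean value theorem between 0 and t
    x gains one power of t at each step of the induction on [r]. *)
Lemma taylor_bound phi M r s : smooth_on setT phi ->
  (forall s, (size s <= M)%N -> pderivs s phi 0 = 0) ->
  (size s + r = M.+1)%N ->
  exists2 C : R, 0 <= C & forall t x, `|t| <= 1 -> box x ->
    `|pderivs s phi (t *: x)| <= C * `|t| ^+ r.
Proof.
move=> sp h0; elim: r s => [|r IH] s sr.
  have [C C0 hC] := smooth_bounded box_compact (subsetT box) (smooth_pderivs s sp).
  exists C => // t x t1 bx; rewrite expr0 mulr1; apply: hC => j.
  by rewrite mxE normrM mulr_ile1.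
have /(_ _)/cid2 D (j : 'I_q) := IH ((j, ord0) :: s) (etrans (addSnnS _ _) sr).
pose C j := s2val (D j).
have C0 j : 0 <= C j by rewrite /C; case: (D j).
exists (\sum_j C j); first exact: sumr_ge0.
move=> t x t1 bx.
have ss := smooth_pderivs s sp.
have [|c ct] := @line_mvt R V (pderivs s phi) 0 x t.
  move=> c _; have dp := smooth_is_diff oT ss (I : setT (0 + c *: x)).
  exact: diff_derivable.
have sM : (size s <= M)%N by rewrite -ltnS -sr -addSnnS leq_addr.
rewrite !add0r (h0 s sM) subr0 => ->.
rewrite derive_coord// normrM exprS mulrCA ler_wpM2l//.
apply: le_trans (ler_norm_sum _ _ _) _; rewrite mulr_suml; apply: ler_sum => j _.
rewrite normrM.
have c1 : `|c| <= 1 by exact: le_trans t1.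
have hj : `|pderivs ((j, ord0) :: s) phi (c *: x)| <= C j * `|c| ^+ r.
  by rewrite /C; case: (D j) => Cj Cj0 /= hC; exact: hC.
apply: (@le_trans _ _ (1 * (C j * `|c| ^+ r))).
  by apply: ler_pM => //; exact: bx.
by rewrite mul1r ler_wpM2l// lerXn2r// nnegrE.
Qed.

Lemma pderivs_dilation phi (t : R) s x : smooth_on setT phi ->
  pderivs s (fun y => phi (t *: y)) x = t ^+ size s * pderivs s phi (t *: x).
Proof.
move=> sp; elim: s x => [|ij s IH] x; first by rewrite mul1r.
have sd i j : smooth_on setT (fun y : V => (t *: y) i j).
  under eq_fun do rewrite mxE.
  exact: (smooth_mul oT (smooth_cst oT _) (smooth_coord oT _ _)).
have ss := smooth_pderivs s sp.
have sp2 := smooth_pull oT oT ss (fun _ _ => I) sd.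
have -> : pderivs (ij :: s) (fun y => phi (t *: y)) x =
    pderiv ij (fun y => t ^+ size s * pderivs s phi (t *: y)) x.
  exact: (pderiv_on ij oT (fun y _ => IH y) I).
rewrite (pderiv_mul ij (smooth_cst oT _) sp2 I) pderiv_cst mulr0 addr0.
rewrite (pderiv_pull ij oT ss (fun _ _ => I) sd I) (bigD1 ij)// big1 => [|kl kn].
  have -> : pderiv ij (fun y : V => (t *: y) ij.1 ij.2) x = t.
    have -> : (fun y : V => (t *: y) ij.1 ij.2) = (fun y => t * y ij.1 ij.2).
      by apply/funext => y; rewrite mxE.
    rewrite (pderiv_mul ij (smooth_cst oT t) (smooth_coord oT _ _) I).
    by rewrite pderiv_cst pderiv_coord -surjective_pairing eqxx mulr0 addr0 mulr1.
  by rewrite /= addr0 exprSr mulrA.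
have -> : (fun y : V => (t *: y) kl.1 kl.2) = (fun y => t * y kl.1 kl.2).
  by apply/funext => y; rewrite mxE.
rewrite (pderiv_mul ij (smooth_cst oT t) (smooth_coord oT _ _) I).
rewrite pderiv_cst pderiv_coord -surjective_pairing.
by case/andP: kn => _ /negbTE ->; rewrite !mulr0 addr0 mul0r.
Qed.

(** A derivative of order j of the dilated function carries t^j from the chain rule and t^(M + 1 -
    j) from [taylor_bound], hence the same power for all j up to k. *)
Lemma dilation_bound phi M k : smooth_on setT phi -> (k <= M)%N ->
  (forall s, (size s <= M)%N -> pderivs s phi 0 = 0) ->
  exists2 B : R, 0 <= B & forall t s x, 0 <= t -> t <= 1 -> (size s <= k)%N -> box x ->
    `|pderivs s (fun y => phi (t *: y)) x| <= B * t ^+ M.+1.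
Proof.
move=> sp kM h0.
have ex (s : seq ('I_q * 'I_1)) : exists C : R, 0 <= C /\ ((size s <= k)%N ->
    forall t x, `|t| <= 1 -> box x ->
    `|pderivs s phi (t *: x)| <= C * `|t| ^+ (M.+1 - size s)).
  case: (leqP (size s) k) => [sk|_]; last by exists 0.
  have sM : (size s <= M.+1)%N by apply: leq_trans sk _; exact: leqW.
  have [C C0 hC] := taylor_bound sp h0 (subnKC sM).
  by exists C.
have /(_ _)/cid D := ex; pose C s := projT1 (D s).
have C0 s : 0 <= C s by rewrite /C; case: (D s) => ? [].
(* There are finitely many lists of length at most [k], and the sum of their constants dominates
   each of them. *)
exists (\sum_(n < k.+1) \sum_(u : n.-tuple ('I_q * 'I_1)) C u).
  by apply: sumr_ge0 => n _; apply: sumr_ge0.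
move=> t s x t0 t1 sk bx.
have hC : C s <= \sum_(n < k.+1) \sum_(u : n.-tuple ('I_q * 'I_1)) C u.
  have sk' : (size s < k.+1)%N by [].
  rewrite (bigD1 (Ordinal sk'))//= (bigD1 (in_tuple s))//= -addrA lerDl.
  by rewrite addr_ge0 ?sumr_ge0// => n _; apply: sumr_ge0.
rewrite pderivs_dilation// normrM normrX ger0_norm//.
apply: (@le_trans _ _ (t ^+ size s * (C s * t ^+ (M.+1 - size s)))).
  rewrite ler_wpM2l ?exprn_ge0//.
  have [_ /(_ sk) h] := projT2 (D s).
  by have := h t x; rewrite (ger0_norm t0) => /(_ t1 bx).
rewrite mulrCA -exprD subnKC; last by apply: leq_trans sk _; exact: leqW.
by rewrite ler_wpM2r// exprn_ge0.
Qed.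

End TaylorRemainder.

(** * Taylor polynomials in x' and x_n *)

Section TaylorPolynomial.
Variables (R : realType) (p : nat).
Local Notation V := 'cV[R]_p.+1.
Local Notation oT := (@openT V).
Local Notation wd := (widen_ord (leqnSn p)).
Local Notation en := (ord_max : 'I_p.+1, ord0 : 'I_1).
Implicit Types (x : V) (k : multinom p).

Definition lastpow m (G : 'cV[R]_p -> R[i]) : V -> R[i] :=
  fun x => (x ord_max ord0)%:C ^+ m * G (resx x).

Lemma wd_max j : (wd j == ord_max) = false.
Proof. by apply/negbTE; rewrite -val_eqE /= neq_ltn ltn_ord. Qed.

Lemma last_first_dir (t : R) j x :
  (t *: delta_mx (wd j) ord0 + x) ord_max ord0 = x ord_max ord0.
Proof. by rewrite !mxE eq_sym wd_max mulr0 add0r. Qed.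

Lemma resx_first_dir (t : R) j x :
  resx (t *: delta_mx (wd j) ord0 + x) = t *: delta_mx j ord0 + resx x.
Proof.
apply/matrixP => i z; rewrite !mxE (ord1 z) !eqxx !andbT.
have -> : (wd i == wd j) = (i == j) by rewrite -!val_eqE.
by [].
Qed.

Lemma resx_last_dir (t : R) x : resx (t *: delta_mx ord_max ord0 + x) = resx x.
Proof. by apply/matrixP => i z; rewrite !mxE wd_max mulr0 add0r. Qed.

Lemma csmooth_lastpow m G : csmooth setT G -> csmooth setT (lastpow m G).
Proof.
move=> sG; apply: (csmooth_mul oT).
  elim: m => [|m IH]; first by under eq_fun do rewrite expr0; exact: (csmooth_cst oT 1).
  under eq_fun do rewrite exprS.
  exact: (csmooth_mul oT (csmooth_real oT (smooth_coord oT _ _)) IH).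
apply: (csmooth_pull oT (@openT 'cV[R]_p) sG (fun _ _ => I)) => i j.
by under eq_fun do rewrite mxE; exact: (smooth_coord oT).
Qed.

Lemma cpderivs_lastpow_first m G s x : csmooth setT G ->
  cpderivs (wlist s) (lastpow m G) x = lastpow m (cpderivs s G) x.
Proof.
move=> sG; elim: s x => [//|[j z] s IH] x.
rewrite (ord1 z) /= (_ : cpderivs (wlist s) _ = lastpow m (cpderivs s G)); last exact/funext.
have sGs := csmooth_cpderivs s sG.
have oTp := @openT 'cV[R]_p.
rewrite (@cpderiv_line_eq _ _ _ _ _ _
   (fun y => (x ord_max ord0)%:C ^+ m * cpderivs s G y + 0) _ (j, ord0) x (resx x)); last first.
  by move=> t; rewrite addr0 /lastpow [X in X%:C](last_first_dir t j x) resx_first_dir.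
rewrite (cpderiv_lin oTp _ _ sGs (csmooth_cst oTp 0) I) cpderiv_cst addr0.
by [].
Qed.

(** For n > m the falling factorial is 0, so the truncated exponent m - n does no harm. *)
Lemma cpderivs_lastpow_last m n G x : csmooth setT G ->
  cpderivs (nseq n en) (lastpow m G) x = (m ^_ n)%:R * lastpow (m - n) G x.
Proof.
move=> sG; elim: n x => [|n IH] x; first by rewrite ffactn0 mul1r subn0.
rewrite [LHS](@cpderivs_on _ _ _ _ oT _ _ [:: en] (fun y _ => IH y) x I) /=.
have sL := csmooth_lastpow (m - n) sG.
rewrite (cpderiv_mul oT en (csmooth_cst oT _) sL I) cpderiv_cst mulr0 addr0.
have dpow r : cpderiv en (lastpow r G) x = r%:R * lastpow r.-1 G x.
  case: r => [|r].
    rewrite mul0r -[RHS](cpderiv_cst (G (resx x)) en x); apply: cpderiv_line_eq => t.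
    by rewrite /lastpow !expr0 !mul1r resx_last_dir.
  elim: r => [|r IHr].
    rewrite mul1r /lastpow expr0 mul1r.
    rewrite (@cpderiv_line_eq _ _ _ _ _ _
      (fun y : V => G (resx x) * (y ord_max ord0)%:C) _ en x x).
      have sc := csmooth_real oT (smooth_coord oT (ord_max : 'I_p.+1) (ord0 : 'I_1)).
      rewrite (cpderiv_mul oT en (csmooth_cst oT _) sc I) cpderiv_cst mulr0 addr0.
      by rewrite cpderiv_real pderiv_coord eqxx mulr1.
    by move=> t; rewrite expr1 mulrC resx_last_dir.
  have sc := csmooth_real oT (smooth_coord oT (ord_max : 'I_p.+1) (ord0 : 'I_1)).
  have -> : lastpow r.+2 G = (fun y => (y ord_max ord0)%:C * lastpow r.+1 G y).
    by apply/funext => y; rewrite /lastpow exprS mulrA.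
  rewrite (cpderiv_mul oT en sc (csmooth_lastpow _ sG) I) IHr.
  rewrite cpderiv_real pderiv_coord eqxx mulr1 /= mulrCA.
  have -> : (x ord_max ord0)%:C * lastpow r G x = lastpow r.+1 G x.
    by rewrite /lastpow exprS mulrA.
  by rewrite -[in RHS]natr1 mulrDl mul1r.
by rewrite dpow mulrA -natrM -ffactnSr subnS.
Qed.

Definition mono m l (Q : dhomog p R[i] l) : V -> R[i] := lastpow m (polyfun Q).

Lemma csmooth_mono m l (Q : dhomog p R[i] l) : csmooth setT (mono m Q).
Proof. exact: csmooth_lastpow (csmooth_polyfun _). Qed.

Lemma mono_jet m l (Q : dhomog p R[i] l) n k :
  cpderivs (slist n k) (mono m Q) 0 =
  (m == n)%:R * (m`!%:R * (mcoeff k Q * (mfact k)%:R)).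
Proof.
have sQ := csmooth_polyfun (mpoly_of_dhomog Q).
rewrite /slist cpderivs_cat.
rewrite (_ : cpderivs (wlist _) _ = lastpow m (cpderivs (mlist k) (polyfun Q))); last first.
  by apply/funext => x; exact: cpderivs_lastpow_first.
rewrite (cpderivs_lastpow_last m n 0 (csmooth_cpderivs (mlist k) sQ)).
have r0 : resx (0 : V) = 0 by apply/matrixP => i j; rewrite !mxE.
rewrite /lastpow r0 cpderivs_polyfun0 mxE.
have [->|mn] := eqVneq m n; first by rewrite ffactnn subnn expr0 !mul1r.
rewrite mul0r; case: (ltngtP m n) mn => // mn _.
  by rewrite ffact_small// mul0r.
by rewrite expr0n subn_eq0 leqNgt mn mul0r mulr0.
Qed.

Lemma mcoeff_opD U m l (F : V -> R[i]) k : open U -> csmooth U F -> U 0 ->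
  mcoeff k (opD m l F 0) * (mfact k)%:R = (mdeg k == l)%:R * cpderivs (slist m k) F 0.
Proof.
move=> oU sF U0; have -> : (opD m l F 0 : mpoly p R[i]) =
    \sum_(j <- mdegs p l) cpderivs (slist m j) F 0 *: ytilde R j.
  rewrite /= /opD_mpoly.
  rewrite (@sum_mdegs p _ l (fun k => dlast m (dfirst k F) (embx 0) *: ytilde R k)).
  by apply: eq_bigr => j _; rewrite dlastE dfirstE -cpderivs_cat embx0.
rewrite raddf_sum /=.
have E j : mcoeff k (cpderivs (slist m j) F 0 *: ytilde R j) * (mfact k)%:R
     = (j == k)%:R * cpderivs (slist m k) F 0.
  rewrite mcoeffZ ytildeE mcoeffZ mcoeffX; have [->|_] := eqVneq j k.
    by rewrite mulr1 mul1r divfK// mfact_neq0.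
  by rewrite !mulr0 !mul0r.
rewrite mulr_suml (eq_bigr _ (fun j _ => E j)) -mulr_suml; congr (_ * _).
have [kl|kl] := boolP (mdeg k == l).
  have kin : k \in mdegs p l by rewrite mem_mdegs.
  rewrite (bigD1_seq k)//= ?mdegs_uniq// eqxx big1 ?addr0// => j /negbTE jk.
  by rewrite jk.
rewrite big_seq big1// => j; rewrite mem_mdegs => /eqP jl.
by case: eqP => // jk; rewrite -jk jl eqxx in kl.
Qed.

(** Both degrees run up to [M] independently, so terms of total degree above [M] occur as well; the
    index set is then a product, and the derivatives of order up to [M] are still matched. *)
Definition taylor M (psi : V -> R[i]) : V -> R[i] := fun x =>
  \sum_(m < M.+1) \sum_(l < M.+1) (m`!%:R)^-1 * mono m (opD m l psi 0) x.

Lemma csmooth_taylor M psi : csmooth setT (taylor M psi).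
Proof.
apply: (csmooth_bigsum oT) => m; apply: (csmooth_bigsum oT) => l.
exact: (csmooth_mul oT (csmooth_cst oT _) (csmooth_mono _ _)).
Qed.

Lemma cpderivs_sum0 (J : Type) (r : seq J) (F : J -> V -> R[i]) s x :
  (forall j, csmooth setT (F j)) ->
  cpderivs s (fun y => \sum_(j <- r) F j y) x = \sum_(j <- r) cpderivs s (F j) x.
Proof.
move=> sF; elim: r => [|j r IH].
  have -> : (fun y : V => \sum_(j <- [::]) F j y) = fun=> 0.
    by apply/funext => y; rewrite big_nil.
  rewrite big_nil; suff -> : cpderivs s (fun _ : V => 0 : R[i]) = fun=> 0 by [].
  elim: s => [//|ij s IH]; rewrite /= IH; apply/funext => y; exact: cpderiv_cst.
have -> : (fun y => \sum_(j <- j :: r) F j y) =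
    fun y => 1 * F j y + \sum_(j <- r) F j y.
  by apply/funext => y; rewrite big_cons mul1r.
by rewrite (cpderivs_lin oT 1 s (sF j) (csmooth_bigsum oT r xpredT sF) I) big_cons IH mul1r.
Qed.

Lemma perm_slist (s : seq ('I_p.+1 * 'I_1)) : exists m k,
  perm_eq s (slist m k) /\ (m + mdeg k = size s)%N.
Proof.
elim: s => [|[i z] s [m [k [IH sk]]]].
  exists 0%N, mnm0; split; last by rewrite mdeg0.
  by rewrite /slist mlist0.
rewrite (ord1 z); have [[j ->]|->] := ord_widenP i.
  exists m, (mnm_add k (mnm1 j)); split; last first.
    by rewrite mdegD mdeg1 addnA sk addn1.
  have := perm_mlist_shift k j => /(perm_map (fun ij : 'I_p * 'I_1 => (wd ij.1, ij.2))) /= h.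
  apply: (@perm_trans _ ((wd j, ord0) :: slist m k)); first by rewrite perm_cons.
  rewrite /slist -cat1s perm_catCA perm_cat2l /= perm_sym; exact: h.
exists m.+1, k; split; last by rewrite addSn sk.
by rewrite /slist /= perm_cons.
Qed.

Lemma taylor_vanish M (psi : V -> R[i]) s : csmooth setT psi -> (size s <= M)%N ->
  cpderivs s (fun x => -1 * taylor M psi x + psi x) 0 = 0.
Proof.
move=> sp sM; have [m [k [sk mk]]] := perm_slist s.
have sd := csmooth_lin oT (-1) (csmooth_taylor M psi) sp.
rewrite (cpderivs_perm oT sd (I : setT (0 : V)) sk).
rewrite (cpderivs_lin oT (-1) _ (csmooth_taylor M psi) sp I) mulN1r.
suff -> : cpderivs (slist m k) (taylor M psi) 0 = cpderivs (slist m k) psi 0 by rewrite addNr.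
have sm (m' : 'I_M.+1) (l' : 'I_M.+1) :
    csmooth setT (fun x => (m'`!%:R)^-1 * mono m' (opD m' l' psi 0) x).
  exact: (csmooth_mul oT (csmooth_cst oT _) (csmooth_mono _ _)).
rewrite /taylor cpderivs_sum0 => [|m']; last first.
  by apply: (csmooth_bigsum oT) => l'; exact: sm.
have mM : (m < M.+1)%N by rewrite ltnS (leq_trans _ sM)// -mk leq_addr.
have kM : (mdeg k < M.+1)%N by rewrite ltnS (leq_trans _ sM)// -mk leq_addl.
have E (m' l' : 'I_M.+1) :
    cpderivs (slist m k) (fun x => (m'`!%:R)^-1 * mono m' (opD m' l' psi 0) x) 0 =
    (m' == m :> nat)%:R * ((mdeg k == l')%:R * cpderivs (slist m' k) psi 0).
  have := cpderivs_lin oT (m'`!%:R)^-1 (slist m k)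
    (csmooth_mono m' (opD m' l' psi 0)) (csmooth_cst oT 0) (I : setT (0 : V)).
  have z : cpderivs (slist m k) (fun _ : V => 0 : R[i]) = fun=> 0.
    elim: (slist m k) => [//|ij s' IH]; rewrite /= IH; apply/funext => y; exact: cpderiv_cst.
  rewrite z addr0 (_ : (fun y => _ * _ + 0) = (fun x => (m'`!%:R)^-1 * mono m' (opD m' l' psi 0) x)).
    move=> ->; rewrite mono_jet (mcoeff_opD m' l' k oT sp I) mulrCA; congr (_ * _).
    by rewrite mulrA mulVf ?mul1r// pnatr_eq0 -lt0n fact_gt0.
  by apply/funext => y; rewrite addr0.
rewrite (bigD1 (Ordinal mM))//= [X in _ + X]big1 ?addr0 => [|m' mm']; last first.
  rewrite cpderivs_sum0 => [|l']; last exact: sm.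
  rewrite big1// => l' _; rewrite E.
  by rewrite -[m' == m :> nat]/(m' == Ordinal mM) (negbTE mm') mul0r.
rewrite cpderivs_sum0 => [|l']; last exact: (sm (Ordinal mM)).
rewrite (bigD1 (Ordinal kM))//= big1 ?addr0 => [|l' ll'].
  by rewrite (E (Ordinal mM) (Ordinal kM)) /= !eqxx !mul1r.
rewrite (E (Ordinal mM)) /= eqxx mul1r.
by rewrite (_ : (mdeg k == l') = false) ?mul0r//; apply/negbTE; rewrite eq_sym.
Qed.

End TaylorPolynomial.

(** * Continuity of the extension of germs *)

Section ScalarBounds.
Variables (R : realType) (p : nat).
Local Notation q := p.+1.
Local Notation Re := (@complex.Re R).
Local Notation Im := (@complex.Im R).
Variables (alpha : bool * bool) (lam : R[i] * R[i]).
Local Notation cut := (cut (q := q) alpha lam).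

Lemma rcoord_scalar (z : R[i]) c : rcoord c (z : R[i]^o) =
  rcoord c (1 : R[i]^o) * Re z + rcoord c (0 +i* 1 : R[i]^o) * Im z.
Proof.
have sc (w : R[i]) : coord (vbasis {:R[i]^o}) c.1 (w : R[i]^o) =
    w * coord (vbasis {:R[i]^o}) c.1 (1 : R[i]^o).
  by rewrite -{1}[w]mulr1 -[w * 1]/(w *: (1 : R[i]^o)) linearZ.
by rewrite /rcoord (sc z) (sc (0 +i* 1)); case: c.2; rewrite ?ReM ?ImM /=; ring.
Qed.

Lemma cell_part_compact (K : set 'M[R]_q.+1) : compact K -> K `<=` @GL R q.+1 ->
  compact (K `&` [set g | nsq (col0 g) <= corner g ^+ 2]).
Proof.
move=> cK KU; apply: compact_closedI => //.
have -> : [set g : 'M[R]_q.+1 | nsq (col0 g) <= corner g ^+ 2] =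
    (fun g => corner g ^+ 2 - nsq (col0 g)) @^-1` [set t | 0 <= t].
  by apply/seteqP; split => g /=; rewrite subr_ge0.
have oT := @openT 'M[R]_q.+1.
have sF : smooth_on setT (fun g : 'M[R]_q.+1 => corner g ^+ 2 - nsq (col0 g)).
  apply: (smooth_sub_fun oT).
    exact: (smooth_mul oT (smooth_corner oT) (smooth_corner oT)).
  exact: (smooth_pull oT (@openT 'cV[R]_q) (smooth_nsq (@openT 'cV[R]_q))
    (fun _ _ => I) (fun i j => smooth_col0 i j oT)).
apply: closed_comp; last exact: closed_ge.
by move=> g _; exact: (smooth_continuous sF (I : setT g)).
Qed.

(** Where x has norm at most 1, [cut] is a smooth coefficient times the germ composed with [xcoord],
    that is, an operator of order 0; elsewhere it vanishes on an open set. The constant does not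
    depend on the germ. *)
Lemma cut_uniform_bound (K : set 'M[R]_q.+1) k : compact K -> K `<=` @GL R q.+1 ->
  exists2 C : R, 0 <= C & forall psi (e : R), csmooth setT psi -> 0 <= e ->
    (forall s x, (size s <= k)%N -> box x ->
      `|pderivs s (fun y => Re (psi y)) x| <= e /\
      `|pderivs s (fun y => Im (psi y)) x| <= e) ->
    forall c s g, (size s <= k)%N -> K g ->
      `|pderivs s (fun y => rcoord c (cut psi y)) g| <= C * e.
Proof.
move=> cK KU.
(* The closed condition keeps this part compact, and the rest of K lies in the open set [far]. *)
pose K1 := K `&` [set g : 'M[R]_q.+1 | nsq (col0 g) <= corner g ^+ 2].
have cK1 : compact K1 by exact: cell_part_compact.
have K1c : K1 `<=` @cell R q.
  move=> g [Kg h]; have [//|[_]] := GL_cell_far (KU g Kg).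
  by move=> /lt_le_trans /(_ h); rewrite ltxx.
have oC := @open_cell R q; have oV := @openT 'cV[R]_q.
have sx i j := @smooth_xcoord R q i j.
have boxK g : K1 g -> box (xcoord g).
  move=> K1g j; have [Gg a0] := K1c g K1g; case: K1g => _ /= h.
  have : nsq (xcoord g) <= 1.
    by rewrite /xcoord nsqZ exprVn mulrC ler_pdivrMr ?mul1r// exprn_even_gt0.
  move=> /(le_trans (nsq_ent (xcoord g) j)).
  by rewrite -real_normK ?num_real// expr_le1.
have [sRe sIm] := @csmooth_coef R q alpha lam.
have B c : exists2 C : R, 0 <= C & forall psi (e : R), csmooth setT psi -> 0 <= e ->
    (forall s x, (size s <= k)%N -> box x ->
      `|pderivs s (fun y => Re (psi y)) x| <= e /\
      `|pderivs s (fun y => Im (psi y)) x| <= e) ->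
    forall s g, (size s <= k)%N -> K1 g ->
      `|pderivs s (fun y => rcoord c (cut psi y)) g| <= C * e.
  pose a1 (g : 'M[R]_q.+1) := rcoord c (1 : R[i]^o) * Re (coef alpha lam g) + rcoord c (0 +i* 1 : R[i]^o) * Im (coef alpha lam g).
  pose a2 (g : 'M[R]_q.+1) := rcoord c (0 +i* 1 : R[i]^o) * Re (coef alpha lam g) - rcoord c (1 : R[i]^o) * Im (coef alpha lam g).
  have s1 : smooth_on (@cell R q) a1.
    exact: (smooth_add oC (smooth_mul oC (smooth_cst oC _) sRe) (smooth_mul oC (smooth_cst oC _) sIm)).
  have s2 : smooth_on (@cell R q) a2.
    exact: (smooth_sub_fun oC (smooth_mul oC (smooth_cst oC _) sRe) (smooth_mul oC (smooth_cst oC _) sIm)).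
  have [C1 C10 h1] := lop_uniform_bound oC oV (fun x _ => I) sx k cK1 K1c
    (lop_gen setT (@xcoord R q) s1 (leqnn (size (Nil ('I_q * 'I_1))))).
  have [C2 C20 h2] := lop_uniform_bound oC oV (fun x _ => I) sx k cK1 K1c
    (lop_gen setT (@xcoord R q) s2 (leqnn (size (Nil ('I_q * 'I_1))))).
  exists (C1 + C2); first exact: addr_ge0.
  move=> psi e [sp1 sp2] e0 hb s g sk K1g; have Cg := K1c g K1g.
  have E y : cell y -> rcoord c (cut psi y) =
      a1 y * Re (psi (xcoord y)) + a2 y * Im (psi (xcoord y)).
    move=> Cy; rewrite (cut_cell alpha lam psi Cy) rcoord_scalar.
    rewrite (ReM (coef alpha lam y)) (ImM (coef alpha lam y)) /a1 /a2.
    move: (rcoord c (1 : R[i]^o)) (rcoord c (0 +i* 1 : R[i]^o)) => r1 r2.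
    move: (Re (coef alpha lam y)) (Im (coef alpha lam y)) => u1 u2. ring.
  rewrite (pderivs_on s oC E Cg).
  have sp1' : smooth_on (@cell R q) (fun y => a1 y * Re (psi (xcoord y))).
    exact: (smooth_mul oC s1 (smooth_pull oC oV sp1 (fun _ _ => I) sx)).
  have sp2' : smooth_on (@cell R q) (fun y => a2 y * Im (psi (xcoord y))).
    exact: (smooth_mul oC s2 (smooth_pull oC oV sp2 (fun _ _ => I) sx)).
  have -> : (fun y => a1 y * Re (psi (xcoord y)) + a2 y * Im (psi (xcoord y))) =
      (fun y => 1 * (a1 y * Re (psi (xcoord y))) + a2 y * Im (psi (xcoord y))).
    by apply/funext => y; rewrite mul1r.
  rewrite (pderivs_lin oC 1 s sp1' sp2' Cg) mul1r mulrDl.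
  apply: le_trans (ler_normD _ _) (lerD _ _).
    apply: (h1 _ e sp1 e0 _ s g sk K1g) => s' x' /=; rewrite addn0 => sk' K'x.
    exact: (hb _ _ sk' (boxK _ K'x)).1.
  apply: (h2 _ e sp2 e0 _ s g sk K1g) => s' x' /=; rewrite addn0 => sk' K'x.
  exact: (hb _ _ sk' (boxK _ K'x)).2.
have [Cf hC] := choice (fun c => let: ex_intro2 x a b := B c in
  ex_intro (fun C : R => 0 <= C /\ _) x (conj a b)).
exists (\sum_c Cf c); first by apply: sumr_ge0 => c _; exact: (hC c).1.
move=> psi e sp e0 hb c s g sk Kg.
have [h|h] := leP (nsq (col0 g)) (corner g ^+ 2).
  apply: le_trans ((hC c).2 psi e sp e0 hb s g sk (conj Kg h)) _.
  by rewrite ler_wpM2r// (bigD1 c)//= lerDl; apply: sumr_ge0 => c' _; exact: (hC c').1.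
have Fg : @far R q g by split; [exact: KU|].
have z y : @far R q y -> rcoord c (cut psi y) = (fun=> 0) y.
  move=> [_ fy]; have -> : cut psi y = 0.
    apply: cut_far => -[[_ a0]].
    rewrite /xcoord nsqZ exprVn mulrC ltr_pdivrMr ?mul1r; last by rewrite exprn_even_gt0.
    by move=> /(lt_trans fy); rewrite ltxx.
  by rewrite (rcoord_scalar 0) /= !mulr0 addr0.
rewrite (pderivs_on s (@open_far R q) z Fg).
have -> : pderivs s (fun _ : 'M[R]_q.+1 => 0 : R) = fun=> 0.
  by elim: (s) => [//|ij s' IH] /=; rewrite IH; apply/funext => y; exact: pderiv_cst.
rewrite normr0 mulr_ge0//; apply: sumr_ge0 => c' _; exact: (hC c').1.
Qed.

End ScalarBounds.

(** * The functional of an operator at the identity *)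

Section Functional.
Variables (R : realType) (p : nat).
Hypothesis p0 : (0 < p)%N.
Local Notation q := p.+1.
Local Notation Re := (@complex.Re R).
Local Notation Im := (@complex.Im R).
Variables (alpha beta : bool * bool) (lam nu : R[i] * R[i]).
Variables (W : vectType R[i]) (varpi : 'M[R]_p -> 'End(W)).
Hypothesis hvarpi : irr_rep varpi.
Local Notation I_ := (Ind (@triv_rep R p.+1) alpha lam).
Local Notation J_ := (Ind varpi beta nu).
Variable D : ('M[R]_p.+2 -> R[i]^o) -> ('M[R]_p.+1 -> W).
Hypothesis hD : Diff I_ J_ D.
Local Notation oT := (@openT 'cV[R]_q).
Local Notation io := (cut (q := q) alpha lam).
Implicit Types (f h : 'M[R]_p.+2 -> R[i]^o) (psi phi : 'cV[R]_q -> R[i]).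

Definition at_one f : W := D f 1%:M.

Lemma at_one_lin (a : R[i]) f h : I_ f -> I_ h ->
  at_one (fun g => a *: f g + h g) = a *: at_one f + at_one h.
Proof. by move=> If Ih; rewrite /at_one (Diff_linear hD). Qed.

Lemma at_one0 : at_one (fun=> 0) = 0.
Proof.
have := at_one_lin (-1) (Ind_zero _ _ _) (Ind_zero _ _ _).
rewrite (_ : (fun g => _) = fun=> 0); last by apply/funext => g; rewrite scaler0 addr0.
by rewrite scaleN1r addNr.
Qed.

Lemma near_one_xcoord (P : 'cV[R]_q -> Prop) : (\forall x \near (0 : 'cV[R]_q), P x) ->
  \forall g \near (1%:M : 'M[R]_p.+2), cell g /\ P (xcoord g).
Proof.
move=> hP.
have c1 : @cell R q (1%:M : 'M[R]_p.+2).
  split; first by rewrite /GL /= unitmx1.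
  by rewrite /corner mxE eqxx oner_eq0.
have x1 : xcoord (1%:M : 'M[R]_p.+2) = 0 :> 'cV[R]_q.
  by apply/matrixP => i j; rewrite (ord1 j) /xcoord mxE col0E !mxE mulr0.
have co : {for (1%:M : 'M[R]_p.+2), continuous (@xcoord R q)}.
  apply: mx_continuous => i j.
  exact: (smooth_continuous (smooth_xcoord i j) c1).
have n1 : \forall g \near (1%:M : 'M[R]_p.+2), cell g.
  exact: (open_nbhs_nbhs (conj (@open_cell R q) c1)).
have n2 : \forall g \near (1%:M : 'M[R]_p.+2), P (xcoord g).
  by apply: co; rewrite x1.
by apply: filterS2 n1 n2.
Qed.

(** If D f is non-zero at the identity, then by locality the identity is in the support of f, so f
    is non-zero at points whose coordinate x is arbitrarily close to 0. *)
Lemma at_one_local f : I_ f -> (\forall x \near (0 : 'cV[R]_q), f (expNm x) = 0) ->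
  at_one f = 0.
Proof.
move=> If /near_one_xcoord hf; apply/eqP/negP => /negP n0.
have G1 : @GL R p.+1 1%:M by rewrite /GL /= unitmx1.
have /(Diff_local hD If) : supp (D f) 1%:M.
  by split=> //; apply: subset_closure.
rewrite embG1 => -[/(_ _ hf) [g [/= fg [Cg xg]]] _].
have [Gg a0] := Cg.
by move: fg; rewrite (Ind_cell (ltn0Sn _) If Gg a0) xg mulr0 eqxx.
Qed.

Lemma at_one_germ f h : I_ f -> I_ h ->
  (\forall x \near (0 : 'cV[R]_q), f (expNm x) = h (expNm x)) -> at_one f = at_one h.
Proof.
move=> If Ih fh; apply/eqP; rewrite -subr_eq0; apply/eqP.
rewrite addrC -scaleN1r -at_one_lin//; apply: at_one_local; first exact: Ind_lin.
by apply: filterS fh => x ->; rewrite scaleN1r addNr.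
Qed.

Definition germ psi : W := at_one (io psi).

Lemma germ_lin (a : R[i]) psi phi : csmooth setT psi -> csmooth setT phi ->
  germ (fun x => a * psi x + phi x) = a *: germ psi + germ phi.
Proof.
move=> s1 s2; rewrite /germ -at_one_lin; [|exact: cut_Ind..].
congr (at_one _); apply/funext => g; rewrite /cut; case: ifP => _.
  by rewrite /GRing.scale /= mulrDr mulrCA.
by rewrite scaler0 addr0.
Qed.

Lemma germ0 : germ (fun=> 0) = 0.
Proof.
rewrite /germ -[RHS]at_one0; congr (at_one _); apply/funext => g.
by rewrite /cut; case: ifP; rewrite ?mulr0.
Qed.

Lemma germ_chart f : I_ f -> at_one f = germ (fun x => f (expNm x)).
Proof.
move=> If; have sf := csmooth_chart If.
rewrite /germ; apply: (at_one_germ If (cut_Ind (ltn0Sn p) alpha lam sf)).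
by apply: filterS (cut_near alpha lam (fun x => f (expNm x))) => x ->.
Qed.

Lemma germ_near psi phi : csmooth setT psi -> csmooth setT phi ->
  (\forall x \near (0 : 'cV[R]_q), psi x = phi x) -> germ psi = germ phi.
Proof.
move=> s1 s2 h; apply: at_one_germ; [exact: cut_Ind..|].
by apply: filterS h => x hx; rewrite !cut_expNm hx.
Qed.

Section Translate.
Variables (e t1 t2 : R) (g0 : 'M[R]_p) (b : 'rV[R]_p).
Hypotheses (he : e = 1 \/ e = -1) (hg : SLpm g0).
Local Notation P := (elM e g0 *m expH p t1 *m expJ p t2 *m expNp b).

Lemma translate_Ind f : I_ f -> I_ (fun g => f (embG P *m g)).
Proof.
move=> If; have GP := GL_embGP p0 t1 t2 b he hg.
have -> : (fun g => f (embG P *m g)) = ltransl (invmx (embG P)) f.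
  by apply/funext => g; rewrite /ltransl invmxK.
exact: (Ind_ltransl (GL_inv GP) If).
Qed.

Lemma at_one_translate f : I_ f ->
  at_one (fun g => f (embG P *m g)) = ((inducing varpi beta nu e g0 t1 t2)^-1)%VF (at_one f).
Proof.
move=> If; have GP : GL P by apply/GL_embG; exact: (GL_embGP p0 t1 t2 b he hg).
have -> : (fun g => f (embG P *m g)) = ltransl (embG (invmx P)) f.
  by apply/funext => g; rewrite /ltransl embG_inv// invmxK.
rewrite /at_one (Diff_intertwining hD If (GL_inv GP)) /ltransl invmxK.
have [_ _ /(_ 1%:M e g0 t1 t2 b)] := Diff_to hD If.
rewrite mul1mx mulmx1; apply => //.
by rewrite /GL /= unitmx1.
Qed.

End Translate.

(** For t1 = t2 = t the element of A' is diag(exp t, 1, ..., 1), which multiplies all coordinates,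
    x_n included, by exp(-t). *)
Lemma germ_dilation psi t : csmooth setT psi ->
  germ (fun x => psi (expR (- t) *: x))
  = cexp ((lam.1 + lam.2 - nu.1 - nu.2) * t%:C) *: germ psi.
Proof.
move=> sp; have If := cut_Ind (ltn0Sn p) alpha lam sp.
have h1 : (1 : R) = 1 \/ (1 : R) = -1 by left.
have hS : @SLpm R p 1%:M by left; rewrite det1.
have If' := translate_Ind t t (0 : 'rV[R]_p) h1 hS If.
have sd : csmooth setT (fun x => psi (expR (- t) *: x)).
  apply: (csmooth_pull oT oT sp) => // i j.
  apply: (smooth_ext oT (fun (y : 'cV[R]_q) _ => esym (mxE _ _ i j))).
  exact: (smooth_mul oT (smooth_cst oT _) (smooth_coord oT i j)).
have := at_one_translate t t (0 : 'rV[R]_p) h1 hS If.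
rewrite (inducing_invE beta nu t t (at_one (io psi)) (g1 := 1%:M) h1 hS); last first.
- by move=> w; rewrite (irr_rep1 hvarpi) !lfunE.
- by move=> w; rewrite (irr_rep1 hvarpi) !lfunE.
rewrite (irr_rep1 hvarpi) lfunE /= det1 !sgnpow_gt0// mulr1 mul1r -cexpD.
have -> := germ_chart If'.
rewrite (@germ_near _ (fun x => (cexp (- lam.1 * t%:C) * cexp (- lam.2 * t%:C)) * psi (expR (- t) *: x) + 0)).
- rewrite (germ_lin _ sd (csmooth_cst oT 0)) germ0 addr0 -cexpD => E.
  have := congr1 (fun w => cexp ((lam.1 + lam.2) * t%:C) *: w) E.
  rewrite !scalerA -!cexpD (_ : _ + _ = 0); last by ring.
  rewrite cexp0 scale1r => ->; congr (cexp _ *: _); ring.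
- exact: (csmooth_chart If').
- exact: (csmooth_lin oT _ sd (csmooth_cst oT 0)).
have sm : \forall x \near (0 : 'cV[R]_q), nsq (expR (- t) *: x) <= 4^-1.
  have c : {for (0 : 'cV[R]_q), continuous (fun x : 'cV[R]_q => expR (- t) *: x)}.
    exact: scaler_continuous.
  have h : nbhs (expR (- t) *: (0 : 'cV[R]_q)) [set y | nsq y <= 4^-1].
    by rewrite scaler0; exact: (@nsq_near0 R q).
  exact: (c _ h).
apply: filterS sm => x hx.
have h0 : pairing (0 : 'rV[R]_p) (resx x) = 0 by rewrite /pairing mul0mx mxE.
rewrite (Ind_translate p0 If t t h1 hS) ?h0 ?addr0 ?ltr01//.
rewrite ln1 mulr0 cexp0 mulr1.
have -> : Psi 1 t t 1%:M (0 : 'rV[R]_p) x = expR (- t) *: x.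
  rewrite /Psi h0 addr0 invr1 scale1r mulr1 mul1r /cfac subrr mul0r expR0 mulr1 -expRN.
  apply: cVnP => [j|].
    by rewrite !mxE embx_widen scalemx1 mul_scalar_mx !mxE wd_max andFb mulr0 addr0.
  by rewrite !mxE embx_max add0r eqxx mulr1 mulrC.
by rewrite cut_expNm cutoff_near// mul1r /kap det1 !sgnpow_gt0// mulr1 mul1r.
Qed.

(** Continuity is applied only at the zero section, on the compact set {1} and without derivatives;
    linearity turns it into a bound by scaling. *)
Lemma germ_bound : exists k (C : R), 0 <= C /\ forall psi (e : R), csmooth setT psi -> 0 < e ->
  (forall s x, (size s <= k)%N -> box x ->
    `|pderivs s (fun y => Re (psi y)) x| <= e /\
    `|pderivs s (fun y => Im (psi y)) x| <= e) ->
  forall c, `|rcoord c (germ psi)| <= C * e.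
Proof.
have G1 : [set (1%:M : 'M[R]_p.+1)] `<=` @GL R p.+1 by move=> _ ->; rewrite /GL /= unitmx1.
have [K [k [d [cK KU d0 hK]]]] := Diff_continuous hD (Ind_zero _ _ _) 0
  (@compact_set1 _ (1%:M : 'M[R]_p.+1)) G1 (ltr01 : 0 < (1 : R)).
have [C0 C00 hC0] := cut_uniform_bound alpha lam k cK KU.
exists k, (2 * (C0 + 1) / d); split.
  by rewrite divr_ge0// ?mulr_ge0 ?addr_ge0// ltW.
move=> psi e sp e0 hb c.
have C1 : 0 < C0 + 1 by rewrite ltr_wpDl.
(* The scale at which the extension becomes smaller than [d]: C0 a e = d C0 / (2 (C0 + 1)) < d. *)
pose a : R := d / (2 * (C0 + 1) * e).
have a0 : 0 < a by rewrite divr_gt0// !mulr_gt0.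
have sap : csmooth setT (fun x => a%:C * psi x + 0).
  exact: (csmooth_lin oT _ sp (csmooth_cst oT 0)).
have za s (f : 'cV[R]_q -> R) (x : 'cV[R]_q) : smooth_on setT f ->
    pderivs s (fun y => a * f y + 0) x = a * pderivs s f x.
  move=> sf; rewrite (pderivs_lin oT a s sf (smooth_cst oT 0) (I : setT x)).
  have -> : pderivs s (fun _ : 'cV[R]_q => 0 : R) = fun=> 0.
    by elim: (s) => [//|ij s' IH] /=; rewrite IH; apply/funext => y; exact: pderiv_cst.
  by rewrite addr0.
have hba s x : (size s <= k)%N -> box x ->
    `|pderivs s (fun y => Re (a%:C * psi y + 0)) x| <= a * e /\
    `|pderivs s (fun y => Im (a%:C * psi y + 0)) x| <= a * e.
  move=> sk bx; have [b1 b2] := hb s x sk bx.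
  have -> : (fun y => Re (a%:C * psi y + 0)) = (fun y => a * Re (psi y) + 0).
    by apply/funext => y; rewrite ReD ReM /= mul0r subr0.
  have -> : (fun y => Im (a%:C * psi y + 0)) = (fun y => a * Im (psi y) + 0).
    by apply/funext => y; rewrite ImD ImM /= mul0r addr0.
  rewrite (za _ _ _ sp.1) (za _ _ _ sp.2) !(normrM a) (gtr0_norm a0).
  by split; rewrite ler_wpM2l// ltW.
have cl : smooth_close K k d (fun _ : 'M[R]_p.+2 => 0 : R[i]^o) (io (fun x => a%:C * psi x + 0)).
  move=> c' s g sk Kg.
  have -> : pderivs s (fun _ : 'M[R]_p.+2 => rcoord c' (0 : R[i]^o)) g = 0.
    have -> : (fun _ : 'M[R]_p.+2 => rcoord c' (0 : R[i]^o)) = fun=> 0.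
      by apply/funext => _; rewrite (rcoord_scalar 0) /= !mulr0 addr0.
    have -> : pderivs s (fun _ : 'M[R]_p.+2 => 0 : R) = fun=> 0; last by [].
    by elim: (s) => [//|ij s' IH] /=; rewrite IH; apply/funext => y; exact: pderiv_cst.
  rewrite subr0; apply: le_lt_trans (hC0 _ (a * e) sap (ltW (mulr_gt0 a0 e0)) hba c' s g sk Kg) _.
  have -> : C0 * (a * e) = d * (C0 / (2 * (C0 + 1))).
    by rewrite /a; field; rewrite !gt_eqF.
  by rewrite gtr_pMr// ltr_pdivrMr ?mul1r ?mulr_gt0//; lra.
have := hK _ (cut_Ind (ltn0Sn p) alpha lam sap) cl c [::] 1%:M (leqnn 0) erefl.
rewrite /= -/(at_one _) -/(germ _) -/(at_one (fun=> 0)) at_one0.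
rewrite (germ_lin _ sp (csmooth_cst oT 0)) germ0 addr0.
have -> : rcoord c (0 : W) = 0 by rewrite /rcoord linear0; case: c.2.
have -> : rcoord c (a%:C *: germ psi) = a * rcoord c (germ psi).
  by rewrite /rcoord linearZ; case: c.2; rewrite /= ?ReM ?ImM /= mul0r ?addr0 ?subr0.
rewrite subr0 (normrM a) (gtr0_norm a0) mulrC -ltr_pdivlMr// => /ltW /le_trans; apply.
by rewrite /a div1r invf_div mulrAC.
Qed.

Lemma rcoord_eq0 (w : W) : (forall c, rcoord c w = 0) -> w = 0.
Proof.
move=> h; rewrite (coord_vbasis (memvf w)); apply: big1 => i _.
have := h (i, false); have := h (i, true); rewrite /rcoord /= => h1 h2.
by rewrite (complexP (z := coord _ i w) (w := 0)) ?scale0r.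
Qed.

Lemma expR_decay (r K : R) : (forall s, 0 <= s -> `|r| <= K * expR (- s)) -> r = 0.
Proof.
move=> h; apply/eqP/negP => /negP r0; have r1 : 0 < `|r| by rewrite normr_gt0.
have K0 : 0 <= K by have := h 0 (lexx _); rewrite oppr0 expR0 mulr1; apply: le_trans; exact: ltW.
(* At s = K / |r| the inequality exp(s) >= 1 + s would give |r| + K <= K. *)
have s0 : 0 <= K / `|r| by rewrite divr_ge0// ltW.
have := h _ s0; rewrite expRN ler_pdivlMr ?expR_gt0//.
have : `|r| * (1 + K / `|r|) <= `|r| * expR (K / `|r|).
  by rewrite ler_pM2l// expR_ge1Dx.
rewrite mulrDr mulr1 mulrC divfK ?gt_eqF// => h1 /(le_trans h1); lra.
Qed.

(* A dilation by t multiplies germ psi by a power of t, whereas germ_bound bounds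
   the result by a multiple of t^(M+1). *)
Lemma germ_vanish : exists M, forall psi, csmooth setT psi ->
  (forall s, (size s <= M)%N -> cpderivs s psi 0 = 0) -> germ psi = 0.
Proof.
have [k [C [C0 hC]]] := germ_bound.
pose de := lam.1 + lam.2 - nu.1 - nu.2.
(* M >= k lets [dilation_bound] reach the derivatives used in [germ_bound]; M >= - Re de compensates
   the character of the dilation, and the exponent M + 1 leaves a factor exp(-s). *)
pose M := (k + Num.bound (Re de))%N; exists M => psi sp hv.
have hvR s : (size s <= M)%N -> pderivs s (fun x => Re (psi x)) 0 = 0.
  by move=> /hv; rewrite cpderivsE => /(congr1 Re).
have hvI s : (size s <= M)%N -> pderivs s (fun x => Im (psi x)) 0 = 0.
  by move=> /hv; rewrite cpderivsE => /(congr1 Im).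
have kM : (k <= M)%N by exact: leq_addr.
have [B1 B10 h1] := dilation_bound sp.1 kM hvR.
have [B2 B20 h2] := dilation_bound sp.2 kM hvI.
apply: rcoord_eq0 => c; apply: (@expR_decay _ (2 * (C * (B1 + B2 + 1)))) => s s0.
pose t := expR (- s).
have t0 : 0 < t by exact: expR_gt0.
have t1 : t <= 1 by rewrite /t expRN invf_le1 ?expR_gt0// -expR0 ler_expR.
have sd : csmooth setT (fun x => psi (t *: x)).
  apply: (csmooth_pull oT oT sp) => // i j.
  apply: (smooth_ext oT (fun (y : 'cV[R]_q) _ => esym (mxE _ _ i j))).
  exact: (smooth_mul oT (smooth_cst oT _) (smooth_coord oT i j)).
pose e := (B1 + B2 + 1) * t ^+ M.+1.
have e0 : 0 < e by rewrite mulr_gt0 ?exprn_gt0// ltr_wpDl// addr_ge0.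
have := hC _ e sd e0 _; rewrite germ_dilation// => hc.
have {}hc c' : `|rcoord c' (cexp (de * s%:C) *: germ psi)| <= C * e.
  apply: hc => s' x sk bx; split.
    apply: le_trans (h1 t s' x (ltW t0) t1 sk bx) _.
    by rewrite ler_wpM2r ?exprn_ge0 ?ltW//; lra.
  apply: le_trans (h2 t s' x (ltW t0) t1 sk bx) _.
  by rewrite ler_wpM2r ?exprn_ge0 ?ltW//; lra.
set w' := _ *: germ psi in hc.
pose u := cexp (- (de * s%:C)).
have wE : germ psi = u *: w' by rewrite scalerA -cexpD addNr cexp0 scale1r.
have [u1 u2] : `|Re u| <= expR (- Re de * s) /\ `|Im u| <= expR (- Re de * s).
  have Ez : Re (- (de * s%:C)) = - Re de * s by rewrite ReN ReM /= mulr0 subr0 mulNr.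
  rewrite /u /cexp -Ez; move: (- (de * s%:C)) => z /=; rewrite !normrM !(gtr0_norm (expR_gt0 _)).
  by split; rewrite ger_pMr ?expR_gt0// ?cos_max ?sin_max.
clearbody u; have Ce : 0 <= C * e by rewrite mulr_ge0// ltW.
have : `|rcoord c (germ psi)| <= expR (- Re de * s) * (C * e) + expR (- Re de * s) * (C * e).
  have z1 := hc (c.1, false); have z2 := hc (c.1, true).
  rewrite wE /rcoord linearZ; rewrite /rcoord /= in z1 z2.
  case: c.2; rewrite /= ?ReM ?ImM.
    apply: le_trans (ler_normD _ _) _; rewrite !normrM; by apply: lerD; apply: ler_pM.
  apply: le_trans (ler_normB _ _) _; rewrite !normrM; by apply: lerD; apply: ler_pM.
move=> /le_trans; apply; have -> : expR (- Re de * s) * (C * e) + expR (- Re de * s) * (C * e) =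
    2 * (C * (B1 + B2 + 1)) * (expR (- Re de * s) * t ^+ M.+1) by rewrite /e; ring.
rewrite ler_wpM2l ?mulr_ge0 ?addr_ge0//.
rewrite /t -expRM_natl -expRD ler_expR.
have hM : - Re de <= M%:R.
  rewrite /M natrD; apply: le_trans (ler_norm _) _; rewrite normrN.
  rewrite -[leLHS]add0r lerD// ltW//.
  by have := archi_boundP (normr_ge0 (Re de)); rewrite /Num.bound normr_id.
rewrite -[M.+1]addn1 natrD; nra.
Qed.

Definition germ_mono m l (Q : dhomog p R[i] l) : W := germ (mono m Q).

Lemma germ_mono_lin m l (a : R[i]) (Q Q' : dhomog p R[i] l) :
  germ_mono m (a *: Q + Q') = a *: germ_mono m Q + germ_mono m Q'.
Proof.
rewrite /germ_mono -germ_lin; [|exact: csmooth_mono..]; congr germ; apply/funext => x.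
by rewrite /mono /lastpow /polyfun !raddfD /= -mul_mpolyC rmorphM /= mevalC; ring.
Qed.

Lemma germ_sum (J : Type) (r : seq J) (a : J -> R[i]) (F : J -> 'cV[R]_q -> R[i]) :
  (forall j, csmooth setT (F j)) ->
  germ (fun x => \sum_(j <- r) a j * F j x) = \sum_(j <- r) a j *: germ (F j).
Proof.
move=> sF; elim: r => [|j r IH].
  by rewrite big_nil -[RHS]germ0; congr germ; apply/funext => x; rewrite big_nil.
rewrite big_cons -IH -germ_lin; [|exact: sF|].
  by congr germ; apply/funext => x; rewrite big_cons.
apply: (csmooth_bigsum oT) => i; exact: (csmooth_mul oT (csmooth_cst oT _) (sF i)).
Qed.

(** The order can be raised at will, since the vanishing of more derivatives is a stronger
    condition; [N] makes a prescribed pair (m, l) occur in the sum. *)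
Lemma at_one_taylor N : exists2 M, (N <= M)%N & forall f, I_ f ->
  at_one f = \sum_(ml : 'I_M.+1 * 'I_M.+1) (ml.1`!%:R)^-1 *:
    germ_mono ml.1 (opD ml.1 ml.2 (fun x => f (expNm x)) 0).
Proof.
have [M hM] := germ_vanish; exists (maxn N M) => [|f If]; first exact: leq_maxl.
have sf := csmooth_chart If; have st := csmooth_taylor (maxn N M) (fun x => f (expNm x)).
have hv s (sM : (size s <= M)%N) := taylor_vanish sf (leq_trans sM (leq_maxr N M)).
have := hM _ (csmooth_lin oT (-1) st sf) hv.
rewrite (germ_lin _ st sf) -(germ_chart If) scaleN1r => /eqP; rewrite addrC subr_eq0 => /eqP ->.
rewrite -germ_sum => [|ml]; last exact: csmooth_mono.
by congr germ; apply/funext => x; rewrite /taylor pair_bigA.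
Qed.

Lemma at_one_single m l f : I_ f ->
  (forall m' l', (m', l') <> (m, l) ->
    germ_mono m' (opD m' l' (fun x => f (expNm x)) 0) = 0) ->
  at_one f = (m`!%:R)^-1 *: germ_mono m (opD m l (fun x => f (expNm x)) 0).
Proof.
move=> If h; have [M mlM hM] := at_one_taylor (m + l); rewrite (hM _ If).
have mM : (m < M.+1)%N by rewrite ltnS (leq_trans _ mlM)// leq_addr.
have lM : (l < M.+1)%N by rewrite ltnS (leq_trans _ mlM)// leq_addl.
rewrite (bigD1 (Ordinal mM, Ordinal lM))//= big1 ?addr0// => -[m' l'] /= n.
by rewrite h ?scaler0// => -[E1 E2]; case/eqP: n; congr (_, _); exact/val_inj.
Qed.
End Functional.

(** * Maps from poly^l to an irreducible representation *)

Section HomogeneousPolynomials.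
Variables (R : realType) (p : nat).
Implicit Types (xi : 'rV[R]_p) (v w : 'cV[R]_p) (k : multinom p).

Lemma val_dhomogD l (P Q : dhomog p R[i] l) :
  mpoly_of_dhomog (P + Q) = mpoly_of_dhomog P + mpoly_of_dhomog Q.
Proof. exact: raddfD. Qed.

Lemma val_dhomogZ l (a : R[i]) (Q : dhomog p R[i] l) :
  mpoly_of_dhomog (a *: Q) = a *: mpoly_of_dhomog Q.
Proof. exact: linearZ. Qed.

Lemma val_dhomog_sum l (J : Type) (r : seq J) (F : J -> dhomog p R[i] l) :
  mpoly_of_dhomog (\sum_(j <- r) F j) = \sum_(j <- r) mpoly_of_dhomog (F j).
Proof. exact: raddf_sum. Qed.

Lemma val_Ydh l k : mdeg k = l -> mpoly_of_dhomog (Ydh R l k) = ytilde R k.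
Proof.
move=> kl; apply: insubdK; rewrite -topredE /=; apply: dhomogZ; rewrite dhomogX.
exact/eqP.
Qed.

Lemma dhomog_polyfun_inj l (P Q : dhomog p R[i] l) :
  (forall v, polyfun P v = polyfun Q v) -> P = Q.
Proof. by move=> h; apply: val_inj; apply: polyfun_inj => v; exact: h. Qed.

Lemma dhomog_sum_Ydh l (Q : dhomog p R[i] l) :
  Q = \sum_(k <- mdegs p l) (mcoeff k Q * (mfact k)%:R) *: Ydh R l k.
Proof.
have E k : k \in mdegs p l -> mpoly_of_dhomog ((mcoeff k Q * (mfact k)%:R) *: Ydh R l k) =
    mcoeff k Q *: mpolyX R[i] k.
  rewrite mem_mdegs => /eqP kl; rewrite val_dhomogZ val_Ydh// ytildeE scalerA.
  by rewrite -mulrA mulfV ?mulr1// mfact_neq0.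
apply: val_inj; apply/mpolyP => j; rewrite [val (\sum_(_ <- _) _)]val_dhomog_sum.
rewrite big_seq (eq_bigr _ E) raddf_sum /=.
rewrite (eq_bigr (fun k => mcoeff k Q * (k == j)%:R)) => [|k _]; last first.
  by rewrite mcoeffZ mcoeffX.
have [jl|jl] := eqVneq (mdeg j) l; last first.
  rewrite (dhomog_nemf_coeff (dhomog_is_dhomog Q) jl).
  rewrite -big_seq big_seq big1// => k; rewrite mem_mdegs => /eqP kl.
  by case: eqP => [kj|_]; rewrite ?mulr0//; rewrite kj in kl; rewrite kl eqxx in jl.
rewrite -big_seq (bigD1_seq j) ?mdegs_uniq//=; last by rewrite mem_mdegs jl.
by rewrite eqxx mulr1 big1 ?addr0// => k /negbTE ->; rewrite mulr0.
Qed.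

Definition lform xi : mpoly p R[i] := \sum_(j < p) (xi ord0 j)%:C *: mpolyX R[i] (mnm1 j).

Lemma polyfun_lform xi v : polyfun (lform xi) v = (pairing xi v)%:C.
Proof.
rewrite /polyfun raddf_sum /= /pairing mxE rmorph_sum; apply: eq_bigr => j _.
by rewrite mevalZ mevalXU rmorphM.
Qed.

Lemma lform_pow_homog xi l : lform xi ^+ l \is ishomog1 l mdeg.
Proof.
have h : lform xi \is ishomog1 1 mdeg.
  by apply: rpred_sum => j _; apply: dhomogZ; rewrite dhomogX; apply/eqP; exact: mdeg1.
by have := dhomogMn l h; rewrite mul1n.
Qed.

Definition lpow xi l : dhomog p R[i] l := DHomog (lform_pow_homog xi l).

Lemma polyfun_lpow xi l v : polyfun (lpow xi l) v = (pairing xi v)%:C ^+ l.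
Proof. by rewrite /polyfun /= rmorphXn /= -/(polyfun _ v) polyfun_lform. Qed.

Lemma mderiv_lform_pow xi n j :
  mderiv j (lform xi ^+ n) = (n%:R * (xi ord0 j)%:C) *: lform xi ^+ n.-1.
Proof.
have d1 : mderiv j (lform xi) = mpolyC p (xi ord0 j)%:C.
  rewrite raddf_sum /= (bigD1 j)//= big1 ?addr0 => [|i ij].
    rewrite mderivZ mderivX mnm1E eqxx scale1r.
    have -> : mnm_sub (mnm1 j) (mnm1 j) = mnm0 :> multinom p.
      by apply/mnmP => a; rewrite mnmBE mnm0E subnn.
    by rewrite mpolyX0 -mul_mpolyC mulr1.
  by rewrite mderivZ mderivX mnm1E (negbTE ij) scale0r scaler0.
elim: n => [|[|n] IH]; first by rewrite expr0 mul0r scale0r -mpolyC1 mderivC.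
  by rewrite expr1 d1 mul1r expr0 -mul_mpolyC mulr1.
rewrite exprS mderivM IH d1 mul_mpolyC -scalerAr -exprS -scalerDl; congr (_ *: _).
by rewrite -[n.+2]addn1 natrD; ring.
Qed.

Lemma cpderivs_lform_pow xi n (s : seq ('I_p * 'I_1)) v :
  cpderivs s (polyfun (lform xi ^+ n)) v =
  (n ^_ size s)%:R * (\prod_(ij <- s) (xi ord0 ij.1)%:C) * (pairing xi v)%:C ^+ (n - size s).
Proof.
elim: s v => [|[j o] s IH] v.
  by rewrite /= big_nil mulr1 mul1r subn0 /polyfun rmorphXn /= -/(polyfun _ v) polyfun_lform.
rewrite /= (ord1 o).
have -> : cpderivs s (polyfun (lform xi ^+ n)) = polyfun
    (((n ^_ size s)%:R * \prod_(ij <- s) (xi ord0 ij.1)%:C) *: lform xi ^+ (n - size s)).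
  by apply/funext => y; rewrite IH /polyfun mevalZ rmorphXn /= -/(polyfun _ y) polyfun_lform.
rewrite cpderiv_polyfun mderivZ mderiv_lform_pow /polyfun !mevalZ rmorphXn /= -/(polyfun _ v).
rewrite polyfun_lform big_cons ffactnSr natrM -subnS; ring.
Qed.

Lemma mcoeff_lform_pow xi k :
  mcoeff k (lform xi ^+ mdeg k) * (mfact k)%:R =
  (mdeg k)`!%:R * polyfun (mpolyX R[i] k) xi^T.
Proof.
rewrite -cpderivs_polyfun0 cpderivs_lform_pow.
have -> : size (mlist k) = mdeg k.
  rewrite /mlist size_flatten /shape -map_comp sumnE big_map mdegE enumT.
  by apply: eq_bigr => j _ /=; rewrite size_nseq.
rewrite subnn expr0 mulr1 ffactnn; congr (_ * _).
rewrite /mlist big_flatten /= big_map /polyfun mevalX enumT.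
apply: eq_bigr => j _; rewrite /evalc mxE.
by elim: (k j) => [|n IH]; rewrite ?big_nil//= big_cons IH exprS.
Qed.

(** A coordinate of T((xi y)^l) is l! times the sum of the c_k xi^k, where the c_k are the
    coordinates of the images of the basis [Ydh]; a polynomial in xi that vanishes at all real
    points has c_k = 0. *)
Lemma lpow_span l (W : vectType R[i]) (T : {linear dhomog p R[i] l -> W}) :
  (forall xi, T (lpow xi l) = 0) -> forall Q, T Q = 0.
Proof.
move=> h.
suff Z k : mdeg k = l -> T (Ydh R l k) = 0.
  move=> Q; rewrite (dhomog_sum_Ydh Q) linear_sum big_seq big1// => k.
  by rewrite mem_mdegs => /eqP /Z E; rewrite linearZ_LR E scaler0.
move=> kl; rewrite (coord_vbasis (memvf (T _))); apply: big1 => i _.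
pose c k := coord (vbasis {:W}) i (T (Ydh R l k)).
suff : \sum_(j <- mdegs p l) c j *: mpolyX R[i] j = 0.
  move=> /(congr1 (mcoeff k)); rewrite mcoeff0 raddf_sum /= (bigD1_seq k) ?mdegs_uniq//=; last first.
    by rewrite mem_mdegs kl.
  rewrite mcoeffZ mcoeffX eqxx mulr1 big1 ?addr0 => [|j jk]; first by rewrite /c => ->; rewrite scale0r.
  by rewrite mcoeffZ mcoeffX (negbTE jk) mulr0.
apply: polyfun_inj => v; rewrite /polyfun raddf_sum meval0 /=.
have := congr1 (coord (vbasis {:W}) i) (h v^T).
rewrite (dhomog_sum_Ydh (lpow _ _)) !linear_sum linear0 /= big_seq.
have E j : j \in mdegs p l -> coord (vbasis {:W}) i
    (T ((mcoeff j (lform v^T ^+ l) * (mfact j)%:R) *: Ydh R l j)) =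
    l`!%:R * (c j * polyfun (mpolyX R[i] j) v).
  rewrite mem_mdegs => /eqP jl; rewrite !linearZ /= -/(c j) -jl mcoeff_lform_pow trmxK.
  by rewrite mulrAC -mulrA; congr (_ * _); rewrite mulrC.
rewrite (eq_bigr _ E) -mulr_sumr => /eqP; rewrite mulf_eq0 pnatr_eq0 -leqn0 leqNgt fact_gt0 /=.
rewrite -big_seq => /eqP E0; rewrite -[RHS]E0; apply: eq_bigr => j _.
by rewrite mevalZ.
Qed.
End HomogeneousPolynomials.

Section PolynomialFamilies.
Variables (R : realType) (p : nat).
Implicit Types (F : R -> mpoly p R[i]).

(** Polynomial dependence on a real parameter, coefficient by coefficient: passing to the limit at 0
    becomes the vanishing of a polynomial with infinitely many zeros. *)
Definition polyfam F := forall k, exists r : {poly R[i]},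
  forall s, mcoeff k (F s) = r.[s%:C].

Lemma polyfam_cst P : polyfam (fun=> P).
Proof. by move=> k; exists (mcoeff k P)%:P => s; rewrite hornerC. Qed.

Lemma polyfam_add F1 F2 : polyfam F1 -> polyfam F2 -> polyfam (fun s => F1 s + F2 s).
Proof.
move=> h1 h2 k; have [r1 e1] := h1 k; have [r2 e2] := h2 k.
by exists (r1 + r2) => s; rewrite mcoeffD e1 e2 hornerD.
Qed.

Lemma polyfam_mul F1 F2 : polyfam F1 -> polyfam F2 -> polyfam (fun s => F1 s * F2 s).
Proof.
move=> /choice[r1 e1] /choice[r2 e2] k.
exists (\sum_(kk : bmultinom p (mdeg k).+1 * bmultinom p (mdeg k).+1
  | k == mnm_add (bmnm kk.1) (bmnm kk.2)) r1 (bmnm kk.1) * r2 (bmnm kk.2)) => s.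
rewrite mcoeffM horner_sum; apply: eq_bigr => kk _.
by rewrite hornerM e1 e2.
Qed.

Lemma polyfam_scale (r : {poly R[i]}) F : polyfam F -> polyfam (fun s => r.[s%:C] *: F s).
Proof.
by move=> h k; have [r' e] := h k; exists (r * r') => s; rewrite mcoeffZ e hornerM.
Qed.

Lemma polyfam_sum (J : Type) (r : seq J) (F : J -> R -> mpoly p R[i]) :
  (forall j, polyfam (F j)) -> polyfam (fun s => \sum_(j <- r) F j s).
Proof.
move=> h; elim: r => [|j r IH k].
  by move=> k; exists 0 => s; rewrite big_nil mcoeff0 horner0.
have [r' e] := polyfam_add (h j) IH k.
by exists r' => s; rewrite big_cons e.
Qed.

Lemma polyfam_prod (J : Type) (r : seq J) (F : J -> R -> mpoly p R[i]) :
  (forall j, polyfam (F j)) -> polyfam (fun s => \prod_(j <- r) F j s).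
Proof.
move=> h; elim: r => [|j r IH k].
  move=> k; have [r' e] := polyfam_cst 1 k; exists r' => s; rewrite big_nil; exact: e.
have [r' e] := polyfam_mul (h j) IH k.
by exists r' => s; rewrite big_cons e.
Qed.

Lemma polyfam_exp n F : polyfam F -> polyfam (fun s => F s ^+ n).
Proof.
move=> h; elim: n => [|n IH k].
  exact: polyfam_cst.
have [r' e] := polyfam_mul h IH k; exists r' => s; rewrite exprS; exact: e.
Qed.

Lemma poly_zero_real (r : {poly R[i]}) : (forall s : R, 0 < s -> r.[s%:C] = 0) -> r = 0.
Proof.
move=> h; apply/eqP/negP => /negP r0.
(* As many zeros as the size of [r], one more than its degree allows. *)
pose rs : seq R[i] := [seq (i.+1%:R : R)%:C | i <- seq.iota 0 (size r)].
have h1 : all (root r) rs.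
  by apply/allP => z /mapP [i _ ->]; rewrite /root h.
have h2 : uniq rs.
  rewrite map_inj_uniq ?iota_uniq// => i j /(congr1 (@complex.Re R)) /= /eqP.
  by rewrite eqr_nat eqSS => /eqP.
by have := max_poly_roots r0 h1 h2; rewrite size_map size_iota ltnn.
Qed.
End PolynomialFamilies.

(** * Equivariant maps and Schur's lemma *)

Section EquivariantMaps.
Variables (R : realType) (p : nat).
Hypothesis p0 : (0 < p)%N.
Variables (W : vectType R[i]) (varpi : 'M[R]_p -> 'End(W)).
Hypothesis hvarpi : irr_rep varpi.
Variables (l : nat) (d1 d2 : bool).
Implicit Types (T : {linear dhomog p R[i] l -> W}) (Q : dhomog p R[i] l).

Definition twisted T := forall g u, SLpm g ->
  T ((sgnpow d1 (\det g))%:C *: poly_rep g u) = (sgnpow d2 (\det g))%:C *: varpi g (T u).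

Lemma sgnpowC_neq0 d (g : 'M[R]_p) : SLpm g -> (sgnpow d (\det g))%:C != 0 :> R[i].
Proof.
move=> hg; rewrite fmorph_eq0; apply: sgnpow_neq0.
by case: hg => ->; rewrite ?oppr_eq0 oner_eq0.
Qed.

Lemma twisted_poly_rep T g Q : twisted T -> SLpm g ->
  T (poly_rep g Q) = ((sgnpow d1 (\det g))%:C^-1 * (sgnpow d2 (\det g))%:C) *: varpi g (T Q).
Proof.
move=> hT hg; rewrite -scalerA -(hT g Q hg) linearZ_LR scalerA mulVf ?scale1r//.
exact: sgnpowC_neq0.
Qed.

Lemma poly_rep_scale (c : R) (B : 'M[R]_p) Q : c != 0 ->
  poly_rep (invmx (c *: B)) Q = (c ^+ l)%:C *: poly_rep (invmx B) Q.
Proof.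
move=> c0; apply: dhomog_polyfun_inj => v.
apply: etrans (polyfun_poly_rep Q (invmx (c *: B)) v) _.
apply: etrans _ (esym (polyfun_scale (poly_rep (invmx B) Q) (c ^+ l)%:C v)).
by rewrite (polyfun_poly_rep Q (invmx B) v) !invmxK -scalemxAl polyfunZ.
Qed.

Lemma twisted_ker_unit T Q (B : 'M[R]_p) : twisted T -> T Q = 0 -> B \in unitmx ->
  T (poly_rep (invmx B) Q) = 0.
Proof.
move=> hT TQ uB.
have d0 : \det B != 0 by move: uB; rewrite unitmxE unitfE.
(* Division by the p-th root of |det B| brings B to determinant 1 or -1, and scalar matrices act on
   poly^l by numbers. *)
pose c := expR (ln `|\det B| / p%:R).
have c0 : 0 < c by exact: expR_gt0.
have cp : c ^+ p = `|\det B|.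
  rewrite /c -expRM_natl mulrC divfK ?pnatr_eq0 -?lt0n//.
  by rewrite lnK// posrE normr_gt0.
have hS : SLpm (c^-1 *: B).
  rewrite /SLpm /= detZ exprVn cp.
  have [dp|dn] := ltP 0 (\det B); [left|right].
    by rewrite gtr0_norm// mulVf.
  by rewrite ler0_norm// invrN mulNr mulVf.
have -> : B = c *: (c^-1 *: B) by rewrite scalerA mulfV ?scale1r// gt_eqF.
have [iS _ _] := SLpm_inv hS.
by rewrite poly_rep_scale ?gt_eqF// linearZ_LR twisted_poly_rep// TQ linear0 !scaler0.
Qed.

Lemma polyfam_poly_rep (A B : 'M[R]_p) Q :
  polyfam (fun s => mpoly_of_dhomog (poly_rep (invmx (A + s *: B)) Q)).
Proof.
rewrite /= /subst_inv => k.
have E s : comp_mpoly [tuple \sum_(k < p) (invmx (invmx (A + s *: B)) j k)%:C *: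
    mpolyX R[i] (mnm1 k) | j < p] Q = \sum_(m <- msupp Q) mcoeff m Q *: \prod_(i < p)
    (\sum_(k < p) ((A i k)%:C%:P + (B i k)%:C *: 'X).[s%:C] *: mpolyX R[i] (mnm1 k)) ^+ m i.
  rewrite comp_mpolyE; apply: eq_bigr => m _; congr (_ *: _); apply: eq_bigr => i _.
  rewrite tnth_mktuple; congr (_ ^+ _); apply: eq_bigr => j _.
  by rewrite invmxK !mxE hornerD hornerC hornerZ hornerX -rmorphM -rmorphD mulrC.
have [r e] : exists r : {poly R[i]}, forall s, mcoeff k (\sum_(m <- msupp Q) mcoeff m Q *: \prod_(i < p)
    (\sum_(k < p) ((A i k)%:C%:P + (B i k)%:C *: 'X).[s%:C] *: mpolyX R[i] (mnm1 k)) ^+ m i) = r.[s%:C].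
  apply: polyfam_sum => m k'.
  have [r e] : exists r : {poly R[i]}, forall s, mcoeff k' (\prod_(i < p)
      (\sum_(k < p) ((A i k)%:C%:P + (B i k)%:C *: 'X).[s%:C] *: mpolyX R[i] (mnm1 k)) ^+ m i) = r.[s%:C].
    apply: polyfam_prod => i; apply: polyfam_exp; apply: polyfam_sum => j.
    apply: polyfam_scale; exact: polyfam_cst.
  by exists (mcoeff m Q *: r) => s; rewrite mcoeffZ e hornerZ.
by exists r => s; rewrite E.
Qed.

(* s (1 - w xi) + w xi is invertible for s <> 0 and equals the rank one
   projection w xi at s = 0. *)
Lemma twisted_ker_rank1 T Q (xi : 'rV[R]_p) (w : 'cV[R]_p) : twisted T -> T Q = 0 ->
  pairing xi w = 1 -> T (poly_rep (invmx (w *m xi)) Q) = 0.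
Proof.
move=> hT TQ xw; pose E := w *m xi.
have EE : E *m E = E.
  by rewrite /E mulmxA -(mulmxA w) [xi *m w]mx11_scalar -/(pairing xi w) xw mulmx1.
pose B (s : R) := E + s *: (1%:M - E).
(* Since E is a projection, B(s) B(1/s) = 1. *)
have uB s : s != 0 -> B s \in unitmx.
  move=> s0; have : B s *m B s^-1 = 1%:M.
    rewrite /B mulmxDl !mulmxDr -!scalemxAr -!scalemxAl EE.
    rewrite mulmxBr mulmx1 EE subrr scaler0 addr0.
    rewrite mulmxBl mul1mx EE subrr scaler0 add0r scalerA mulVf// scale1r.
    by rewrite mulmxBr !mulmx1 mulmxBl mul1mx EE subrr subr0 addrC subrK.
  by move=> /mulmx1_unit [].
rewrite (coord_vbasis (memvf (T _))); apply: big1 => i _.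
have [r hr] := choice (fun k => polyfam_poly_rep E (1%:M - E) Q k).
pose rr := \sum_(k <- mdegs p l) (coord (vbasis {:W}) i (T (Ydh R l k)) * (mfact k)%:R) *: r k.
have hrr s : coord (vbasis {:W}) i (T (poly_rep (invmx (B s)) Q)) = rr.[s%:C].
  rewrite (dhomog_sum_Ydh (poly_rep _ Q)) !linear_sum horner_sum /=; apply: eq_bigr => k _.
  by rewrite linearZ_LR linearZ /= hornerZ -(hr k s); ring.
have rr0 : rr = 0.
  apply: poly_zero_real => s s0.
  by rewrite -hrr (twisted_ker_unit hT TQ (uB s _)) ?linear0// gt_eqF.
have := hrr 0; rewrite rr0 horner0 /B scale0r addr0 -/E => ->.
by rewrite scale0r.
Qed.

(** When xi w = 1, the matrix w xi sends Q to Q(w) (xi y)^l. A point w where the non-zero polynomial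
    (xi y) Q does not vanish, once rescaled, therefore puts (xi y)^l in the kernel. *)
Lemma twisted_ker T Q : twisted T -> T Q = 0 -> Q != 0 -> forall Q', T Q' = 0.
Proof.
move=> hT TQ Q0; apply: lpow_span.
have Qn0 : mpoly_of_dhomog Q != 0.
  by apply: contra Q0 => /eqP h; apply/eqP/val_inj.
have good xi : xi != 0 -> T (lpow xi l) = 0.
  move=> xi0.
  have [w hw] : exists w, polyfun (lform xi * mpoly_of_dhomog Q) w != 0.
    apply: contrapT => /forallNP h.
    have : lform xi * mpoly_of_dhomog Q = 0.
      apply: polyfun_inj => v; rewrite [RHS]/polyfun meval0; apply/eqP/negPn/negP; exact: h.
    move=> /eqP; rewrite mulf_eq0 (negbTE Qn0) orbF => /eqP l0.
    case/eqP: xi0; apply/rowP => j; rewrite mxE.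
    have := polyfun_lform xi (delta_mx j ord0); rewrite l0 /polyfun meval0.
    rewrite /pairing mxE (bigD1 j)//= big1 ?addr0 => [|i ij]; last first.
      by rewrite mxE (negbTE ij) mulr0.
    by rewrite mxE !eqxx mulr1 => /(congr1 (@complex.Re R)) /= ->.
  move: hw; rewrite /polyfun mevalM -!/(polyfun _ w) polyfun_lform mulf_eq0 negb_or.
  rewrite fmorph_eq0 => /andP[xw Qw].
  pose w' := (pairing xi w)^-1 *: w.
  have xw' : pairing xi w' = 1 by rewrite pairingZ mulVf.
  have := twisted_ker_rank1 hT TQ xw'.
  have -> : poly_rep (invmx (w' *m xi)) Q = polyfun Q w' *: lpow xi l.
    apply: dhomog_polyfun_inj => v; apply: etrans (polyfun_poly_rep Q (invmx (w' *m xi)) v) _.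
    apply: etrans _ (esym (polyfun_scale (lpow xi l) (polyfun Q w') v)).
    rewrite polyfun_lpow invmxK -mulmxA [xi *m v]mx11_scalar -/(pairing xi v).
    by rewrite mul_mx_scalar polyfunZ rmorphXn mulrC.
  rewrite linearZ => /eqP; rewrite scaler_eq0 => /orP[|/eqP//].
  by rewrite /w' polyfunZ mulf_eq0 (negbTE Qw) orbF fmorph_eq0 expf_eq0 invr_eq0 (negbTE xw) andbF.
(* For xi = 0 no such w exists: the power is 0 unless l = 0, and then it is the constant 1, as for
   any other xi. *)
move=> xi; have [->|] := eqVneq xi 0; last exact: good.
have lf0 : lform (0 : 'rV[R]_p) = 0.
  by rewrite /lform big1// => j _; rewrite mxE scale0r.
case: (posnP l) => [l0|lp].
  have n0 : const_mx 1 != 0 :> 'rV[R]_p.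
    by apply/eqP => /rowP /(_ (Ordinal p0)); rewrite !mxE => /eqP; rewrite oner_eq0.
  rewrite -(good _ n0); congr (T _); apply: val_inj => /=.
  by rewrite l0 !expr0.
rewrite (_ : lpow 0 l = 0) ?linear0//; apply: val_inj => /=.
by rewrite lf0 expr0n gtn_eqF.
Qed.

Lemma twisted_surjective T : twisted T -> (exists Q, T Q != 0) -> forall w, exists Q, T Q = w.
Proof.
move=> hT [Q0 TQ0] w.
pose X := [seq T (Ydh R l k) | k <- mdegs p l].
have TX Q : T Q \in <<X>>%VS.
  rewrite (dhomog_sum_Ydh Q) linear_sum big_seq; apply: rpred_sum => k kl.
  by rewrite linearZ_LR; apply: rpredZ; apply: memv_span; apply: map_f.
have XT v : v \in <<X>>%VS -> exists Q, T Q = v.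
  move=> /(@coord_span _ _ _ (in_tuple X)) ->.
  have hc (i : 'I_(size X)) : exists Q, T Q = X`_i.
    have : X`_i \in X by apply: mem_nth.
    by move=> /mapP [k _ ->]; eexists.
  have [c hc'] := choice hc.
  exists (\sum_i coord (in_tuple X) i v *: c i).
  by rewrite linear_sum; apply: eq_bigr => i _; rewrite linearZ_LR hc'.
apply: (XT w); have [|X0|->] := irr_rep_irr hvarpi (U := <<X>>%VS) _; last exact: memvf.
- move=> g hg; apply/subvP => v /memv_imgP [u /XT [Q <-] ->].
  have hS : SLpm g by left.
  by have := hT g Q hS; rewrite hg !sgnpow_gt0// !scale1r => <-; exact: TX.
- by case/negP: TQ0; move: (TX Q0); rewrite X0 memv0.
Qed.

Lemma twisted_bijective T : twisted T -> (exists Q, T Q != 0) -> bijective T.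
Proof.
move=> hT nT; have [g hg] := choice (twisted_surjective hT nT).
exists g => // Q; apply/eqP; rewrite -subr_eq0; apply/negPn/negP => n0.
have := twisted_ker hT _ n0; rewrite linearB hg subrr => /(_ erefl) h.
by case: nT => Q' /eqP; apply; exact: h.
Qed.

(** An eigenvector exists because R[i] is algebraically closed and W is not 0; its eigenspace is
    stable under SL, hence everything. *)
Lemma schur (A : 'End(W)) : (forall g w, SL g -> A (varpi g w) = varpi g (A w)) ->
  exists a, forall w, A w = a *: w.
Proof.
move=> hA.
have dW : (0 < \dim {:W})%N.
  by rewrite lt0n dimv_eq0; apply/eqP; exact: irr_rep_neq0 hvarpi.
have [w [w0 [a wa]]] : exists w, w != 0 /\ exists a, A w = a *: w.
  pose b := vbasis {:W}.
  pose M : 'M[R[i]]_(\dim {:W}) := \matrix_(i, j) coord b j (A b`_i).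
  have [a ra] : exists a, root (char_poly M) a.
    by apply/closed_rootP; rewrite size_char_poly eqSS -lt0n.
  move: ra; rewrite -eigenvalue_root_char => /eigenvalueP [v vA v0].
  exists (\sum_i v ord0 i *: b`_i); split.
    apply: contra_neq v0 => E; apply/rowP => i; rewrite mxE.
    have := congr1 (coord b i) E; rewrite linear0 coord_sum_free//.
    exact: basis_free (vbasisP _).
  exists a; rewrite linear_sum scaler_sumr.
  have E i : A (v ord0 i *: b`_i) = \sum_j (v ord0 i * M i j) *: b`_j.
    rewrite linearZ /= {1}(coord_vbasis (memvf (A b`_i))) scaler_sumr.
    by apply: eq_bigr => j _; rewrite scalerA mxE.
  rewrite (eq_bigr _ (fun i _ => E i)) exchange_big /=; apply: eq_bigr => j _.
  by rewrite -scaler_suml scalerA; congr (_ *: _); move/rowP: vA => /(_ j); rewrite !mxE.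
exists a; pose U := lker (A - a *: \1)%VF.
have inU v : (v \in U) = (A v == a *: v).
  by rewrite memv_ker add_lfunE opp_lfunE scale_lfunE id_lfunE subr_eq0.
have [|U0|UT] := irr_rep_irr hvarpi (U := U) _.
- move=> g hg; apply/subvP => v /memv_imgP [u]; rewrite !inU => /eqP Au ->.
  by rewrite hA// Au linearZ.
- by move: w0; rewrite -memv0 -U0 inU wa eqxx.
- by move=> v; apply/eqP; rewrite -inU UT memvf.
Qed.

(** Schur's lemma for T0 composed with the inverse of T; on SL, where [varpi] is irreducible, the
    signs disappear. *)
Lemma twisted_unique T T0 : twisted T -> bijective T -> twisted T0 ->
  exists a, forall Q, T0 Q = a *: T Q.
Proof.
move=> hT [S TK KT] hT0.
have lS : linear S by exact: can2_linear TK KT.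
have lA : linear (fun w => T0 (S w)).
  by move=> a u v; rewrite lS linearP.
pose A : {linear W -> W} := HB.pack (fun w => T0 (S w)) (GRing.isLinear.Build _ _ _ _ _ lA).
have [|a ha] := @schur (linfun A).
  move=> g w hg; rewrite !lfunE /=; have hS : SLpm g by left.
  have E T' : twisted T' -> forall u, T' (poly_rep g u) = varpi g (T' u).
    by move=> hT' u; have := hT' g u hS; rewrite hg !sgnpow_gt0// !scale1r.
  by rewrite -{1}(KT w) -(E T hT) TK (E T0 hT0).
by exists a => Q; have := ha (T Q); rewrite lfunE /= TK.
Qed.

End EquivariantMaps.

(** * Classification *)

Section OperatorJets.
Variables (R : realType) (p : nat).
Local Notation oT := (@openT 'cV[R]_p.+1).

Lemma opD_germ m l (F G : 'cV[R]_p.+1 -> R[i]) :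
  (\forall x \near (0 : 'cV[R]_p.+1), F x = G x) -> opD m l F 0 = opD m l G 0.
Proof.
move=> FG; rewrite !opD_sum; apply: eq_bigr => k _; congr (_ *: _).
exact: cpderivs_near_eq.
Qed.

Lemma dhomog_mcoeff_inj l (P Q : dhomog p R[i] l) :
  (forall k, mdeg k = l -> mcoeff k P = mcoeff k Q) -> P = Q.
Proof.
move=> h; apply: val_inj; apply/mpolyP => k; have [kl|kl] := eqVneq (mdeg k) l.
  exact: h.
by rewrite !(dhomog_nemf_coeff (dhomog_is_dhomog _) kl).
Qed.

Lemma opD_mono m l (Q : dhomog p R[i] l) : opD m l (mono m Q) 0 = m`!%:R *: Q.
Proof.
apply: dhomog_mcoeff_inj => k kl; rewrite val_dhomogZ mcoeffZ.
apply: (mulIf (mfact_neq0 R k)).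
rewrite (mcoeff_opD m l k oT (csmooth_mono m Q) I) mono_jet kl !eqxx !mul1r.
by rewrite mulrA.
Qed.

Lemma opD_mono_neq m l m' l' (Q : dhomog p R[i] l) : (m', l') <> (m, l) ->
  opD m' l' (mono m Q) 0 = 0.
Proof.
move=> n; apply: dhomog_mcoeff_inj => k kl.
have -> : mcoeff k (0 : dhomog p R[i] l') = 0 by exact: mcoeff0.
apply: (mulIf (mfact_neq0 R k)).
rewrite (mcoeff_opD m' l' k oT (csmooth_mono m Q) I) mono_jet mul0r.
have [mm|_] := eqVneq m m'; last by rewrite !mul0r mulr0.
have -> : mcoeff k Q = 0; last by rewrite mul0r !mulr0.
apply: (dhomog_nemf_coeff (dhomog_is_dhomog Q)).
by apply/eqP => ll; have {}ll : mdeg k = l := ll; apply: n; rewrite mm -kl ll.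
Qed.

Lemma poly_repZ l (g : 'M[R]_p) (a : R[i]) (Q : dhomog p R[i] l) :
  poly_rep g (a *: Q) = a *: poly_rep g Q.
Proof.
apply: dhomog_polyfun_inj => v; apply: etrans (polyfun_poly_rep (a *: Q) g v) _.
apply: etrans _ (esym (polyfun_scale (poly_rep g Q) a v)).
by rewrite (polyfun_poly_rep Q g v) (polyfun_scale Q a).
Qed.

Lemma poly_rep1 l (Q : dhomog p R[i] l) : poly_rep 1%:M Q = Q.
Proof.
apply: dhomog_polyfun_inj => v; apply: etrans (polyfun_poly_rep Q 1%:M v) _.
by rewrite invmx1 mul1mx.
Qed.

Lemma cexp_trivial (z : R[i]) : (forall t : R, cexp (z * t%:C) = 1) -> z = 0.
Proof.
move=> h; have E (t : R) : expR (complex.Re z * t) * cos (complex.Im z * t) = 1 /\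
    expR (complex.Re z * t) * sin (complex.Im z * t) = 0.
  have := h t; rewrite /cexp => /[dup] /(congr1 (@complex.Re R)) + /(congr1 (@complex.Im R)).
  by case: z {h} => a b /=; rewrite !mulr0 subr0 add0r.
have sin0 t : sin (complex.Im z * t) = 0.
  by have /eqP := (E t).2; rewrite mulf_eq0 gt_eqF ?expR_gt0//= => /eqP.
have i0 : complex.Im z = 0.
  (* The sine would have to vanish at pi / 2. *)
  apply/eqP/negPn/negP => n0; have := sin0 ((complex.Im z)^-1 * (pi / 2)).
  by rewrite mulrA mulfV// mul1r sin_pihalf => /eqP; rewrite oner_eq0.
have r0 : complex.Re z = 0.
  have := (E 1).1; rewrite i0 mul0r cos0 !mulr1 -[1]expR0 => /expR_inj.
  by [].
exact: complexP.
Qed.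

End OperatorJets.

(** * Constraints imposed by equivariance *)

Section Invariance.
Variables (R : realType) (p : nat).
Hypothesis p0 : (0 < p)%N.
Local Notation q := p.+1.
Local Notation Re := (@complex.Re R).
Local Notation Im := (@complex.Im R).
Variables (alpha beta : bool * bool) (lam nu : R[i] * R[i]).
Variables (W : vectType R[i]) (varpi : 'M[R]_p -> 'End(W)).
Hypothesis hvarpi : irr_rep varpi.
Local Notation I_ := (Ind (@triv_rep R p.+1) alpha lam).
Local Notation J_ := (Ind varpi beta nu).
Variable D : ('M[R]_p.+2 -> R[i]^o) -> ('M[R]_p.+1 -> W).
Hypothesis hD : Diff I_ J_ D.

Definition germ_linear m l : {linear dhomog p R[i] l -> W} :=
  HB.pack (@germ_mono R p alpha lam W D m l) (GRing.isLinear.Build _ _ _ _ _ (germ_mono_lin hD m (l := l))).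

(** Elements of M'A' have b = 0, so the translate of a germ x_n^m Q(x') has no jet other than that
    of type (m, l); equivariance at the identity thus becomes a condition on each T_(m,l)
    separately. *)
Lemma germ_linear_invE m l e (g0 : 'M[R]_p) t1 t2 (Q : dhomog p R[i] l) : e = 1 \/ e = -1 -> SLpm g0 ->
  (kap alpha lam e t1 t2 g0
     * ((e * expR t1)^-1 ^+ m * ((e * expR t1)^-1 * cfac p t1 t2) ^+ l)%:C)
    *: germ_linear m l (poly_rep (invmx g0) Q) =
  ((inducing varpi beta nu e g0 t1 t2)^-1)%VF (germ_linear m l Q).
Proof.
move=> he hg; have If := cut_Ind (ltn0Sn p) alpha lam (csmooth_mono m Q).
have If' := translate_Ind p0 t1 t2 (0 : 'rV[R]_p) he hg If.
have chart m' l' : opD m' l' (fun x => cut alpha lam (mono m Q) (expNm x)) 0 =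
    opD m' l' (mono m Q) 0.
  exact: (opD_germ m' l' (cut_near alpha lam (mono m Q))).
have jets m' l' := opD_equivariant p0 If t1 t2 he hg
  (Or31 _ _ (erefl (0 : 'rV[R]_p))) (m := m') (l := l').
have vanish m' l' : (m', l') <> (m, l) ->
    germ_linear m' l' (opD m' l' (fun x => cut alpha lam (mono m Q)
      (embG (elM e g0 *m expH p t1 *m expJ p t2 *m expNp 0) *m expNm x)) 0) = 0.
  move=> n; rewrite (jets m' l') (chart m' l') (opD_mono_neq Q n).
  have -> : poly_rep (invmx g0) (0 : dhomog p R[i] l') = 0.
    by rewrite -[X in poly_rep _ X](scale0r 0) poly_repZ scale0r.
  by rewrite scaler0 linear0.
have E := at_one_single p0 hvarpi hD If' vanish.
rewrite -(at_one_translate p0 hD t1 t2 (0 : 'rV[R]_p) he hg If) {}E.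
rewrite (jets m l) (chart m l) opD_mono poly_repZ.
set G := germ_linear m l.
rewrite -[germ_mono _ _ _ _ _]/(G _); move: G (poly_rep _ _) => G Q'.
set c := kap _ _ _ _ _ _ * _; clearbody c.
rewrite !(linearZ_LR G) !scalerA; congr (_ *: _).
by rewrite mulrCA mulVf ?mulr1// pnatr_eq0 -lt0n fact_gt0.
Qed.

Lemma germ_weight m l e (g0 : 'M[R]_p) t1 t2 (Q : dhomog p R[i] l) : e = 1 \/ e = -1 -> SLpm g0 ->
  ((sgnpow alpha.1 e * e ^+ (m + l) * sgnpow alpha.2 (\det g0))%:C *
    (cexp (- (lam.1 + (m + l)%:R + l%:R / p%:R) * t1%:C)
     * cexp (- (lam.2 - l%:R / p%:R) * t2%:C))) *: germ_linear m l (poly_rep (invmx g0) Q) =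
  ((sgnpow beta.1 e * sgnpow beta.2 (\det g0))%:C *
   (cexp (- nu.1 * t1%:C) * cexp (- nu.2 * t2%:C))) *: varpi (invmx g0) (germ_linear m l Q).
Proof.
move=> he hg; rewrite -(weight_identity p0 alpha lam m l t1 t2 g0 he).
apply: etrans (germ_linear_invE m t1 t2 Q he hg) _.
apply: (inducing_invE beta nu t1 t2 _ he hg) => w.
  exact: (varpiK hvarpi w hg).1.
exact: (varpiK hvarpi w hg).2.
Qed.

Lemma SLpm1 : SLpm (1%:M : 'M[R]_p). Proof. by left; rewrite det1. Qed.

Lemma germ_weight1 m l e t1 t2 (Q : dhomog p R[i] l) : e = 1 \/ e = -1 ->
  germ_linear m l Q != 0 ->
  (sgnpow alpha.1 e * e ^+ (m + l))%:C *
    (cexp (- (lam.1 + (m + l)%:R + l%:R / p%:R) * t1%:C)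
     * cexp (- (lam.2 - l%:R / p%:R) * t2%:C)) =
  (sgnpow beta.1 e)%:C * (cexp (- nu.1 * t1%:C) * cexp (- nu.2 * t2%:C)).
Proof.
move=> he G0; have := germ_weight m t1 t2 Q he SLpm1.
rewrite invmx1 poly_rep1 (irr_rep1 hvarpi) id_lfunE det1 !(sgnpow_gt0 _ ltr01) !mulr1.
by move=> /eqP; rewrite -subr_eq0 -scalerBl scaler_eq0 (negbTE G0) orbF subr_eq0 => /eqP.
Qed.

Lemma germ_nu m l (Q : dhomog p R[i] l) : germ_linear m l Q != 0 ->
  nu = (lam.1 + (m + l)%:R + l%:R / p%:R, lam.2 - l%:R / p%:R).
Proof.
move=> G0; have h1 : (1 : R) = 1 \/ (1 : R) = -1 by left.
have E t1 t2 := germ_weight1 t1 t2 h1 G0.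
have key (a b : R[i]) : (forall t : R, cexp (- a * t%:C) = cexp (- b * t%:C)) -> b = a.
  move=> h; apply/eqP; rewrite -subr_eq0; apply/eqP; apply: cexp_trivial => t.
  have -> : (b - a) * t%:C = - a * t%:C + - (- b * t%:C) by ring.
  by rewrite cexpD cexpN h mulfV// cexp_neq0.
rewrite [nu]surjective_pairing; congr (_, _); apply: key => t.
  by have := E t 0; rewrite !(sgnpow_gt0 _ ltr01) expr1n !mulr1 !mulr0 cexp0 !mulr1 !mul1r.
by have := E 0 t; rewrite !(sgnpow_gt0 _ ltr01) expr1n !mulr1 !mulr0 cexp0 !mul1r.
Qed.

Lemma germ_beta m l (Q : dhomog p R[i] l) : germ_linear m l Q != 0 ->
  beta.1 = alpha.1 (+) odd (m + l).
Proof.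
move=> G0; have h1 : (-1 : R) = 1 \/ (-1 : R) = -1 by right.
have := germ_weight1 0 0 h1 G0; rewrite !mulr0 !cexp0 !mulr1.
rewrite -(sgnpow_odd _ h1) -sgnpow_addb ?oppr_eq0 ?oner_eq0//.
move=> /(congr1 (@complex.Re R)) /=; rewrite /sgnpow sgrN sgr1.
by case: beta.1; case: (alpha.1 (+) odd _) => // /eqP; rewrite ?eqNr ?oner_eq0 // eq_sym eqNr oner_eq0.
Qed.

Lemma germ_twisted m l : twisted varpi alpha.2 beta.2 (germ_linear m l).
Proof.
move=> g Q hg; have [hi _ _] := SLpm_inv hg.
have h1 : (1 : R) = 1 \/ (1 : R) = -1 by left.
have := germ_weight m 0 0 Q h1 hi.
rewrite invmxK !mulr0 cexp0 !mulr1 expr1n mulr1 !(sgnpow_gt0 _ ltr01) !mul1r.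
have -> : \det (invmx g) = \det g.
  by rewrite det_inv; case: hg => ->; rewrite ?invrN invr1.
by rewrite (linearZ_LR (germ_linear m l)).
Qed.

Lemma weight_inj m l m' l' (mu : R[i] * R[i]) :
  (mu.1 + (m + l)%:R + l%:R / p%:R, mu.2 - l%:R / p%:R) =
  (mu.1 + (m' + l')%:R + l'%:R / p%:R, mu.2 - l'%:R / p%:R) -> (m, l) = (m', l').
Proof.
move=> [E1 E2]; have pn0 : p%:R != 0 :> R[i] by rewrite pnatr_eq0 -lt0n.
have ll : l = l'.
  move: E2 => /addrI /oppr_inj /(mulIf (invr_neq0 pn0)) /eqP.
  by rewrite eqr_nat => /eqP.
rewrite -ll in E1 *; congr (_, _); move: E1 => /addIr /addrI /eqP.
by rewrite eqr_nat eqn_add2r => /eqP.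
Qed.

Lemma germ_unique m l (Q : dhomog p R[i] l) m' l' : germ_linear m l Q != 0 ->
  (m', l') <> (m, l) -> forall Q', germ_linear m' l' Q' = 0.
Proof.
move=> G0 n Q'; apply/eqP/negPn/negP => G0'; apply: n.
by have := germ_nu G0'; rewrite {1}(germ_nu G0) => /weight_inj ->.
Qed.

Lemma at_one_opD m l (Q : dhomog p R[i] l) f : germ_linear m l Q != 0 -> I_ f ->
  at_one D f = (m`!%:R)^-1 *: germ_linear m l (opD m l (fun x => f (expNm x)) 0).
Proof.
move=> G0 If; apply: (at_one_single p0 hvarpi hD If) => m' l' n.
exact: (germ_unique G0 n).
Qed.

(** Translation by diag(g, 1) moves the point of evaluation to the identity, where [at_one_opD]
    applies; [DD] is defined by the same translation. *)
Lemma Diff_DD m l (Q : dhomog p R[i] l) f : germ_linear m l Q != 0 -> I_ f ->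
  D f = fun g => (m`!%:R)^-1 *: DD m (germ_linear m l) f g.
Proof.
move=> G0 If; apply/funext => g; rewrite /DD; case: ifPn => [Gg|Gg]; last first.
  by rewrite scaler0; have [_ h _] := Diff_to hD If; apply: h; exact/negP.
have Gi : GL (invmx g) by exact: GL_inv.
have Ge : GL (embG (invmx g)) by exact/GL_embG.
rewrite -(at_one_opD G0 (f := fun x => f (embG g *m x))).
  have -> : (fun x => f (embG g *m x)) = ltransl (embG (invmx g)) f.
    by apply/funext => x; rewrite /ltransl (embG_inv Gg) invmxK.
  by rewrite /at_one (Diff_intertwining hD If Gi) /ltransl invmxK mulmx1.
have -> : (fun x => f (embG g *m x)) = ltransl (embG (invmx g)) f.
  by apply/funext => x; rewrite /ltransl (embG_inv Gg) invmxK.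
exact: Ind_ltransl.
Qed.

Lemma inversion_continuous (xi : 'rV[R]_p) :
  {for (0 : 'cV[R]_p), continuous (fun x => embx ((1 + pairing xi x)^-1 *: x))}.
Proof.
have oH := @open_halfspace R p xi.
apply: mx_continuous => i j; rewrite (ord1 j).
have [[k ->]|->] := ord_widenP i; last first.
  have -> : (fun y => embx ((1 + pairing xi y)^-1 *: y) ord_max ord0) = fun=> 0.
    by apply/funext => y; rewrite embx_max.
  exact: cst_continuous.
have -> : (fun y => embx ((1 + pairing xi y)^-1 *: y) (widen_ord (leqnSn p) k) ord0) =
    fun y => (1 + pairing xi y)^-1 * y k ord0.
  by apply/funext => y; rewrite embx_widen mxE.
have s1 : smooth_on (halfspace xi) (fun y => (1 + pairing xi y)^-1).
  exact: (smooth_inv oH (fun y Hy => lt0r_neq0 Hy) (smooth_pairing xi oH)).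
exact: (smooth_continuous (smooth_mul oH s1 (smooth_coord oH k ord0)) (halfspace0 xi)).
Qed.

(* Transporting the germ x_n^m (xi x)^(l-1), which is invisible to [at_one],
   by exp(xi) in N'_+ produces the l-jet (lam.1 + m + l - 1) (xi x)^l. *)
Lemma germ_bol m l (Q : dhomog p R[i] l) : germ_linear m l Q != 0 ->
  l = 0%N \/ lam.1 + m%:R = 1 - l%:R.
Proof.
case: l Q => [|l'] Q G0; [by left|right].
(* The weight of the translated germ: lam_1 from the section, m from the derivatives in x_n, l' from
   the degree in x'. *)
pose mu := lam.1 + m%:R + l'%:R.
suff mu0 : mu = 0.
  by rewrite -[l'.+1]addn1 natrD opprD addrCA subrr addr0 -[LHS](addrK l'%:R) -/mu mu0 sub0r.
apply/eqP/negPn/negP => mu0; move: (G0); apply/negP/negPn.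
rewrite (lpow_span (T := germ_linear m l'.+1)) ?eqxx// => xi.
have h1 : (1 : R) = 1 \/ (1 : R) = -1 by left.
have If := cut_Ind (ltn0Sn p) alpha lam (csmooth_mono m (lpow xi l')).
have If' := translate_Ind p0 0 0 xi h1 SLpm1 If.
set f := cut _ _ _ in If If'; set f' := fun g => _ in If'.
have n' : (m, l') <> (m, l'.+1) by case; exact: n_Sn.
(* D sees only jets of type (m, l' + 1), so it kills f, whose germ has type (m, l'), and by
   equivariance also the translate f'. *)
have Z : germ_linear m l'.+1 (opD m l'.+1 (fun x => f' (expNm x)) 0) = 0.
  have : at_one D f' = 0.
    rewrite /f' (at_one_translate p0 hD 0 0 xi h1 SLpm1 If).
    have -> : at_one D f = germ_linear m l' (lpow xi l') by [].
    by rewrite (germ_unique G0 n') linear0.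
  move=> /eqP; rewrite (at_one_opD G0 If') scaler_eq0 invr_eq0 pnatr_eq0.
  by rewrite eqn0Ngt fact_gt0 => /eqP.
have fm : \forall x \near (0 : 'cV[R]_q), f (expNm x) = mono m (lpow xi l') x.
  exact: cut_near.
have dl : \forall x \near (0 : 'cV[R]_p),
    dlast m (fun y => f (expNm y)) (embx ((1 + pairing xi x)^-1 *: x)) =
    m`!%:R * polyfun (lpow xi l') ((1 + pairing xi x)^-1 *: x).
  pose s := nseq m (ord_max : 'I_q, ord0 : 'I_1).
  pose P y := cpderivs s (fun y => f (expNm y)) y = cpderivs s (mono m (lpow xi l')) y.
  have nr : nbhs (embx ((1 + pairing xi 0)^-1 *: (0 : 'cV[R]_p))) [set y | P y].
    by rewrite scaler0 embx0; exact: (cpderivs_near s fm).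
  (* The substitution x |-> x / (1 + xi x) is continuous and fixes 0, so it preserves equalities of
     germs. *)
  have nr' : \forall x \near (0 : 'cV[R]_p), P (embx ((1 + pairing xi x)^-1 *: x)).
    exact: (inversion_continuous (xi := xi) nr).
  apply: filterS nr' => x hx.
  rewrite dlastE hx cpderivs_lastpow_last; last exact: csmooth_polyfun.
  by rewrite /lastpow subnn expr0 mul1r ffactnn resx_embx.
have jet' v : polyfun (jet l'.+1 (fun x => dlast m (fun y => f' (expNm y)) (embx x))) v =
    - mu * m`!%:R * (pairing xi v)%:C ^+ l'.+1.
  apply: (jet_power (b := xi)); apply: filterS2 dl (near_halfspace xi) => x dx hx.
  rewrite (dlast_translate p0 If 0 0 h1 SLpm1 m hx).
  have -> : kap alpha lam 1 0 0 (1%:M : 'M[R]_p) = 1.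
    by rewrite /kap det1 !(sgnpow_gt0 _ ltr01) !mulr0 cexp0 !mulr1.
  have -> : ((1 * expR 0)^-1 * cfac p 0 0) *: 1%:M = 1%:M :> 'M[R]_p.
    by rewrite /cfac subrr mul0r expR0 !mulr1 invr1 scale1r.
  rewrite mul1mx dx expR0 mulr1 invr1 expr1n !mul1r polyfun_lpow pairingZ.
  rewrite rmorphM exprMn fmorphV.
  (* The power (xi x)^l' at x / (1 + xi x) leaves a factor (1 + xi x)^(-l'), which raises the weight
     from lam_1 + m to [mu]. *)
  have -> : cexp (- mu * (ln (1 + pairing xi x))%:C) =
      cexp (- (lam.1 + m%:R) * (ln (1 + pairing xi x))%:C) * ((1 + pairing xi x)%:C)^-1 ^+ l'.
    rewrite -(cexp_ln hx) -cexpN -cexpMn -cexpD; congr cexp; rewrite /mu; ring.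
  by ring.
have oE : opD m l'.+1 (fun x => f' (expNm x)) 0 = (- mu * m`!%:R) *: lpow xi l'.+1.
  apply: dhomog_polyfun_inj => v.
  apply: etrans _ (esym (polyfun_scale (lpow xi l'.+1) _ v)); rewrite polyfun_lpow -jet'.
  by rewrite (opD_jet m l'.+1 (@openT _) (csmooth_chart If')).
move: Z; rewrite oE (linearZ_LR (germ_linear m l'.+1)) => /eqP.
by rewrite scaler_eq0 mulf_eq0 oppr_eq0 (negbTE mu0) pnatr_eq0 eqn0Ngt fact_gt0 => /eqP.
Qed.
End Invariance.

(** * Spanning and vanishing of the space of operators *)

Section Classification.
Variables (R : realType) (p : nat).
Hypothesis p0 : (0 < p)%N.
Variables (alpha beta : bool * bool) (lam nu : R[i] * R[i]).
Variables (W : vectType R[i]) (varpi : 'M[R]_p -> 'End(W)).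
Hypothesis hvarpi : irr_rep varpi.
Local Notation I_ := (Ind (@triv_rep R p.+1) alpha lam).
Local Notation J_ := (Ind varpi beta nu).
Implicit Types D E : ('M[R]_p.+2 -> R[i]^o) -> ('M[R]_p.+1 -> W).

(** [Diff] constrains an operator on I only, because I is stable under linear combinations and
    translations. *)
Lemma Diff_ext D E : Diff I_ J_ E -> (forall f, I_ f -> D f = E f) -> Diff I_ J_ D.
Proof.
move=> hE DE; split.
- by move=> f If; rewrite (DE _ If); exact: (Diff_to hE If).
- move=> a f h If Ih; rewrite (DE _ If) (DE _ Ih) (DE _ (Ind_lin a If Ih)).
  exact: (Diff_linear hE).
- move=> f If K' k' e cK KU e0; have [K [k [d [cK1 KU1 d0 h]]]] := Diff_continuous hE If k' cK KU e0.
  exists K, k, d; split=> // f' If'; rewrite (DE _ If) (DE _ If'); exact: h.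
- by move=> f If; rewrite (DE _ If); exact: (Diff_local hE If).
- move=> f h If Gh; have Ge : GL (embG h) by exact/GL_embG.
  by rewrite (DE _ If) (DE _ (Ind_ltransl Ge If)); exact: (Diff_intertwining hE If Gh).
Qed.

Lemma Diff_zero : Diff I_ J_ (fun _ _ => 0).
Proof.
split.
- by move=> f _; exact: Ind_zero.
- by move=> a f h _ _; apply/funext => g; rewrite scaler0 addr0.
- move=> f _ K' k' e _ _ e0; exists set0, 0%N, 1; split=> //; first exact: compact0.
  by move=> h _ _ c s x _ _; rewrite subrr normr0.
- move=> f _ g [+ _]; have -> : [set g : 'M[R]_p.+1 | (0 : W) != 0] = set0.
    by apply/seteqP; split => x //=; rewrite eqxx.
  by rewrite closure0.
- by [].
Qed.

Lemma at_one_full D : Diff I_ J_ D -> (forall f, I_ f -> at_one D f = 0) ->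
  forall f, I_ f -> D f = fun=> 0.
Proof.
move=> hD h f If; apply/funext => g.
have [Gg|Gg] := pselect (GL g); last by have [_ h0 _] := Diff_to hD If; exact: h0.
have Gi := GL_inv Gg; have Ge : GL (embG (invmx g)) by exact/GL_embG.
have := h _ (Ind_ltransl Ge If).
by rewrite /at_one (Diff_intertwining hD If Gi) /ltransl invmxK mulmx1.
Qed.

(** If every T_(m,l) vanishes, then so does D f at the identity for all f in I, and translating f
    reaches the other points. *)
Lemma Diff_dichotomy D (hD : Diff I_ J_ D) :
  (exists m l (Q : dhomog p R[i] l), germ_linear hD m l Q != 0) \/
  (forall f, I_ f -> D f = fun=> 0).
Proof.
have [|h] := pselect (exists m l (Q : dhomog p R[i] l), germ_linear hD m l Q != 0); first by left.
right; apply: (at_one_full hD) => f If.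
have Z m l (Q : dhomog p R[i] l) : germ_mono alpha lam D m Q = 0.
  by apply/eqP/negPn/negP => n; apply: h; exists m, l, Q.
by rewrite (at_one_single p0 hvarpi hD (m := 0) (l := 0) If) => [|m' l' _]; rewrite Z ?scaler0.
Qed.

(** The common core of the two families, the first one being the case l = 0. As nu determines (m,
    l), every non-zero operator has the same type, and uniqueness of T makes it a multiple of
    [DD]. *)
Lemma Diff_spanned_DD m l (T : {linear dhomog p R[i] l -> W}) :
  bijective T -> twisted varpi alpha.2 beta.2 T ->
  beta.1 = alpha.1 (+) odd (m + l) ->
  nu = (lam.1 + (m + l)%:R + l%:R / p%:R, lam.2 - l%:R / p%:R) ->
  l = 0%N \/ lam.1 + m%:R = 1 - l%:R ->
  Diff_spanned I_ J_ (fun F x => T (opD m l F x)).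
Proof.
move=> bT hT hb hnu hl; exists (DD m T); split.
- exact: DD_Diff.
- by move=> f x If; exact: (DD_chart m T x If).
move=> D; split=> [hD|[c Dc]].
  have [[m' [l' [Q G0]]]|Z] := Diff_dichotomy hD; last first.
    by exists 0 => f If; rewrite (Z _ If); apply/funext => g; rewrite scale0r.
  have := germ_nu p0 hvarpi G0; rewrite {1}hnu => /(weight_inj p0) [mm ll].
  move: mm ll G0; move: m' l' Q => m' l' Q mm ll; subst m' l' => G0.
  have [a ha] := twisted_unique hvarpi hT bT (germ_twisted p0 hvarpi hD m (l:=l)).
  exists ((m`!%:R)^-1 * a) => f If; rewrite (Diff_DD p0 hvarpi G0 If); apply/funext => g.
  by rewrite -scalerA /DD; case: ifP => _; rewrite ?ha ?scaler0.
(* Conversely, a multiple of [DD] is the operator attached to c T, which is equivariant even when c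
   = 0, though then not bijective. *)
have lT : linear (fun Q => c *: T Q).
  by move=> a P Q; rewrite linearP scalerDr !scalerA mulrC.
pose cT : {linear dhomog p R[i] l -> W} := HB.pack (fun Q => c *: T Q) (GRing.isLinear.Build _ _ _ _ _ lT).
have hcT : twisted varpi alpha.2 beta.2 cT.
  move=> g Q hg; rewrite /cT /= (hT g Q hg).
  have -> : varpi g (c *: T Q) = c *: varpi g (T Q) by rewrite linearZ.
  by rewrite !scalerA mulrC.
have hE := DD_Diff p0 hvarpi hcT hb hnu hl.
apply: (Diff_ext hE) => f If; rewrite (Dc _ If); apply/funext => g.
by rewrite /DD; case: ifP => _; rewrite ?scaler0.
Qed.

(** Identifies poly^0 with the complex numbers, with inverse [const0], so that the first family
    becomes the case l = 0. *)
Definition coef0 (Q : dhomog p R[i] 0) : R[i]^o := mcoeff mnm0 Q.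

Definition const0 (c : R[i]^o) : dhomog p R[i] 0 := c *: Ydh R 0 mnm0.

Lemma coef0_opD m (F : 'cV[R]_p.+1 -> R[i]) x : coef0 (opD m 0 F x) = opD0 m F x.
Proof.
have E : mdegs p 0 = [:: mnm0].
  apply: perm_small_eq => //; apply: uniq_perm => // [|k]; first exact: mdegs_uniq.
  by rewrite mem_mdegs mdeg_eq0 inE.
rewrite opD_translate opD_sum E big_seq1.
rewrite /coef0 val_dhomogZ mcoeffZ val_Ydh ?mdeg0// ytildeE mcoeffZ mcoeffX eqxx mulr1.
rewrite /mfact big1 => [|j _]; last by rewrite mnm0E.
rewrite invr1 mulr1 /slist mlist0 cats0 cpderivs_translate addr0.
by rewrite /opD0 dlastE.
Qed.

Lemma coef0_lin : linear coef0.
Proof. by move=> a P Q; rewrite /coef0 val_dhomogD val_dhomogZ mcoeffD mcoeffZ. Qed.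

Lemma const0_lin : linear const0.
Proof. by move=> a c d; rewrite /const0 scalerDl scalerA. Qed.

Lemma const0K : cancel const0 coef0.
Proof.
move=> c; rewrite /const0 /coef0 val_dhomogZ mcoeffZ val_Ydh ?mdeg0// ytildeE mcoeffZ mcoeffX eqxx.
by rewrite /mfact big1 ?invr1 ?mulr1// => j _; rewrite mnm0E.
Qed.

Lemma coef0K : cancel coef0 const0.
Proof.
move=> Q; apply: dhomog_mcoeff_inj => k /eqP; rewrite mdeg_eq0 => /eqP ->.
exact: (const0K (coef0 Q)).
Qed.

Lemma coef0_poly_rep g Q : coef0 (poly_rep g Q) = coef0 Q.
Proof.
rewrite /coef0 -(polyfun0 Q) -[LHS]polyfun0.
by apply: etrans (polyfun_poly_rep Q g 0) _; rewrite mulmx0.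
Qed.

Lemma Lambda1_spanned m T : Lambda1 alpha beta varpi lam nu m T ->
  Diff_spanned I_ J_ (fun F x => T (opD0 m F x)).
Proof.
move=> [hb [[S TK KT] hT] hnu].
have lS : linear (fun Q => T (coef0 Q)) by move=> a P Q; rewrite coef0_lin linearP.
pose T' : {linear dhomog p R[i] 0 -> W} := HB.pack (fun Q => T (coef0 Q)) (GRing.isLinear.Build _ _ _ _ _ lS).
have -> : (fun F x => T (opD0 m F x)) = (fun F x => T' (opD m 0 F x)).
  by apply/funext => F; apply/funext => x; rewrite /T' /= coef0_opD.
apply: Diff_spanned_DD.
- exists (fun w => const0 (S w)) => [Q|w]; rewrite /T' /=.
    by rewrite TK coef0K.
  by rewrite const0K KT.
- move=> g Q hg; rewrite -(hT g (coef0 Q) hg) /triv_rep id_lfunE /T' /=; congr (T _).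
  by rewrite /coef0 val_dhomogZ mcoeffZ -/(coef0 (poly_rep g Q)) coef0_poly_rep.
- by rewrite addn0.
- by rewrite addn0 mul0r subr0 addr0.
- by left.
Qed.

Lemma Lambda2_spanned m l (T : {linear dhomog p R[i] l -> W}) :
  Lambda2 alpha beta varpi lam nu m T -> Diff_spanned I_ J_ (fun F x => T (opD m l F x)).
Proof.
move=> [hb [bT hT] hlam hnu]; apply: Diff_spanned_DD => //.
- by rewrite hnu hlam subrK.
- by right; rewrite hlam natrD; ring.
Qed.

(** The isomorphism T required by the labels is the map T_(m,l) of D itself, equivariant by
    [germ_twisted] and bijective because it is non-zero; for l = 0 it is composed with [const0]. *)
Lemma Lambda_of_germ D (hD : Diff I_ J_ D) m l (Q : dhomog p R[i] l) :
  germ_linear hD m l Q != 0 ->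
  (exists m T, Lambda1 alpha beta varpi lam nu m T) \/
  (exists m l T, @Lambda2 R p alpha beta W varpi lam nu m l T).
Proof.
move=> G0; have hb := germ_beta p0 hvarpi G0; have hnu := germ_nu p0 hvarpi G0.
have hT := germ_twisted p0 hvarpi hD m (l:=l).
have bT := twisted_bijective p0 hvarpi hT (ex_intro _ Q G0).
case: (germ_bol p0 hvarpi G0) => [l0|hl]; [left|right].
  move: hb hnu hT bT; clear G0; move: Q; rewrite l0 => _ hb hnu hT [S TK KT].
  have lS : linear (fun c => germ_linear hD m 0 (const0 c)).
    by move=> a c d; rewrite const0_lin linearP.
  pose T' : {linear R[i]^o -> W} := HB.pack (fun c => germ_linear hD m 0 (const0 c)) (GRing.isLinear.Build _ _ _ _ _ lS).
  exists m, T'; split.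
  - by rewrite hb addn0.
  - split.
      exists (fun w => coef0 (S w)) => [c|w].
        by apply: etrans (congr1 coef0 (TK (const0 c))) _; exact: const0K.
      by rewrite -[RHS]KT -[in RHS](coef0K (S w)).
    move=> g c hg; apply: etrans _ (hT g (const0 c) hg).
    rewrite /triv_rep id_lfunE; congr (germ_linear hD m 0 _).
    apply: (can_inj coef0K); rewrite const0K /coef0 val_dhomogZ mcoeffZ -/(coef0 (poly_rep g _)).
    by rewrite coef0_poly_rep const0K.
  - by rewrite hnu addn0 mul0r subr0 addr0.
exists m, l, (germ_linear hD m l); split=> //.
- by rewrite natrD -[LHS](addrK m%:R) hl; ring.
(* Here lam_1 + m + l = 1, which leaves 1 + l / p. *)
- rewrite hnu; congr (_ + _, _); rewrite natrD addrA hl; ring.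
Qed.

End Classification.

Theorem theorem10p3 (R : realType) (n : nat) (hn : (2 <= n)%N)
    (alpha beta : bool * bool)
    (W : vectType R[i]) (varpi : 'M[R]_n.-1 -> 'End(W)) (hvarpi : irr_rep varpi)
    (lam nu : R[i] * R[i]) :
  let I := Ind (@triv_rep R n.-1.+1) alpha lam in
  let J := Ind varpi beta nu in
  [/\ forall m T, Lambda1 alpha beta varpi lam nu m T ->
        Diff_spanned I J (fun F x => T (opD0 m F x)),
      forall m l T, @Lambda2 R n.-1 alpha beta W varpi lam nu m l T ->
        Diff_spanned I J (fun F x => T (opD m l F x)) &
      (forall m T, ~ Lambda1 alpha beta varpi lam nu m T) ->
      (forall m l T, ~ @Lambda2 R n.-1 alpha beta W varpi lam nu m l T) ->
        Diff_trivial I J].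
Proof.
have p0 : (0 < n.-1)%N by case: n hn {varpi hvarpi} => [|[|]].
split.
- by move=> m T; exact: Lambda1_spanned.
- by move=> m l T; exact: Lambda2_spanned.
move=> no1 no2 D; split=> [hD|Z]; last first.
  by apply: (Diff_ext (Diff_zero _ _ _ _ _)) => f If; rewrite Z.
have [[m [l [Q G0]]]|//] := Diff_dichotomy p0 hvarpi hD.
case: (Lambda_of_germ p0 hvarpi G0) => [[m' [T]]|[m' [l' [T]]]].
  by move=> /no1.
by move=> /no2.
Qed.
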